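(* Assume the Setting below with Conditions 1, 2 and 3', and assume $R_E^*=W_{E,\eta\eta}(\theta^*,\eta^* )$ and $W_{P,\theta\theta}(\theta^* )$ are nonsingular. Let $\hat\theta_N$ be the prediction error estimator and $\hat\eta_N$ the second-stage ECF estimator defined below. Then $$\hat\eta_N-\eta^*=-(R_E^* )^{-1}\frac1N V_{E,N\eta}(\hat\theta_N,\eta^* )+O^{Q/(2(p+q))}_M\big(N^{-1}\big).$$
   Context: Setting. Fix $h>0$, an integer $Q\ge2$ and integers $p,q\ge1$ ($p=\dim\theta$, $q=\dim\eta$). $(Z_t)$ is a real-valued Lévy process whose Lévy measure $\nu(dx)=\nu(dx,\eta^* )$ depends on an unknown parameter $\eta^*$ in an open set $G_\eta\subset\mathbb R^q$. Its increments $\Delta Z_n=Z_{nh}-Z_{(n-1)h}$, $n\in\mathbb Z$, are i.i.d., and it is assumed that $\mathbb E[\Delta Z_n]=0$. For $\eta\in G_\eta$, $\varphi(u,\eta)$ ($u\in\mathbb R$) denotes the characteristic function of $\Delta Z_n$ under parameter $\eta$; it is three times continuously differentiable in $\eta$. For $\theta$ in an open set $G_\theta\subset\mathbb R^p$, $A(\theta)$ is a causal time-invariant finite-dimensional linear SISO filter in innovation form, $(A(\theta)x)_n=x_n+\sum_{j\ge1}a_j(\theta)x_{n-j}$, depending three times continuously differentiably on $\theta$. The data are $\Delta y_n=A(\theta^* )\Delta Z_n$, $n\in\mathbb Z$, with unknown $\theta^*\in G_\theta$. The estimated innovation $\varepsilon_n(\theta)$, $n\ge1$, is the output of $A^{-1}(\theta)$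 driven by $(\Delta y_n)_{n\ge1}$ with zero initial conditions; $\varepsilon^*_n(\theta)=A^{-1}(\theta)\Delta y_n$, $n\in\mathbb Z$, is the stationary output. Subscripts $\theta,\eta,\rho$ denote partial derivatives. Condition 1: $\int_{|x|\ge1}|x|^r\,\nu(dx,\eta^* )<\infty$ for all $1\le r\le Q$. Condition 2: for $\theta\in G_\theta$, $A(\theta)$ and $A^{-1}(\theta)$ are exponentially stable: their impulse-response coefficients and their $\theta$-derivatives up to order 3 are bounded by $c\alpha^j$ (lag $j$), with $c>0$, $0<\alpha<1$ uniform on compact subsets of $G_\theta$. PE stage. $W_P(\theta)=\tfrac12\mathbb E[\varepsilon^*_n(\theta)^2]$. $\hat\theta_N$ is a measurably chosen solution in $D_\theta$ of $\sum_{n=1}^N\varepsilon_n(\theta)\varepsilon_{n\theta}(\theta)=0$. ECF stage. Fix $k\ge1$, real $u_1,\dots,u_k$ and a real symmetric positive definite $k\times k$ matrix $K$. $h_n(u;\theta,\eta)=e^{iu\varepsilon_n(\theta)}-\varphi(u,\eta)$, $h^*_n(u;\theta,\eta)=e^{iu\varepsilon^*_n(\theta)}-\varphi(u,\eta)$, $h_n(\theta,\eta)=(h_n(u_1;\theta,\eta),\dots,h_n(u_k;\theta,\eta))^T$, similarly $h^*_n$. $V_{E,N}(\theta,\eta)=\sum_{n=1}^Nh_n(\theta,\eta)^TK^{-1}\overline{h_n(\theta,\eta)}$, $W_E(\theta,\eta)=\mathbb E[h^*_n(\theta,\eta)^TK^{-1}\overline{h^*_n(\theta,\eta)}]$. $\hat\eta_N$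 is a measurably chosen solution in $D_\eta$ of $V_{E,N\eta}(\hat\theta_N,\eta)=0$. Here $D_\rho=D_\theta\times D_\eta$ and $D^*_\rho$ are compact with $(\theta^*,\eta^* )\in D^*_\rho\subset\operatorname{int}D_\rho$, $D_\rho\subset G_\theta\times G_\eta$. Condition 3': the equations $W_{P,\theta}(\theta)=0$ and $W_{E,\eta}(\theta^*,\eta)=0$ have the unique solutions $\theta^*$, resp. $\eta^*$, in $D_\theta$, resp. $D_\eta$. Notation: for random variables $X_N$ and a positive function $f$, $X_N=O^r_M(f(N))$ means $\sup_N\mathbb E^{1/s}|X_N|^s/f(N)<\infty$ for all $1\le s\le r$. *)

(* Defs.v *)
From HB Require Import structures.
From mathcomp Require Import all_boot all_order all_algebra.
From mathcomp Require Import all_classical all_reals all_analysis.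
From mathcomp Require Import complex.

Set Implicit Arguments.
Unset Strict Implicit.
Unset Printing Implicit Defensive.

Import Order.TTheory GRing.Theory Num.Theory.
Import numFieldNormedType.Exports.

Local Open Scope classical_set_scope.
Local Open Scope ring_scope.

Section Calculus.
Variable R : realType.

Definition rseries (u : nat -> R) : R :=
  limn (fun n => \sum_(0 <= j < n) u j).

Definition unitv {p : nat} (i : 'I_p) : 'rV[R]_p := delta_mx 0 i.

Definition pderiv {p : nat} (f : 'rV[R]_p -> R) (i : 'I_p) : 'rV[R]_p -> R :=
  fun x => 'D_(unitv i) f x.

Definition pD {p : nat} (s : seq 'I_p) (f : 'rV[R]_p -> R) : 'rV[R]_p -> R :=
  foldr (fun i g => pderiv g i) f s.

Definition Ck {p : nat} (k : nat) (G : set 'rV[R]_p) (f : 'rV[R]_p -> R) : Prop :=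
  (forall s : seq 'I_p, (size s <= k)%N ->
     forall x, G x -> {for x, continuous (pD s f)}) /\
  (forall s : seq 'I_p, (size s < k)%N ->
     forall (i : 'I_p) x, G x -> derivable (pD s f) x (unitv i)).

Definition grad {p : nat} (f : 'rV[R]_p -> R) (x : 'rV[R]_p) : 'rV[R]_p :=
  \row_i pderiv f i x.

Definition hess {p : nat} (f : 'rV[R]_p -> R) (x : 'rV[R]_p) : 'M[R]_p :=
  \matrix_(i, j) pderiv (pderiv f j) i x.

End Calculus.

Section Complex.
Variable R : realType.
Local Open Scope complex_scope.

Definition cexp (z : R[i]) : R[i] :=
  Complex (expR (complex.Re z) * cos (complex.Im z)) (expR (complex.Re z) * sin (complex.Im z)).

Definition eit (t : R) : R[i] := Complex (cos t) (sin t).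

End Complex.

Section Levy.
Variable R : realType.

Definition levy_measure (nu : {measure set R -> \bar R}) : Prop :=
  nu [set 0] = 0%E /\
  (\int[nu]_x (Num.min 1 (x ^+ 2))%:E < +oo)%E.

(** Levy-Khintchine exponent
    psi(u) = i b u - s2 u^2/2 + int (e^{iux} - 1 - iux 1_{|x|<1}) nu(dx),
    given by its real and imaginary parts *)
Definition lk_exponent (b s2 : R) (nu : {measure set R -> \bar R}) (u : R) : R[i] :=
  Complex (- (s2 * u ^+ 2) / 2 + fine (\int[nu]_x (cos (u * x) - 1)%:E))
          (b * u + fine (\int[nu]_x (sin (u * x) - (if `|x| < 1 then u * x else 0))%:E)).

Definition levy_increment_cf (h b s2 : R) (nu : {measure set R -> \bar R})
    (u : R) : R[i] :=
  cexp ((h%:C)%C * lk_exponent b s2 nu u).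

End Levy.

Section Probability.
Variables (R : realType) (d : measure_display) (T : measurableType d).
Variable (P : probability T R).

Definition mutually_independent (X : int -> T -> R) : Prop :=
  forall (s : seq int) (B : int -> set R), uniq s ->
    (forall i, measurable (B i)) ->
    P (\big[setI/setT]_(i <- s) (X i @^-1` B i)) =
      (\prod_(i <- s) P (X i @^-1` B i))%E.

Definition identically_distributed (X : int -> T -> R) : Prop :=
  forall (n : int) (B : set R), measurable B ->
    P (X n @^-1` B) = P (X 0 @^-1` B).

Definition iid (X : int -> T -> R) : Prop :=
  (forall n, measurable_fun setT (X n)) /\
  mutually_independent X /\ identically_distributed X.

End Probability.

Section Model.
Variable R : realType.

(** a (impulse response a_0 = 1, a_1, a_2, ...) and b are mutually inverse
    causal filters at theta: (sum_i a_i z^i)(sum_j b_j z^j) = 1 *)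
Definition inverse_filter {p : nat} (a b : nat -> 'rV[R]_p -> R) (th : 'rV[R]_p) : Prop :=
  b 0%N th = 1 /\
  forall j : nat, (0 < j)%N -> \sum_(i < j.+1) a i th * b (j - i)%N th = 0.

(** the filter with impulse response a is finite dimensional at theta:
    it has a finite-order state space realisation *)
Definition finite_dim_filter {p : nat} (a : nat -> 'rV[R]_p -> R) (th : 'rV[R]_p) : Prop :=
  exists (n : nat) (F : 'M[R]_n) (g : 'cV[R]_n) (c : 'rV[R]_n),
    forall j : nat, (0 < j)%N -> a j th = (c *m (F ^+ j.-1) *m g) 0 0.

Variables (d : measure_display) (T : measurableType d).

Definition data {p : nat} (a : nat -> 'rV[R]_p -> R) (th0 : 'rV[R]_p)
    (dZ : int -> T -> R) (n : int) (w : T) : R :=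
  rseries (fun j => a j th0 * dZ (n - j%:Z)%R w).

(** estimated innovation eps_n(theta), n >= 1: output of A^{-1}(theta)
    driven by dy_1, ..., dy_n with zero initial conditions *)
Definition eps {p : nat} (b : nat -> 'rV[R]_p -> R) (dy : int -> T -> R)
    (n : nat) (th : 'rV[R]_p) (w : T) : R :=
  \sum_(0 <= j < n) b j th * dy (n%:Z - j%:Z)%R w.

(** stationary output eps*_n(theta) = A^{-1}(theta) dy_n, n in Z *)
Definition eps_star {p : nat} (b : nat -> 'rV[R]_p -> R) (dy : int -> T -> R)
    (n : int) (th : 'rV[R]_p) (w : T) : R :=
  rseries (fun j => b j th * dy (n - j%:Z)%R w).

Definition pe_score {p : nat} (b : nat -> 'rV[R]_p -> R) (dy : int -> T -> R)
    (N : nat) (th : 'rV[R]_p) (w : T) : 'rV[R]_p :=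
  \sum_(1 <= n < N.+1) eps b dy n th w *: grad (fun t => eps b dy n t w) th.

Definition hfun {q : nat} (phi : R -> 'rV[R]_q -> R[i]) (u e : R) (eta : 'rV[R]_q) : R[i] :=
  eit (u * e) - phi u eta.

(** the real number  v^T K^{-1} conj(v)  for v in C^k *)
Definition quadK {k : nat} (K : 'M[R]_k) (v : 'I_k -> R[i]) : R :=
  complex.Re (\sum_(j < k) \sum_(l < k) ((invmx K j l)%:C)%C * v j * conjc (v l)).

Definition VEN {p q k : nat} (u : 'I_k -> R) (K : 'M[R]_k)
    (phi : R -> 'rV[R]_q -> R[i]) (b : nat -> 'rV[R]_p -> R)
    (dy : int -> T -> R) (N : nat) (th : 'rV[R]_p) (eta : 'rV[R]_q) (w : T) : R :=
  \sum_(1 <= n < N.+1) quadK K (fun j => hfun phi (u j) (eps b dy n th w) eta).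

Variable P : probability T R.

(** W_P(theta) = 1/2 E[eps*_n(theta)^2]  (independent of n by stationarity) *)
Definition WP {p : nat} (b : nat -> 'rV[R]_p -> R) (dy : int -> T -> R)
    (th : 'rV[R]_p) : R :=
  fine ('E_P[fun w => eps_star b dy 0 th w ^+ 2]) / 2.

Definition WE {p q k : nat} (u : 'I_k -> R) (K : 'M[R]_k)
    (phi : R -> 'rV[R]_q -> R[i]) (b : nat -> 'rV[R]_p -> R)
    (dy : int -> T -> R) (th : 'rV[R]_p) (eta : 'rV[R]_q) : R :=
  fine ('E_P[fun w => quadK K (fun j => hfun phi (u j) (eps_star b dy 0 th w) eta)]).

End Model.

(* Main.v *)
(** Both estimators are roots of perturbed scores.  If [F] is within [e] of a
    score [G] with a simple isolated zero [x0], in [C^1] near [x0] and in [C^0]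
    elsewhere, then for small [e] comparison with the simplified Newton map
    shows that [F] has a root and that every root [x] of [F] satisfies
    [|x - x0| = O(e)] and [|x - x0 + F(x0) G'(x0)^-1| = O(e^2)]; for large [e]
    the last bound is trivial on a compact domain.  The ECF criterion depends
    on the data only through the averages of [cos (u_j eps_n)] and
    [sin (u_j eps_n)], so the remainder is bounded pointwise by [C E_N^2],
    where [E_N] is the error of these averages, and it suffices that [E_N] be
    [O(N^-1/2)] in [L^(2s)].

    [E_N] is at most the error of the i.i.d. averages of [cos (u_j dZ_n)] and
    [sin (u_j dZ_n)], plus a multiple of a geometrically weighted error of the
    empirical autocovariances of [dy] (which controls the prediction error
    score uniformly in [theta], hence [thhat]), plus an exponentially decaying
    transient.  All three are [O(N^-1/2)] in [L^(2s)] as soon as [dZ] has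
    [4s <= Q] moments, by the inequality [E|S_n|^r = O(n^(r/2))] for sums with
    [E(|S_n|^(r-2) S_n D_n) = 0].

    The moments of [dZ] come from Condition 1: the nonnegative trigonometric
    polynomials [(2 - 2 cos (u y))^m], summed over dyadic [u] with weights
    [u^-r], are comparable with [|y|^r], and their expectations are read off
    the characteristic function of a symmetrised increment. *)
Require Import Defs.
From HB Require Import structures.
From mathcomp Require Import all_boot all_order all_algebra.
From mathcomp Require Import all_classical all_reals all_analysis.
From mathcomp Require Import complex.
From mathcomp Require Import measurable_realfun ring lra zify.
Import Order.TTheory GRing.Theory Num.Theory.
Import numFieldNormedType.Exports.
Local Open Scope classical_set_scope.
Local Open Scope ring_scope.
Set Implicit Arguments.
Unset Strict Implicit.
Unset Printing Implicit Defensive.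

(** * Power inequalities and integrals of nonmeasurable functions *)

(** Uniformity in [theta] costs no moments. The coefficients of the inverse filter are deterministic
    and, with their derivatives, geometrically bounded near the domain, so the randomness of the
    prediction error criterion separates from [theta]: one scalar, the weighted covariance error,
    bounds the criterion and its derivatives on the whole domain at once.

    The moment requirement [4 s <= Q] records two squarings: the remainder is quadratic in [E_N],
    and [E_N] contains averages of products of the data, which need twice as many moments of the
    noise. It follows from [s <= Q / (2 (p + q))] because [p + q >= 2].

    The estimators are roots only for those outcomes where a root exists, and the remainder is an
    expression whose measurability is not at hand. Everything up to the bound [C E_N^2] is therefore
    a deterministic estimate at a fixed outcome; expectations are taken of the measurable majorant
    alone. *)

Section PowerInequalities.
Context {R : realType}.
Implicit Types r x y z a b p n d : R.

(** Young's inequality for [x] and [a^(r-1)] with the exponents [r] and [r / (r-1)], rearranged.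
    This gives convexity of the power without derivatives and includes the boundary point
    [a = 0]. *)
Lemma powR_tangent r x a : 1 <= r -> 0 <= x -> 0 <= a ->
  a `^ r + r * a `^ (r - 1) * (x - a) <= x `^ r.
Proof.
move=> r1 x0 a0.
have r0 : 0 < r by lra.
move: r1; rewrite le_eqVlt => /predU1P[<-|r1].
  by rewrite subrr powRr0 !powRr1//; lra.
have rn0 : r != 0 by lra.
have r10 : r - 1 != 0 by lra.
have := @conjugate_powR R x (a `^ (r - 1)) r (r / (r - 1)) x0 (powR_ge0 _ _).
rewrite divr_gt0//; last by lra.
move=> /(_ r0 isT).
have -> : r^-1 + (r / (r - 1))^-1 = 1 by field; rewrite rn0 r10.
move=> /(_ erefl).
rewrite -powRrM mulrCA divff// mulr1 => H.
have E : a `^ (r - 1) * a = a `^ r by rewrite mulrC mulr_powRB1//; lra.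
have : r * (x * a `^ (r - 1)) <= r * (x `^ r / r + a `^ r / (r / (r - 1))).
  by rewrite ler_pM2l.
have -> : r * (x `^ r / r + a `^ r / (r / (r - 1))) = x `^ r + (r - 1) * a `^ r.
  by field; rewrite rn0 r10.
rewrite -E; nra.
Qed.

Lemma powRD_le p a b : 0 <= p -> 0 <= a -> 0 <= b ->
  (a + b) `^ p <= 2 `^ p * (a `^ p + b `^ p).
Proof.
move=> p0 a0 b0; wlog ab : a b a0 b0 / a <= b => [H|].
  by have [/H|/ltW /H] := leP a b; [apply|rewrite addrC [_ `^ p + _]addrC; apply].
apply: (@le_trans _ _ ((2 * b) `^ p)).
  by apply: ge0_ler_powR; rewrite ?nnegrE//; lra.
by rewrite powRM// ler_wpM2l ?powR_ge0// lerDr powR_ge0.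
Qed.

Lemma normr_powR2 x : (`|x| `^ 2) = x ^+ 2.
Proof. by rewrite -[2]/(2%:R) powR_mulrn// -normrX ger0_norm// sqr_ge0. Qed.

Lemma powRBM2 r x : 2 <= r -> `|x| `^ (r - 2) * x ^+ 2 = `|x| `^ r.
Proof.
move=> r2; rewrite -normr_powR2 -powRD; last first.
  by apply/implyP => /eqP; lra.
by have -> : r - 2 + 2 = r by ring.
Qed.

Lemma powRBM1 r x : 1 < r -> `|x| `^ (r - 1) * `|x| = `|x| `^ r.
Proof. by move=> r1; rewrite mulrC mulr_powRB1//; lra. Qed.

Lemma powRBM21 r x : 2 <= r -> `|x| `^ (r - 2) * `|x| = `|x| `^ (r - 1).
Proof.
move=> r2; have := @mulr_powRB1 R `|x| (r - 1) (normr_ge0 x).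
have -> : r - 1 - 1 = r - 2 by ring.
by rewrite [LHS]mulrC => ->//; lra.
Qed.

(** The map [|x|^(r-2) x] is the derivative of [|x|^r / r]. For arguments of equal sign the tangent
    inequality at exponent [r - 1] gives the first term. For opposite signs [|z - x| = |z| + |x|],
    so both values are at most [|z - x|^(r-1)], which is the origin of the second term. *)
Lemma spowR_lipschitz r x z : 2 <= r ->
  `| `|z| `^ (r - 2) * z - `|x| `^ (r - 2) * x | <=
  (r + 1) * (`|z| `^ (r - 2) + `|x| `^ (r - 2)) * `|z - x| + 2 * `|z - x| `^ (r - 1).
Proof.
move=> r2.
have nn (u : R) : 0 <= `|u| `^ (r - 2) by exact: powR_ge0.
have mono (u v : R) : `|u| <= `|v| -> `|u| `^ (r - 1) <= `|v| `^ (r - 1).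
  by move=> uv; apply: ge0_ler_powR; rewrite ?nnegrE//; lra.
have T (u v : R) : `|v| `^ (r - 1) - `|u| `^ (r - 1) <= (r - 1) * `|v| `^ (r - 2) * (`|v| - `|u|).
  have := @powR_tangent (r - 1) `|u| `|v|; rewrite !normr_ge0 => /(_ _ isT isT).
  have -> : r - 1 - 1 = r - 2 by ring.
  by move=> H; have := H ltac:(lra); lra.
have same : (0 <= z /\ 0 <= x) \/ (z <= 0 /\ x <= 0) \/ (`|z - x| = `|z| + `|x|).
  have [z0|z0] := leP 0 z; have [x0|x0] := leP 0 x.
  - by left.
  - by right; right; rewrite (ger0_norm z0) (ltr0_norm x0) ger0_norm; lra.
  - by right; right; rewrite (ltr0_norm z0) (ger0_norm x0) ler0_norm; lra.
  - by right; left; lra.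
have e0 : 0 <= `|z - x| `^ (r - 1) by exact: powR_ge0.
have ss (u v : R) : 0 <= u -> 0 <= v ->
    `| `|u| `^ (r - 2) * u - `|v| `^ (r - 2) * v| <=
    (r + 1) * (`|u| `^ (r - 2) + `|v| `^ (r - 2)) * `|u - v|.
  wlog uv : u v / u <= v => [H u0 v0|u0 v0].
    have [h|/ltW h] := leP u v; first exact: H.
    by rewrite distrC [`|u - v|]distrC [_ `^ _ + _]addrC; exact: H.
  have E w : 0 <= w -> `|w| `^ (r - 2) * w = `|w| `^ (r - 1).
    by move=> w0; rewrite -powRBM21// (ger0_norm w0).
  have H1 := T u v; have nu := nn u; have nv := nn v.
  have Muv : `|u| `^ (r - 1) <= `|v| `^ (r - 1) by apply: mono; rewrite !ger0_norm.
  rewrite !E// distrC ger0_norm; last by rewrite subr_ge0.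
  have -> : `|u - v| = v - u by rewrite distrC ger0_norm// subr_ge0.
  rewrite (_ : `|v| - `|u| = v - u) in H1; last by rewrite !ger0_norm.
  apply: (le_trans H1).
  have h1 : 0 <= (v - u) * (2 * `|v| `^ (r - 2)) by rewrite !mulr_ge0//; lra.
  have h2 : 0 <= (v - u) * ((r + 1) * `|u| `^ (r - 2)) by rewrite !mulr_ge0//; lra.
  lra.
case: same => [[z0 x0]|[[z0 x0]|same]].
- by apply: (le_trans (ss _ _ z0 x0)); lra.
- have := ss (- z) (- x); rewrite !normrN => /(_ ltac:(lra) ltac:(lra)).
  rewrite !mulrN -!opprD !normrN => /le_trans; apply.
  lra.
- apply: (le_trans (ler_normB _ _)).
  rewrite !normrM !(ger0_norm (nn _)) !powRBM21//.
  have h1 : `|z| `^ (r - 1) <= `|z - x| `^ (r - 1).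
    by apply: mono; rewrite same lerDl.
  have h2 : `|x| `^ (r - 1) <= `|z - x| `^ (r - 1).
    by apply: mono; rewrite same lerDr.
  have : 0 <= (r + 1) * (`|z| `^ (r - 2) + `|x| `^ (r - 2)) * `|z - x|.
    by rewrite !mulr_ge0 ?addr_ge0 ?powR_ge0//; lra.
  lra.
Qed.

(** Convexity at the point [z = x + y] gives [|z|^r <= |x|^r + r |z|^(r-2) z y]; [spowR_lipschitz]
    then moves the derivative from [z] back to [x], at the price of the last term. *)
Lemma powR_taylor2 r : 2 <= r -> exists2 C, 0 < C & forall x y,
  `|x + y| `^ r <= `|x| `^ r + r * (`|x| `^ (r - 2) * x) * y
                   + C * (`|x| `^ (r - 2) * y ^+ 2 + `|y| `^ r).
Proof.
move=> r2; set K := 2 `^ (r - 2).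
have K0 : 0 <= K by exact: powR_ge0.
exists (r * ((r + 1) * (K + 1) + 2)) => [|x y].
  by rewrite mulr_gt0//; nra.
set z := x + y.
have nn (u : R) : 0 <= `|u| `^ (r - 2) by exact: powR_ge0.
have h1 : `|z| `^ r <= `|x| `^ r + r * (`|z| `^ (r - 2) * z) * y.
  have := @powR_tangent r `|x| `|z|; rewrite !normr_ge0 => /(_ _ isT isT).
  move=> /(_ ltac:(lra)) H.
  have : `|z| `^ (r - 1) * (`|x| - `|z|) >= `|z| `^ (r - 2) * z * (x - z).
    rewrite -powRBM21// -!mulrA ler_wpM2l//.
    rewrite !mulrBr -!expr2 real_normK ?num_real// lerD2r.
    by rewrite (le_trans (ler_norm _))// normrM.
  have -> : x - z = - y by rewrite /z; ring.
  move=> ?; have : r * (`|z| `^ (r - 2) * z * - y) <= r * (`|z| `^ (r - 1) * (`|x| - `|z|)).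
    by rewrite ler_pM2l//; lra.
  lra.
have h2 := spowR_lipschitz x z r2.
rewrite (_ : z - x = y) in h2; last by rewrite /z; ring.
have h3 : (`|z| `^ (r - 2) * z - `|x| `^ (r - 2) * x) * y <=
   ((r + 1) * (`|z| `^ (r - 2) + `|x| `^ (r - 2)) * `|y| + 2 * `|y| `^ (r - 1)) * `|y|.
  apply: (le_trans (ler_norm _)); rewrite normrM ler_wpM2r//.
have h4 : `|z| `^ (r - 2) <= K * (`|x| `^ (r - 2) + `|y| `^ (r - 2)).
  rewrite /z.
  apply: (@le_trans _ _ ((`|x| + `|y|) `^ (r - 2))).
    apply: ge0_ler_powR; [lra|by rewrite nnegrE|by rewrite nnegrE addr_ge0|exact: ler_normD].
  by apply: powRD_le => //; lra.
have y2 : `|y| * `|y| = y ^+ 2 by rewrite -expr2 real_normK ?num_real.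
have yr : `|y| `^ (r - 2) * y ^+ 2 = `|y| `^ r by exact: powRBM2.
have yr1 : `|y| `^ (r - 1) * `|y| = `|y| `^ r by apply: powRBM1; lra.
rewrite (_ : (_ + _) * `|y| = (r + 1) * ((`|z| `^ (r - 2) + `|x| `^ (r - 2)) * y ^+ 2) + 2 * `|y| `^ r) in h3; last first.
  by rewrite -y2 -yr1; ring.
have h5 : (`|z| `^ (r - 2) + `|x| `^ (r - 2)) * y ^+ 2 <=
    (K + 1) * (`|x| `^ (r - 2) * y ^+ 2 + `|y| `^ r).
  rewrite -yr; have := nn x; have := nn y; have := sqr_ge0 y; move: h4.
  set a := _ `^ _; set b := `|x| `^ _; set c := `|y| `^ _; set s := y ^+ 2 => h4 s0 c0 b0.
  have : (a + b) * s <= (K * (b + c) + b) * s by rewrite ler_wpM2r// lerD2r.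
  have : 0 <= c * s by rewrite mulr_ge0.
  lra.
have h6 : (`|z| `^ (r - 2) * z - `|x| `^ (r - 2) * x) * y <=
    ((r + 1) * (K + 1) + 2) * (`|x| `^ (r - 2) * y ^+ 2 + `|y| `^ r).
  apply: (le_trans h3); rewrite [leRHS]mulrDl; apply: lerD.
    by rewrite -[leRHS]mulrA ler_wpM2l//; lra.
  by rewrite ler_wpM2l// lerDr mulr_ge0// sqr_ge0.
have h7 : r * ((`|z| `^ (r - 2) * z - `|x| `^ (r - 2) * x) * y) <=
    r * (((r + 1) * (K + 1) + 2) * (`|x| `^ (r - 2) * y ^+ 2 + `|y| `^ r)).
  by rewrite ler_wpM2l//; lra.
lra.
Qed.

(** Compare [y^2] with [(d / n) x^2]: in either case one of the two terms on the right suffices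
    alone. The free weight lets the term in [|x|^r] carry a factor of order [1 / n]. *)
Lemma powR_young2 r n x y d : 2 <= r -> 0 < n -> 0 < d ->
  `|x| `^ (r - 2) * y ^+ 2 <= d / n * `|x| `^ r + (n / d) `^ (r / 2 - 1) * `|y| `^ r.
Proof.
move=> r2 n0 d0.
have [h|h] := leP (y ^+ 2) (d / n * x ^+ 2).
  apply: (@le_trans _ _ (d / n * `|x| `^ r)).
    by rewrite -(powRBM2 x r2) [leRHS]mulrCA ler_wpM2l// powR_ge0.
  by rewrite lerDl mulr_ge0// powR_ge0.
apply: (@le_trans _ _ ((n / d) `^ (r / 2 - 1) * `|y| `^ r)); last first.
  by rewrite lerDr mulr_ge0// ?powR_ge0// divr_ge0// ltW.
rewrite -(powRBM2 y r2) mulrA ler_wpM2r ?sqr_ge0//.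
have e (u : R) : `|u| `^ (r - 2) = (u ^+ 2) `^ (r / 2 - 1).
  by rewrite -normr_powR2 -powRrM; congr (_ `^ _); field.
rewrite !e -powRM ?sqr_ge0//; last by rewrite divr_ge0 ?ltW.
apply: ge0_ler_powR; rewrite ?nnegrE ?sqr_ge0//; first by lra.
  by rewrite mulr_ge0 ?sqr_ge0// divr_ge0// ltW.
by have := ltW h; rewrite -ler_pdivlMl ?divr_gt0// invf_div.
Qed.

End PowerInequalities.

Section GeometricSums.
Context {R : realFieldType}.
Implicit Types (x : R).

Lemma geo_sum_le x n : 0 <= x < 1 -> \sum_(0 <= j < n) x ^+ j <= (1 - x)^-1.
Proof.
move=> /andP[x0 x1]; have x1' : 0 < 1 - x by rewrite subr_gt0.
rewrite -[leRHS]mul1r ler_pdivlMr// mulrC.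
suff -> : (1 - x) * \sum_(0 <= j < n) x ^+ j = 1 - x ^+ n by rewrite gerBl exprn_ge0.
elim: n => [|n IH]; first by rewrite big_geq// mulr0 expr0 subrr.
by rewrite big_nat_recr//= mulrDr IH exprS; ring.
Qed.

Lemma mulrn_geo_le x n : 0 <= x < 1 -> n%:R * x ^+ n <= (1 - x)^-1.
Proof.
move=> x01; apply: (le_trans _ (geo_sum_le n x01)); case/andP: x01 => x0 x1.
apply: (@le_trans _ _ (\sum_(0 <= j < n) x ^+ n)).
  by rewrite big_const_nat subn0 iter_addr_0 mulr_natl.
rewrite big_nat [leRHS]big_nat; apply: ler_sum => j /andP[_ jn].
by rewrite ler_wiXn2l ?(ltW x1) ?(ltnW jn).
Qed.
End GeometricSums.

Section NonMeasurableIntegrands.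
Context d {T : measurableType d} {R : realType} (mu : {measure set T -> \bar R}).
Local Open Scope ereal_scope.
Import HBNNSimple.
Implicit Types f g : T -> \bar R.

(** The estimators only enter through expressions that are not known to be
    measurable, so integrals are compared as suprema over simple functions. *)
Lemma ge0_le_integral_nm f g : (forall x, 0 <= f x) -> (forall x, f x <= g x) ->
  \int[mu]_x f x <= \int[mu]_x g x.
Proof.
move=> f0 fg; have g0 x : 0 <= g x by exact: le_trans (fg x).
rewrite !ge0_integralTE//; apply: le_ereal_sup => _ [h /= hf <-].
by exists h => //= x; exact: le_trans (fg x).
Qed.

(** A simple function below [f], set to zero on [N], keeps its integral and lies below [g]
    everywhere. *)
Lemma ge0_ae_le_integral_nm (N : set T) f g : measurable N -> mu N = 0 ->
  (forall x, 0 <= f x) -> (forall x, 0 <= g x) -> (forall x, ~ N x -> f x <= g x) ->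
  \int[mu]_x f x <= \int[mu]_x g x.
Proof.
move=> mN N0 f0 g0 fg; rewrite [leLHS]ge0_integralTE//.
apply: ge_ereal_sup => _ [h /= hf <-].
rewrite -integralT_nnsfun (ge0_negligible_integral mN)//; last 2 first.
- by apply/measurable_EFinP; exact: measurable_funPT.
- by move=> x _; rewrite lee_fin.
rewrite integral_mkcond; apply: ge0_le_integral_nm => x.
  by apply: erestrict_ge0 => y _; rewrite lee_fin.
rewrite patchE; case: ifPn => // /[!inE] -[_ Nx].
exact: le_trans (hf x) (fg _ Nx).
Qed.

Lemma ae_eq_integral_nm (N : set T) f g : measurable N -> mu N = 0 ->
  (forall x, ~ N x -> f x = g x) -> \int[mu]_x f x = \int[mu]_x g x.
Proof.
move=> mN N0 fg; rewrite integralE [RHS]integralE; congr (_ - _).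
- apply/eqP; rewrite eq_le; apply/andP; split;
    by apply: (ge0_ae_le_integral_nm mN) => // x Nx; rewrite !funeposE fg.
- apply/eqP; rewrite eq_le; apply/andP; split;
    by apply: (ge0_ae_le_integral_nm mN) => // x Nx; rewrite !funenegE fg.
Qed.
End NonMeasurableIntegrands.

(** * Bounds in [L^r] with explicit constants *)

Section LrBounds.
Context d {T : measurableType d} {R : realType} (P : probability T R).
Implicit Types (f g : T -> R) (r K : R).

(** Measurability and the sign of [K] are bundled with the moment bound so that such bounds compose,
    and [K] is explicit so that it can carry the rate in [N]. *)
Definition Lb r K f := [/\ 0 <= K, measurable_fun setT f &
  (\int[P]_w (`|f w| `^ r)%:E <= (K `^ r)%:E)%E].

Lemma measurable_EFin_powR r f : measurable_fun setT f ->
  measurable_fun setT (fun w => (`|f w| `^ r)%:E).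
Proof.
move=> mf; apply/measurable_EFinP.
apply: (@measurableT_comp _ _ _ _ _ _ (fun x : R => x `^ r) _ (fun w => `|f w|)).
  exact: measurable_powR.
exact: measurableT_comp.
Qed.

Lemma Lb_Lnorm r K f : 1 <= r -> Lb r K f -> ('N[P]_r%:E[EFin \o f] <= K%:E)%E.
Proof.
move=> r1 [K0 mf H]; rewrite unlock.
have r0 : r != 0 by lra.
rewrite -[leRHS](_ : (K `^ r)%:E `^ r^-1 = K%:E)%E; last first.
  by rewrite poweR_EFin -powRrM mulfV// powRr1.
apply: gt0_ler_poweR => //; first by rewrite invr_ge0; lra.
- by rewrite in_itv/= leey andbT integral_ge0// => x _; exact: poweR_ge0.
- by rewrite in_itv/= leey andbT lee_fin powR_ge0.
Qed.

Lemma Lnorm_Lb r K f : 1 <= r -> 0 <= K -> measurable_fun setT f ->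
  ('N[P]_r%:E[EFin \o f] <= K%:E)%E -> Lb r K f.
Proof.
move=> r1 K0 mf H; split; [exact: K0|exact: mf|].
have r0 : r != 0 by lra.
under eq_integral do rewrite -poweR_EFin -abse_EFin.
rewrite -(powR_Lnorm P (EFin \o f) r0) -poweR_EFin.
apply: gt0_ler_poweR => //; first lra.
- by rewrite in_itv/= leey andbT Lnorm_ge0.
- by rewrite in_itv/= leey andbT lee_fin.
Qed.

Lemma LbD r K L f g : 1 <= r -> Lb r K f -> Lb r L g ->
  Lb r (K + L) (fun w => f w + g w).
Proof.
move=> r1 hf hg; have [K0 mf _] := hf; have [L0 mg _] := hg.
apply: Lnorm_Lb => //; [exact: addr_ge0|exact: measurable_funD|].
apply: (@le_trans _ _ ('N[P]_r%:E[EFin \o f] + 'N[P]_r%:E[EFin \o g])%E).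
  exact: minkowski_EFin.
by rewrite EFinD; apply: leeD; exact: Lb_Lnorm.
Qed.

Lemma Lb_le r K L f : 0 <= r -> K <= L -> Lb r K f -> Lb r L f.
Proof.
move=> r0 KL [K0 mf H]; split; [exact: le_trans KL|exact: mf|].
apply: (le_trans H); rewrite lee_fin; apply: ge0_ler_powR => //.
by rewrite nnegrE (le_trans K0).
Qed.

Lemma Lb_mono r K f g : 0 <= r -> measurable_fun setT f ->
  (forall w, `|f w| <= `|g w|) -> Lb r K g -> Lb r K f.
Proof.
move=> r0 mf fg [K0 mg H]; split; [exact: K0|exact: mf|apply: le_trans H].
apply: ge0_le_integral_nm => w; rewrite lee_fin ?powR_ge0//.
by apply: ge0_ler_powR.
Qed.

Lemma Lb_eq r K f g : f =1 g -> Lb r K f -> Lb r K g.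
Proof. by move=> /funext ->. Qed.

Lemma LbZ r K a f : 0 <= r -> Lb r K f -> Lb r (`|a| * K) (fun w => a * f w).
Proof.
move=> r0 [K0 mf H]; split; [by rewrite mulr_ge0|exact: measurable_funM|].
under eq_integral do rewrite normrM powRM// EFinM.
rewrite ge0_integralZl ?lee_fin ?powR_ge0//; last exact: measurable_EFin_powR.
by rewrite powRM// EFinM lee_wpmul2l// lee_fin powR_ge0.
Qed.

Lemma Lb_cst r a : 0 <= r -> Lb r `|a| (fun=> a).
Proof.
move=> r0; split; [exact: normr_ge0|exact: measurable_cst|rewrite integral_cst//].
by rewrite [X in (_ * X)%E]probability_setT mule1.
Qed.

Lemma LbN r K f : Lb r K f -> Lb r K (fun w => - f w).
Proof.
move=> [K0 mf H]; split; [exact: K0|exact: measurableT_comp|].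
by under eq_integral do rewrite normrN.
Qed.

Lemma LbB r K L f g : 1 <= r -> Lb r K f -> Lb r L g ->
  Lb r (K + L) (fun w => f w - g w).
Proof. by move=> r1 hf hg; apply: (LbD r1 hf); exact: LbN. Qed.

Lemma Lb_norm r K f : Lb r K f -> Lb r K (fun w => `|f w|).
Proof.
move=> [K0 mf H]; split; [exact: K0|exact: measurableT_comp|].
by under eq_integral do rewrite normr_id.
Qed.

Lemma Lb_sum (I : Type) (s : seq I) r (K : I -> R) (f : I -> T -> R) : 1 <= r ->
  (forall i, Lb r (K i) (f i)) ->
  Lb r (\sum_(i <- s) K i) (fun w => \sum_(i <- s) f i w).
Proof.
move=> r1 H; elim: s => [|i s IH].
  rewrite big_nil; apply: (@Lb_eq _ _ (fun=> 0)) => [w|]; first by rewrite big_nil.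
  by have := @Lb_cst r 0; rewrite normr0; apply; lra.
rewrite big_cons; apply: (@Lb_eq _ _ (fun w => f i w + \sum_(i <- s) f i w)).
  by move=> w; rewrite big_cons.
exact: LbD.
Qed.

Lemma cvg_normr_powR r (u : R^nat) (l : R) : 1 <= r -> u @ \oo --> l ->
  `|u n| `^ r @[n --> \oo] --> `|l| `^ r.
Proof.
move=> r1 cu; have cun : `|u n| @[n --> \oo] --> `|l| by exact: cvg_norm.
have [M [M0 uM]] : exists M, 0 <= M /\ \forall n \near \oo, `|u n| <= M.
  exists (`|l| + 1); split; first by rewrite addr_ge0.
  move/cvgrPdist_le : cun => /(_ 1 ltr01); apply: filterS => n.
  by rewrite ler_norml => /andP[]; lra.
pose B := r * (M `^ (r - 1) + `|l| `^ (r - 1)).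
have B0 : 0 <= B by rewrite mulr_ge0 ?addr_ge0 ?powR_ge0//; lra.
apply/cvgrPdist_le => e e0.
have eB : 0 < e / (B + 1) by rewrite divr_gt0//; lra.
move/cvgrPdist_le : cun => /(_ _ eB) cun.
near=> n.
have hM : `|u n| <= M by near: n.
have hd : `| `|l| - `|u n| | <= e / (B + 1) by near: n.
apply: (@le_trans _ _ (B * `| `|l| - `|u n| |)); last first.
  apply: (@le_trans _ _ (B * (e / (B + 1)))); first by rewrite ler_wpM2l.
  rewrite mulrCA ler_piMr ?(ltW e0)// ler_pdivrMr; lra.
(* The tangent inequalities at [|l|] and at [|u n|] bound the difference of the powers from both
   sides. *)
have T1 := powR_tangent r1 (normr_ge0 (u n)) (normr_ge0 l).
have T2 := powR_tangent r1 (normr_ge0 l) (normr_ge0 (u n)).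
have m : `|u n| `^ (r - 1) <= M `^ (r - 1).
  by apply: ge0_ler_powR; rewrite ?nnegrE//; lra.
have h (a b : R) : 0 <= a -> a <= M `^ (r - 1) + `|l| `^ (r - 1) ->
    r * a * b <= B * `|b|.
  move=> a0 aM; rewrite (le_trans (ler_norm _))// normrM ler_wpM2r//.
  by rewrite ger0_norm ?mulr_ge0 ?ler_wpM2l//; clear -r1; lra.
have h1 := h _ (`|l| - `|u n|) (powR_ge0 `|l| (r - 1)).
have h2 := h _ (`|u n| - `|l|) (powR_ge0 `|u n| (r - 1)).
rewrite lerDr powR_ge0 in h1; rewrite (le_trans m) ?lerDl ?powR_ge0// distrC in h2.
have {}h1 := h1 isT; have {}h2 := h2 isT.
clear -T1 T2 h1 h2.
by rewrite ler_norml; apply/andP; split; lra.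
Unshelve. all: by end_near. Qed.

(** Infinite sums of noise variables are handled as pointwise limits of finite sums with a common
    constant; both the constant and measurability survive the limit. *)
Lemma Lb_fatou r K (f_ : nat -> T -> R) f : 1 <= r -> (forall n, Lb r K (f_ n)) ->
  (forall w, f_ ^~ w @ \oo --> f w) -> Lb r K f.
Proof.
move=> r1 H cf; have [K0 _ _] := H 0%N.
have mf : measurable_fun setT f.
  apply: (@measurable_fun_cvg _ _ _ _ f_) => [n|w _]; last exact: cf.
  by have [] := H n.
split; [exact: K0|exact: mf|].
pose F n w := (`|f_ n w| `^ r)%:E.
have Fc w : F ^~ w @ \oo --> (`|f w| `^ r)%:E.
  by apply/fine_cvgP; split; [exact: nearW|exact: (cvg_normr_powR r1 (cf w))].
have -> : (\int[P]_w (`|f w| `^ r)%:E = \int[P]_w limn_einf (F ^~ w))%E.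
  apply: eq_integral => w _; rewrite is_cvg_limn_einfE; last first.
    by apply/cvg_ex; eexists; exact: Fc.
  by apply/esym/cvg_lim => //; exact: Fc.
apply: (le_trans (fatou P measurableT _ _)).
- by move=> n; apply: measurable_EFin_powR; have [] := H n.
- by move=> n w _; rewrite lee_fin powR_ge0.
rewrite limn_einf_lim; apply: lime_le; first exact: is_cvg_einfs.
apply: nearW => n; apply: (@le_trans _ _ (\int[P]_w F n w)%E).
  by apply: ereal_inf_lbound; exists n => //=.
by have [] := H n.
Qed.

Lemma Lb_integrable_powR r K f : Lb r K f ->
  P.-integrable setT (EFin \o (fun w => `|f w| `^ r)).
Proof.
move=> [K0 mf H]; apply/integrableP; split; first exact: measurable_EFin_powR.
rewrite (le_lt_trans _ (ltry (K `^ r)))//; apply: le_trans H.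
by apply: ge0_le_integral_nm => w; rewrite ?abse_ge0// /= ger0_norm// powR_ge0.
Qed.

Lemma integrable_powR_Lb r f : measurable_fun setT f -> 0 < r ->
  P.-integrable setT (EFin \o (fun w => `|f w| `^ r)) ->
  exists K, Lb r K f.
Proof.
move=> mf r0 H; pose I := \int[P]_w (`|f w| `^ r).
have I0 : 0 <= I by apply: Rintegral_ge0 => w _; exact: powR_ge0.
exists (I `^ r^-1); split; [exact: powR_ge0|exact: mf|].
rewrite -powRrM mulVf ?powRr1 ?gt_eqF//.
by rewrite /I /Rintegral fineK// integrable_fin_num.
Qed.

Lemma Lb_subpow r q K f : 0 < r -> r <= q -> Lb q K f -> exists L, Lb r L f.
Proof.
move=> r0 rq hf; have [K0 mf _] := hf; apply: integrable_powR_Lb => //.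
have h : P.-integrable setT (EFin \o (fun w => 1 + `|f w| `^ q)).
  have := integrableD measurableT (finite_measure_integrable_cst P 1 measurableT) (Lb_integrable_powR hf).
  by apply: eq_integrable => // x _; rewrite /= EFinD.
apply: (le_integrable _ _ _ h) => //; first exact: measurable_EFin_powR.
move=> w _; rewrite /= lee_fin (ger0_norm (powR_ge0 _ _)).
rewrite [leRHS]ger0_norm ?addr_ge0 ?powR_ge0//.
have [f1|/ltW f1] := leP `|f w| 1.
  apply: (@le_trans _ _ 1); last by rewrite lerDl powR_ge0.
  have -> : 1 = 1 `^ r :> R by rewrite powR1.
  by apply: ge0_ler_powR; rewrite ?nnegrE// ltW.
by apply: (@le_trans _ _ (`|f w| `^ q)); [exact: ler_powR|rewrite lerDr].
Qed.

Lemma Lb_integrable r K f : 1 <= r -> Lb r K f -> P.-integrable setT (EFin \o f).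
Proof.
move=> r1 hf; have [L hL] := Lb_subpow ltr01 r1 hf.
have := Lb_integrable_powR hL; apply: le_integrable => //.
  by apply/measurable_EFinP; have [] := hf.
by move=> w _ /=; rewrite powRr1// lee_fin normr_id.
Qed.
End LrBounds.

(** * Independence and moment inequalities *)

Section IndependentPair.
Context d {T : measurableType d} {R : realType} (P : probability T R).

Definition indep2 (A B : T -> R) := forall U V : set R,
  measurable U -> measurable V ->
  P (A @^-1` U `&` B @^-1` V) = (P (A @^-1` U) * P (B @^-1` V))%E.

Lemma indep2_comp (A B : T -> R) (f g : R -> R) : measurable_fun setT f ->
  measurable_fun setT g -> indep2 A B -> indep2 (f \o A) (g \o B).
Proof.
move=> mf mg AB U V mU mV.
have mfU : measurable (f @^-1` U) by rewrite -[X in measurable X]setTI; exact: mf.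
have mgV : measurable (g @^-1` V) by rewrite -[X in measurable X]setTI; exact: mg.
exact: AB _ _ mfU mgV.
Qed.

Let law_pair (A B : {RV P >-> R}) (AB : {RV P >-> (R * R)%type}) :
  (forall w, AB w = (A w, B w)) -> indep2 A B ->
  forall S, measurable S ->
  ((distribution P A \x distribution P B) S = distribution P AB S)%E.
Proof.
move=> ABE AB2 S mS; apply: product_measure_unique => // U V mU mV.
rewrite /= /distribution /pushforward -AB2//; congr (P _).
by apply/seteqP; split => w /=; rewrite ABE.
Qed.

Let ge0_integral_indep (A B : {RV P >-> R}) (F : R * R -> \bar R) :
  indep2 A B -> measurable_fun setT F -> (forall z, 0 <= F z)%E ->
  (\int[P]_w F (A w, B w) =
   \int[distribution P A]_x \int[distribution P B]_y F (x, y))%E.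
Proof.
move=> AB2 mF F0.
have mAB : measurable_fun setT (fun w => (A w, B w)).
  by apply: measurable_fun_pair; exact: measurable_funPT.
pose AB : {RV P >-> (R * R)%type} := mfun_Sub (mem_set mAB).
rewrite -(fubini_tonelli1 F)//.
rewrite (eq_measure_integral (distribution P AB)); last first.
  by move=> S mS _; apply: (@law_pair A B AB) => //.
by rewrite ge0_integral_distribution.
Qed.

Lemma ge0_expectationM_indep (A B : T -> R) :
  measurable_fun setT A -> measurable_fun setT B -> indep2 A B ->
  (forall w, 0 <= A w) -> (forall w, 0 <= B w) ->
  (\int[P]_w (A w * B w)%:E = \int[P]_w (A w)%:E * \int[P]_w (B w)%:E)%E.
Proof.
move=> mA mB AB A0 B0.
pose A' : {RV P >-> R} := mfun_Sub (mem_set mA).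
pose B' : {RV P >-> R} := mfun_Sub (mem_set mB).
have mn : measurable_fun setT (fun x : R => `|x|%:E).
  by apply/measurable_EFinP; exact: normr_measurable.
(* Absolute values make the integrand nonnegative on the whole plane, as Tonelli's theorem asks; on
   the values of [A] and [B] they change nothing. *)
have := @ge0_integral_indep A' B' (fun z => (`|z.1| * `|z.2|)%:E).
rewrite /=.
have -> : (\int[P]_w (`|A w| * `|B w|)%:E = \int[P]_w (A w * B w)%:E)%E.
  by apply: eq_integral => w _; rewrite !ger0_norm.
move=> /(_ AB) ->; last 2 first.
- apply/measurable_EFinP; apply: measurable_funM.
    by apply: measurableT_comp; [exact: normr_measurable|exact: measurable_fst].
  by apply: measurableT_comp; [exact: normr_measurable|exact: measurable_snd].
- by move=> z; rewrite lee_fin mulr_ge0.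
have e (C : T -> R) (C' : {RV P >-> R}) : (forall w, C' w = C w) -> (forall w, 0 <= C w) ->
    (\int[distribution P C']_x `|x|%:E = \int[P]_w (C w)%:E)%E.
  move=> CE C0; rewrite ge0_integral_distribution//.
  by apply: eq_integral => w _; rewrite /= CE ger0_norm.
under eq_integral do under eq_integral do rewrite EFinM.
under eq_integral.
  move=> x _; rewrite ge0_integralZl//.
  rewrite (e B B')//; over.
rewrite ge0_integralZr//; last by apply: integral_ge0 => w _; rewrite lee_fin.
by rewrite (e A A').
Qed.

Lemma integrableM_indep (A B : T -> R) : indep2 A B ->
  P.-integrable setT (EFin \o A) -> P.-integrable setT (EFin \o B) ->
  P.-integrable setT (EFin \o (fun w => A w * B w)).
Proof.
move=> AB iA iB; have mA := measurable_int _ iA; have mB := measurable_int _ iB.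
move/measurable_EFinP in mA; move/measurable_EFinP in mB.
apply/integrableP; split; first by apply/measurable_EFinP; exact: measurable_funM.
under eq_integral do rewrite /= normrM.
rewrite ge0_expectationM_indep//; [|exact: measurableT_comp|exact: measurableT_comp|]; last first.
  by apply: (indep2_comp _ _ AB); exact: normr_measurable.
by apply: lte_mul_pinfty => //; rewrite ?integral_ge0 ?ge0_fin_numE// ?integral_ge0//;
  [have /integrableP[] := iA|have /integrableP[] := iB].
Qed.
Let ge0_RintegralM_indep (A B : T -> R) : indep2 A B ->
  P.-integrable setT (EFin \o A) -> P.-integrable setT (EFin \o B) ->
  (forall w, 0 <= A w) -> (forall w, 0 <= B w) ->
  \int[P]_w (A w * B w) = \int[P]_w A w * \int[P]_w B w.
Proof.
move=> AB iA iB A0 B0; rewrite /Rintegral ge0_expectationM_indep//.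
- by rewrite fineM//; exact: integrable_fin_num.
- exact/measurable_EFinP/(measurable_int _ iA).
- exact/measurable_EFinP/(measurable_int _ iB).
Qed.

Lemma RintegralM_indep (A B : T -> R) : indep2 A B ->
  P.-integrable setT (EFin \o A) -> P.-integrable setT (EFin \o B) ->
  \int[P]_w (A w * B w) = \int[P]_w A w * \int[P]_w B w.
Proof.
move=> AB iA iB.
pose p (x : R) : R := (`|x| + x) / 2; pose n (x : R) : R := (`|x| - x) / 2.
have mp : measurable_fun setT p.
  by apply: measurable_funM => //; apply: measurable_funD => //; exact: normr_measurable.
have mn : measurable_fun setT n.
  by apply: measurable_funM => //; apply: measurable_funB => //; exact: normr_measurable.
have p0 x : 0 <= p x by rewrite /p; have := ler_norm (- x); rewrite normrN; lra.
have n0 x : 0 <= n x by rewrite /n; have := ler_norm x; lra.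
have pn x : p x - n x = x by rewrite /p /n; field.
have le_p x : `|p x| <= `|x|.
  by rewrite ger0_norm// /p; have := ler_norm x; lra.
have le_n x : `|n x| <= `|x|.
  by rewrite ger0_norm// /n; have := ler_norm (- x); rewrite normrN; lra.
have ip (C : T -> R) (f : R -> R) : measurable_fun setT f -> (forall x, `|f x| <= `|x|) ->
    P.-integrable setT (EFin \o C) -> P.-integrable setT (EFin \o (f \o C)).
  move=> mf le_f iC; apply: (le_integrable _ _ _ iC) => //.
    apply/measurable_EFinP; apply: measurableT_comp => //.
    exact/measurable_EFinP/(measurable_int _ iC).
  by move=> w _; rewrite /= lee_fin.
have ind (f g : R -> R) mf mg := @indep2_comp A B f g mf mg AB.
have E (f g : R -> R) : measurable_fun setT f -> (forall x, `|f x| <= `|x|) -> (forall x, 0 <= f x) ->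
    measurable_fun setT g -> (forall x, `|g x| <= `|x|) -> (forall x, 0 <= g x) ->
    P.-integrable setT (EFin \o (fun w => f (A w) * g (B w))) /\
    \int[P]_w (f (A w) * g (B w)) = \int[P]_w f (A w) * \int[P]_w g (B w).
  move=> mf lf f0 mg lg g0; split.
    by apply: (integrableM_indep (A := f \o A) (B := g \o B)); [exact: ind|exact: ip|exact: ip].
  by apply: (ge0_RintegralM_indep (A := f \o A) (B := g \o B)); [exact: ind|exact: ip|exact: ip|move=> w; exact: f0|move=> w; exact: g0].
have [i1 e1] := E _ _ mp le_p p0 mp le_p p0.
have [i2 e2] := E _ _ mp le_p p0 mn le_n n0.
have [i3 e3] := E _ _ mn le_n n0 mp le_p p0.
have [i4 e4] := E _ _ mn le_n n0 mn le_n n0.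
have D (C : T -> R) : P.-integrable setT (EFin \o C) ->
    \int[P]_w C w = \int[P]_w p (C w) - \int[P]_w n (C w).
  move=> iC; rewrite -RintegralB//; [|exact: ip|exact: ip].
  by apply: eq_Rintegral => w _; rewrite pn.
rewrite (D A)// (D B)//.
transitivity (\int[P]_w ((p (A w) * p (B w) - p (A w) * n (B w)) -
                         (n (A w) * p (B w) - n (A w) * n (B w)))).
  by apply: eq_Rintegral => w _; rewrite -{1}(pn (A w)) -{1}(pn (B w)); ring.
rewrite RintegralB//.
- by rewrite !RintegralB// e1 e2 e3 e4; ring.
- by have := integrableB measurableT i1 i2; apply: eq_integrable => // w _; rewrite /= EFinB.
- by have := integrableB measurableT i3 i4; apply: eq_integrable => // w _; rewrite /= EFinB.
Qed.
End IndependentPair.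

Section IidSequence.
Context d {T : measurableType d} {R : realType} (P : probability T R).
Variable X : int -> T -> R.
Hypothesis iidX : iid P X.

Let mX n : measurable_fun setT (X n). Proof. by have [] := iidX. Qed.

(** A pi-system generating the sigma-algebra of all [X i] with [i != m]. The family [B] runs over
    all integers and is full outside [s], so that two cylinders intersect index by index. *)
Definition cylinders (m : int) : set (set T) := [set S |
  exists (s : seq int) (B : int -> set R), [/\ uniq s, m \notin s,
    forall i, measurable (B i), forall i, i \notin s -> B i = setT &
    S = \bigcap_i (X i @^-1` B i)]].

Let bigcapE (s : seq int) (B : int -> set R) : (forall i, i \notin s -> B i = setT) ->
  \bigcap_i (X i @^-1` B i) = \big[setI/setT]_(i <- s) (X i @^-1` B i).
Proof.
move=> Bs; rewrite -bigcap_seq; apply/seteqP; split => w /= H i.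
  by move=> _; exact: H.
move=> _; have [is_|/Bs ->//] := boolP (i \in s); exact: H.
Qed.

Lemma cylindersI m : setI_closed (cylinders m).
Proof.
move=> _ _ [s1 [B1 [u1 m1 mB1 s1B ->]]] [s2 [B2 [u2 m2 mB2 s2B ->]]].
exists (undup (s1 ++ s2)), (fun i => B1 i `&` B2 i); split.
- exact: undup_uniq.
- by rewrite mem_undup mem_cat negb_or m1.
- by move=> i; exact: measurableI.
- move=> i; rewrite mem_undup mem_cat negb_or => /andP[i1 i2].
  by rewrite s1B// s2B// setTI.
- apply/seteqP; split => w /=.
    by move=> [h1 h2] i _; split; [exact: h1|exact: h2].
  by move=> h; split => i _; have [] := h i I.
Qed.

Lemma cylinders_measurable m : cylinders m `<=` measurable.
Proof.
move=> _ [s [B [us ms mB sB ->]]]; rewrite (bigcapE sB).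
apply: bigsetI_measurable => i _; rewrite -[X in measurable X]setTI.
exact: mX.
Qed.

Let P_fin (S : set T) : measurable S -> P S \is a fin_num.
Proof. exact: fin_num_measure. Qed.

(** Dynkin's argument: the events independent of [X m] form a lambda-system. It contains the
    cylinders, by mutual independence applied to the list [m :: s]. *)
Lemma sigma_cylinders_indep m (S : set T) (V : set R) :
  <<s cylinders m >> S -> measurable V ->
  P (S `&` X m @^-1` V) = (P S * P (X m @^-1` V))%E.
Proof.
move=> sS mV; set E := X m @^-1` V.
have mE : measurable E by rewrite -[X in measurable X]setTI; exact: mX.
suff : <<s cylinders m >> `<=` [set S | measurable S /\ P (S `&` E) = (P S * P E)%E].
  by move=> /(_ _ sS) [].
apply: lambda_system_subset => //.
- exact: cylindersI.
- apply/dynkin_lambda_system; split => /=.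
  + by split; [exact: measurableT|rewrite setTI probability_setT mul1e].
  + move=> B [mB PB]; split; first exact: measurableC.
    have [fB fE] := (P_fin mB, P_fin mE).
    have -> : ~` B `&` E = E `\` B by rewrite setDE setIC.
    have PB' : P (E `&` B) = (P B * P E)%E by rewrite setIC.
    have Efin : (P E < +oo)%E by rewrite ltey_eq fE.
    have DE : P (E `\` B) = (P E - P (E `&` B))%E := measureD mE mB Efin.
    rewrite DE PB' probability_setC//.
    by rewrite muleBl ?mul1e// fin_num_adde_defl// fin_numN.
  + move=> F tF HF.
    have mF n : measurable (F n) by have [] := HF n.
    split; first exact: bigcupT_measurable.
    rewrite setI_bigcupl.
    rewrite (measure_bigcup P setT (fun i => F i `&` E)); last 2 first.
    * by move=> i _; exact: measurableI.
    * exact: trivIset_setIr.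
    rewrite measure_bigcup// -(fineK (P_fin mE)) muleC -nneseriesZl; last first.
      by move=> i _; exact: measure_ge0.
    apply: eq_eseriesr => n _; have [_ Hn] := HF n.
    by rewrite fineK ?P_fin// muleC; exact: Hn.
- move=> C cC; split; first exact: cylinders_measurable cC.
  have [s [B [us ms mB sB ->]]] := cC.
  have [_ [ind _]] := iidX.
  pose B' i := if i == m then V else B i.
  have mB' i : measurable (B' i) by rewrite /B'; case: ifP.
  have := ind (m :: s) B'; rewrite /= ms us => /(_ isT mB').
  rewrite !big_cons /B' eqxx -/E.
  rewrite (eq_big_seq (fun i => X i @^-1` B i)); last first.
    by move=> i si; rewrite ifN//; apply: contraNneq ms => <-.
  rewrite [in RHS](eq_big_seq (fun i => P (X i @^-1` B i))); last first.
    by move=> i si; rewrite ifN//; apply: contraNneq ms => <-.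
  rewrite (bigcapE sB) (ind s B us mB) setIC muleC => H; exact: H.
Qed.

(** Measurability with respect to all noise variables except [X m]. Since no time order is imposed,
    past and future indices are treated alike. *)
Definition off_index (m : int) (A : T -> R) :=
  measurable_fun [set: g_sigma_algebraType (cylinders m)] A.

Lemma off_index_X m i : i != m -> off_index m (X i).
Proof.
move=> im _ U mU; rewrite setTI; apply: sub_gen_smallest.
exists [:: i], (fun j => if j == i then U else setT); split => //.
- by rewrite inE eq_sym.
- by move=> j; case: ifP.
- by move=> j; rewrite inE => /negbTE ->.
- apply/seteqP; split => w /=.
    by move=> Uw j _; case: eqP => // ->.
  by move=> /(_ i I); rewrite eqxx.
Qed.

Lemma off_index_indep2 m A : off_index m A -> indep2 P A (X m).
Proof.
move=> mA U V mU mV; apply: sigma_cylinders_indep => //.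
by rewrite -[X in _ X]setTI; exact: mA.
Qed.

Lemma ge0_integral_X n (f : R -> R) : measurable_fun setT f -> (forall x, 0 <= f x) ->
  (\int[P]_w (f (X n w))%:E = \int[P]_w (f (X 0 w))%:E)%E.
Proof.
move=> mf f0.
pose X' i : {RV P >-> R} := mfun_Sub (mem_set (mX i)).
have E i : (\int[P]_w (f (X i w))%:E = \int[distribution P (X' i)]_x (f x)%:E)%E.
  by rewrite ge0_integral_distribution//; exact/measurable_EFinP.
rewrite !E; apply: eq_measure_integral => S mS _.
by have [_ [_ idX]] := iidX; exact: idX.
Qed.

Lemma Lb_X r K n (f : R -> R) : measurable_fun setT f ->
  Lb P r K (f \o X 0) -> Lb P r K (f \o X n).
Proof.
move=> mf [K0 mf0 H]; split; [exact: K0|exact: measurableT_comp|].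
apply: le_trans H; rewrite le_eqVlt; apply/orP; left; apply/eqP.
apply: (@ge0_integral_X n (fun x => `|f x| `^ r)); last by move=> x; exact: powR_ge0.
by have /measurable_EFinP := @measurable_EFin_powR _ R R r f mf.
Qed.

Lemma integrable_X n (f : R -> R) : measurable_fun setT f ->
  P.-integrable setT (EFin \o (f \o X 0)) -> P.-integrable setT (EFin \o (f \o X n)).
Proof.
move=> mf /integrableP[_ H]; apply/integrableP; split.
  by apply/measurable_EFinP; exact: measurableT_comp.
have := @ge0_integral_X n (fun x => `|f x|).
by rewrite /= => ->//; exact: measurableT_comp.
Qed.

Lemma Rintegral_X n (f : R -> R) : measurable_fun setT f ->
  P.-integrable setT (EFin \o (f \o X 0)) ->
  \int[P]_w f (X n w) = \int[P]_w f (X 0 w).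
Proof.
move=> mf i0; have iN := integrable_X n mf i0.
pose X' i : {RV P >-> R} := mfun_Sub (mem_set (mX i)).
have E i : P.-integrable setT (EFin \o (f \o X i)) ->
  (\int[P]_w (f (X i w))%:E = \int[distribution P (X' i)]_x (f x)%:E)%E.
  by move=> fi; rewrite integral_distribution//; exact/measurable_EFinP.
rewrite /Rintegral !E//; congr fine; apply: eq_measure_integral => S mS _.
by have [_ [_ idX]] := iidX; exact: idX.
Qed.

Lemma RintegralM_off_index n A (g : R -> R) : measurable_fun setT g -> off_index n A ->
  P.-integrable setT (EFin \o A) -> P.-integrable setT (EFin \o (g \o X 0)) ->
  \int[P]_w (A w * g (X n w)) = \int[P]_w A w * \int[P]_w g (X 0 w).
Proof.
move=> mg oA iA ig; rewrite -(Rintegral_X n)//.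
apply: (@RintegralM_indep _ _ _ P A (g \o X n)) => //.
  by apply: (indep2_comp (f := id) _ mg (off_index_indep2 oA)); exact: measurable_id.
exact: integrable_X.
Qed.

(** Independence factors the moment of the product, so the order [r] is kept; Hoelder's inequality
    would consume moments of order [2 r]. *)
Lemma LbM_off_index r K L n A (g : R -> R) : measurable_fun setT g -> off_index n A ->
  Lb P r K A -> Lb P r L (g \o X 0) -> Lb P r (K * L) (fun w => A w * g (X n w)).
Proof.
move=> mg oA [K0 mA hA] hg; have [L0 _ hgn] := Lb_X n mg hg.
have mgX : measurable_fun setT (g \o X n) by exact: measurableT_comp.
have mr : measurable_fun setT (fun x : R => `|x| `^ r).
  by have /measurable_EFinP := @measurable_EFin_powR _ R R r id ltac:(exact: measurable_id).
split; [exact: mulr_ge0|exact: measurable_funM|].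
under eq_integral do rewrite normrM powRM//.
rewrite ge0_expectationM_indep//; last 3 first.
- by have /measurable_EFinP := measurable_EFin_powR r mA.
- by have /measurable_EFinP := measurable_EFin_powR r mgX.
- apply: (indep2_comp (g := fun x => `|g x| `^ r) mr _ (off_index_indep2 oA)).
  by have /measurable_EFinP := @measurable_EFin_powR _ R R r g mg.
rewrite powRM// EFinM; apply: lee_pmul => //;
  by apply: integral_ge0 => w _; rewrite lee_fin powR_ge0.
Qed.
End IidSequence.

Section MomentInequality.
Context d {T : measurableType d} {R : realType} (P : probability T R).
Implicit Types (r K : R) (S D : T -> R).

Definition spowR r (x : R) := `|x| `^ (r - 2) * x.

Lemma normr_spowR r x : 2 <= r -> `|spowR r x| = `|x| `^ (r - 1).
Proof. by move=> r2; rewrite /spowR normrM ger0_norm ?powR_ge0// powRBM21. Qed.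

Lemma measurable_spowR r : measurable_fun setT (spowR r).
Proof.
apply: measurable_funM; last exact: measurable_id.
apply: (@measurableT_comp _ _ _ _ _ _ (fun x : R => x `^ (r - 2)) _ (fun x : R => `|x|)).
  exact: measurable_powR.
exact: normr_measurable.
Qed.

Lemma integrable_spowRM r K L S D : 2 <= r -> Lb P r K S -> Lb P r L D ->
  P.-integrable setT (EFin \o (fun w => spowR r (S w) * D w)).
Proof.
move=> r2 hS hD; have [_ mS _] := hS; have [_ mD _] := hD.
have r1 : 1 < r by lra.
have h : P.-integrable setT (EFin \o (fun w => `|S w| `^ r + `|D w| `^ r)).
  have := integrableD measurableT (Lb_integrable_powR hS) (Lb_integrable_powR hD).
  by apply: eq_integrable => // x _; rewrite /= EFinD.
apply: (le_integrable _ _ _ h) => //.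
  apply/measurable_EFinP; apply: measurable_funM => //.
  exact: (measurableT_comp (measurable_spowR r)).
move=> w _; rewrite /= lee_fin normrM normr_spowR//.
rewrite [leRHS]ger0_norm ?addr_ge0 ?powR_ge0//.
have mono (x y : R) : `|x| <= `|y| -> `|x| `^ (r - 1) <= `|y| `^ (r - 1).
  by move=> xy; apply: ge0_ler_powR; rewrite ?nnegrE//; lra.
have [SD|/ltW DS] := leP `|S w| `|D w|.
  apply: (@le_trans _ _ (`|D w| `^ r)); last by rewrite lerDr powR_ge0.
  by rewrite -(powRBM1 (D w) r1) ler_wpM2r// mono.
apply: (@le_trans _ _ (`|S w| `^ r)); last by rewrite lerDl powR_ge0.
by rewrite -(powRBM1 (S w) r1) ler_wpM2l// powR_ge0.
Qed.

Lemma sqrt_powR r (x : R) : 0 <= x -> (Num.sqrt x) `^ r = x `^ (r / 2).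
Proof. by move=> x0; rewrite -powR12_sqrt// -powRrM mulrC. Qed.

(** Expanding [|S + D|^r] to second order, the orthogonality hypothesis kills
    the linear term, and Young's inequality with weight [1 / n] makes the
    quadratic term contribute at most [E|S|^r / (2 n)]. *)
Lemma moment_sum_orthogonal r : 2 <= r -> exists2 C, 0 <= C &
  forall (D : nat -> T -> R) K, (forall n, Lb P r K (D n)) ->
  (forall n, \int[P]_w (spowR r (\sum_(0 <= i < n) D i w) * D n w) = 0) ->
  forall n, Lb P r (C * K * Num.sqrt n%:R) (fun w => \sum_(0 <= i < n) D i w).
Proof.
move=> r2; have r0 : 0 < r by lra.
have [C0 C00 taylor] := powR_taylor2 r2.
pose h := r / 2; have h1 : 1 <= h by rewrite /h; lra.
(* Chosen so that the Young weight satisfies [C0 * (dl / m) = 1 / (2 m)]. *)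
pose dl := (2 * C0)^-1.
have dl0 : 0 < dl by rewrite invr_gt0; lra.
pose C1 := C0 * ((dl^-1) `^ (h - 1) + 1).
have C10 : 0 <= C1 by rewrite mulr_ge0 ?addr_ge0 ?powR_ge0// ltW.
(* The induction bounds [E|S_m|^r] by [A K^r m^h]. One step adds at most [(A / 2 + C1) K^r m^(h-1)],
   while [(m + 1)^h - m^h >= m^(h-1)]; hence the requirement [A / 2 + C1 <= A]. *)
pose A := 2 * C1 + 1.
have A0 : 0 <= A by rewrite /A; lra.
exists (A `^ r^-1); first exact: powR_ge0.
move=> D K HD orth.
have K0 : 0 <= K by have [] := HD 0%N.
pose S n w := \sum_(0 <= i < n) D i w.
have SS n w : S n.+1 w = S n w + D n w by rewrite /S big_nat_recr.
have key n : Lb P r (A `^ r^-1 * K * Num.sqrt n.+1%:R) (S n.+1).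
  elim: n => [|n IH].
    apply: (@Lb_eq _ _ _ _ _ _ (D 0%N)).
      by move=> w; rewrite SS /S big_geq// add0r.
    apply: Lb_le (HD 0%N) => //; first exact: ltW.
    rewrite sqrtr1 mulr1 ler_peMl//.
    have -> : 1 = 1 `^ r^-1 :> R by rewrite powR1.
    apply: ge0_ler_powR; rewrite ?nnegrE ?invr_ge0 ?(ltW r0)//.
    by rewrite /A; lra.
  have [B0 mS hS] := IH; have [_ mD hD] := HD n.+1.
  set m : R := n.+1%:R in IH B0 hS *.
  have m0 : 0 < m by rewrite ltr0n.
  have m1 : 1 <= m by rewrite ler1n.
  have iS := Lb_integrable_powR IH.
  have iD := Lb_integrable_powR (HD n.+1).
  have iSD := integrable_spowRM r2 IH (HD n.+1).
  pose c := (m / dl) `^ (h - 1).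
  have c0 : 0 <= c by exact: powR_ge0.
  have pt w : `|S n.+2 w| `^ r <= (1 + (2 * m)^-1) * `|S n.+1 w| `^ r +
      (r * (spowR r (S n.+1 w) * D n.+1 w) + C0 * (c + 1) * `|D n.+1 w| `^ r).
    rewrite SS; apply: (le_trans (taylor _ _)).
    have := powR_young2 (S n.+1 w) (D n.+1 w) r2 m0 dl0; rewrite -/h -/c => yo.
    have : C0 * (`|S n.+1 w| `^ (r - 2) * D n.+1 w ^+ 2) <=
           C0 * (dl / m * `|S n.+1 w| `^ r + c * `|D n.+1 w| `^ r).
      by rewrite ler_pM2l.
    have -> : C0 * (dl / m * `|S n.+1 w| `^ r + c * `|D n.+1 w| `^ r) =
       (2 * m)^-1 * `|S n.+1 w| `^ r + C0 * c * `|D n.+1 w| `^ r.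
      by rewrite /dl; field; rewrite gt_eqF// gt_eqF.
    rewrite /spowR; move: ((2 * m)^-1) (`|S n.+1 w| `^ r) (`|D n.+1 w| `^ r) => q a b.
    clear; lra.
  have Kr0 : 0 <= K `^ r by exact: powR_ge0.
  set g := (fun w => (1 + (2 * m)^-1) * `|S n.+1 w| `^ r +
      (r * (spowR r (S n.+1 w) * D n.+1 w) + C0 * (c + 1) * `|D n.+1 w| `^ r)) in pt.
  pose g1 w := (1 + (2 * m)^-1) * `|S n.+1 w| `^ r.
  pose g2 w := r * (spowR r (S n.+1 w) * D n.+1 w).
  pose g3 w := C0 * (c + 1) * `|D n.+1 w| `^ r.
  have i1 : P.-integrable setT (EFin \o g1).
    have := integrableZl measurableT (1 + (2 * m)^-1) iS.
    by apply: eq_integrable => // w _; rewrite /= -EFinM.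
  have i2 : P.-integrable setT (EFin \o g2).
    have := integrableZl measurableT r iSD.
    by apply: eq_integrable => // w _; rewrite /= -EFinM.
  have i3 : P.-integrable setT (EFin \o g3).
    have := integrableZl measurableT (C0 * (c + 1)) iD.
    by apply: eq_integrable => // w _; rewrite /= -EFinM.
  have i23 : P.-integrable setT (EFin \o (fun w => g2 w + g3 w)).
    by have := integrableD measurableT i2 i3; apply: eq_integrable.
  have ig : P.-integrable setT (EFin \o g).
    by have := integrableD measurableT i1 i23; apply: eq_integrable.
  have sS : \int[P]_w `|S n.+1 w| `^ r <= A * K `^ r * m `^ h.
    rewrite -lee_fin /Rintegral fineK; last exact: integrable_fin_num.
    apply: (le_trans hS); rewrite lee_fin !powRM ?mulr_ge0 ?powR_ge0 ?sqrtr_ge0//.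
    by rewrite -powRrM mulVf ?gt_eqF// powRr1// sqrt_powR// ltW.
  have sD : \int[P]_w `|D n.+1 w| `^ r <= K `^ r.
    by rewrite -lee_fin /Rintegral fineK//; exact: integrable_fin_num.
  have Eg : \int[P]_w g w <= A * K `^ r * n.+2%:R `^ h.
    rewrite (_ : \int[P]_w g w = \int[P]_w (g1 w + (g2 w + g3 w)))//.
    rewrite RintegralD// RintegralD// /g1 /g2 /g3 !RintegralZl//.
    rewrite orth mulr0 add0r.
    have m20 : 0 <= (2 * m)^-1 by rewrite invr_ge0 mulr_ge0// ltW.
    apply: (@le_trans _ _ ((1 + (2 * m)^-1) * (A * K `^ r * m `^ h) +
                           C0 * (c + 1) * K `^ r)).
      apply: lerD; first by rewrite ler_wpM2l// addr_ge0.
      by rewrite ler_wpM2l// mulr_ge0 ?(ltW C00)// addr_ge0.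
    have mh0 : 0 <= m `^ (h - 1) by exact: powR_ge0.
    have cE : C0 * (c + 1) <= C1 * m `^ (h - 1).
      have dli0 : 0 <= dl^-1 by rewrite invr_ge0; exact: ltW.
      rewrite /c (powRM _ (ltW m0) dli0).
      rewrite /C1 -mulrA ler_wpM2l ?(ltW C00)// mulrDl mul1r [leRHS]addrC [leLHS]addrC.
      rewrite lerD//; last by rewrite mulrC.
      by rewrite -[leLHS](powRr0 m); apply: ler_powR => //; rewrite subr_ge0.
    have mhE : m `^ h = m * m `^ (h - 1) by rewrite mulr_powRB1// (lt_le_trans ltr01).
    have tg := powR_tangent h1 (ltW (ltr0Sn R n.+1)) (ltW m0).
    have mS1 : n.+2%:R - m = 1 by rewrite /m -(natr1 n.+1) addrAC subrr add0r.
    rewrite mS1 mulr1 in tg.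
    have tg2 : m `^ h + m `^ (h - 1) <= n.+2%:R `^ h.
      by apply: le_trans tg; rewrite lerD2l ler_peMl.
    have AK0 : 0 <= A * K `^ r by rewrite mulr_ge0.
    apply: le_trans (ler_wpM2l AK0 tg2).
    apply: (@le_trans _ _ ((1 + (2 * m)^-1) * (A * K `^ r * m `^ h) +
                           C1 * m `^ (h - 1) * K `^ r)).
      by rewrite lerD2l ler_wpM2r.
    have -> : (1 + (2 * m)^-1) * (A * K `^ r * m `^ h) =
              A * K `^ r * m `^ h + A / 2 * (K `^ r * m `^ (h - 1)).
      by rewrite mhE; field; rewrite gt_eqF.
    have := mulr_ge0 Kr0 mh0; set z := K `^ r * _ => z0.
    have -> : C1 * m `^ (h - 1) * K `^ r = C1 * z by rewrite /z; ring.
    rewrite mulrDr -[A * K `^ r * m `^ (h - 1)]mulrA -/z -addrA lerD2l -mulrDl.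
    by rewrite ler_wpM2r// /A; clear; lra.
  have mS2 : measurable_fun setT (S n.+2).
    by rewrite (_ : S n.+2 = (fun w => S n.+1 w + D n.+1 w));
      [exact: measurable_funD|apply/funext => w; exact: SS].
  split; [by rewrite !mulr_ge0 ?powR_ge0 ?sqrtr_ge0|exact: mS2|].
  apply: (@le_trans _ _ (\int[P]_w (g w)%:E)%E).
    by apply: ge0_le_integral_nm => w; rewrite lee_fin ?powR_ge0.
  have <- : (\int[P]_w g w)%:E = (\int[P]_w (g w)%:E)%E.
    by rewrite /Rintegral fineK//; exact: integrable_fin_num.
  rewrite lee_fin (le_trans Eg)// !powRM ?mulr_ge0 ?powR_ge0 ?sqrtr_ge0//.
  by rewrite -powRrM mulVf ?gt_eqF// powRr1// sqrt_powR.
case=> [|n]; last exact: key.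
rewrite sqrtr0 mulr0; apply: (@Lb_eq _ _ _ _ _ _ (fun=> 0)).
  by move=> w; rewrite big_geq.
by have := @Lb_cst _ T R P r 0 (ltW r0); rewrite normr0.
Qed.
End MomentInequality.

Section IidSums.
Context d {T : measurableType d} {R : realType} (P : probability T R).
Variable X : int -> T -> R.
Hypothesis iidX : iid P X.

Lemma off_index_sum m (I : Type) (s : seq I) (F : I -> T -> R) :
  (forall i, off_index X m (F i)) -> off_index X m (fun w => \sum_(i <- s) F i w).
Proof. by move=> H; apply: measurable_sum => i; exact: H. Qed.

(** The orthogonality hypothesis holds because the earlier partial sum and [H n] avoid the index
    [k n], and [g (X (k n))] is centred and independent of whatever avoids that index. *)
Lemma moment_sum_off_index r : 2 <= r -> exists2 C, 0 <= C &
  forall (k : nat -> int) (H : nat -> T -> R) (g : R -> R) K L,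
  measurable_fun setT g -> Lb P r L (g \o X 0) -> \int[P]_w g (X 0 w) = 0 ->
  (forall n, Lb P r K (H n)) -> (forall n, off_index X (k n) (H n)) ->
  (forall n i, (i < n)%N -> off_index X (k n) (fun w => H i w * g (X (k i) w))) ->
  forall n, Lb P r (C * (K * L) * Num.sqrt n%:R)
    (fun w => \sum_(0 <= i < n) H i w * g (X (k i) w)).
Proof.
move=> r2; have [C C0 HC] := moment_sum_orthogonal P r2; exists C => //.
move=> k H g K L mg hg g0 hH oH oD.
have hD n : Lb P r (K * L) (fun w => H n w * g (X (k n) w)).
  exact: (LbM_off_index iidX mg (oH n)).
apply: HC => // n.
pose S w := \sum_(0 <= i < n) H i w * g (X (k i) w).
have oS : off_index X (k n) S.
  rewrite /S (_ : (fun w => _) = (fun w => \sum_(i < n) H i w * g (X (k i) w))); last first.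
    by apply/funext => w; rewrite big_mkord.
  by apply: off_index_sum => i; exact: oD.
have r1 : 1 <= r by lra.
have hS : Lb P r (\sum_(0 <= i < n) (K * L)) S.
  exact: (@Lb_sum _ T R P _ (index_iota 0 n) r (fun=> K * L)).
pose A w := spowR r (S w) * H n w.
have oA : off_index X (k n) A.
  apply: measurable_funM; last exact: oH.
  exact: (measurableT_comp (measurable_spowR r) oS).
have iA : P.-integrable setT (EFin \o A) := integrable_spowRM r2 hS (hH n).
transitivity (\int[P]_w (A w * g (X (k n) w))).
  by apply: eq_Rintegral => w _; rewrite /A mulrA.
rewrite (RintegralM_off_index iidX)//; first by rewrite g0 mulr0.
exact: (Lb_integrable r1 hg).
Qed.

Lemma moment_iid_sum r : 2 <= r -> exists2 C, 0 <= C &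
  forall (k0 : int) (g : R -> R) L, measurable_fun setT g ->
  Lb P r L (g \o X 0) -> \int[P]_w g (X 0 w) = 0 ->
  forall n, Lb P r (C * L * Num.sqrt n%:R) (fun w => \sum_(0 <= i < n) g (X (k0 + i%:Z) w)).
Proof.
move=> r2; have [C C0 HC] := moment_sum_off_index r2; exists C => // k0 g L mg hg g0 n.
apply: (@Lb_eq _ _ _ _ _ _ (fun w => \sum_(0 <= i < n) 1 * g (X (k0 + i%:Z) w))).
  by move=> w; apply: eq_bigr => i _; rewrite mul1r.
have := HC (fun i => k0 + i%:Z) (fun _ _ => 1) g 1 L mg hg g0.
rewrite mul1r; apply.
- by move=> _; have := @Lb_cst _ T R P r 1; rewrite normr1; apply; lra.
- by move=> m; exact: measurable_cst.
- move=> m i im; apply: measurable_funM; first exact: measurable_cst.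
  apply: measurableT_comp; first exact: mg.
  apply: off_index_X.
  by rewrite (inj_eq (addrI _)) eqz_nat ltn_eqF.
Qed.

(** As the lag is positive, the index [k0 + n] occurs in the [n]-th product only as its second
    factor and in no earlier product. *)
Lemma moment_lagged_sum r K : 2 <= r -> Lb P r K (X 0) -> \int[P]_w X 0 w = 0 ->
  exists2 C, 0 <= C & forall (k0 : int) (l n : nat), (0 < l)%N ->
  Lb P r (C * Num.sqrt n%:R)
    (fun w => \sum_(0 <= i < n) X (k0 + i%:Z - l%:Z) w * X (k0 + i%:Z) w).
Proof.
move=> r2 hX X0; have [C C0 HC] := moment_sum_off_index r2; exists (C * (K * K)).
  by have [K0 _ _] := hX; rewrite !mulr_ge0.
move=> k0 l n l0.
have mid : measurable_fun setT (@id R) by exact: measurable_id.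
apply: (HC (fun i => k0 + i%:Z) (fun i => X (k0 + i%:Z - l%:Z)) id K K mid hX X0).
- by move=> i; exact: (Lb_X iidX _ mid hX).
- by move=> i; apply: off_index_X; lia.
- move=> m i im; apply: measurable_funM; apply: off_index_X; lia.
Qed.
End IidSums.

(** * Moments of Levy increments *)

Section TrigPower.
Context {R : realType}.
Implicit Types u x y v : R.

Lemma normr_sin_le x : `|sin x| <= `|x|.
Proof.
wlog x0 : x / 0 <= x => [H|].
  have [/H//|/ltW x0] := leP 0 x.
  by rewrite -normrN -sinN -[leRHS]normrN; apply: H; lra.
move: x0; rewrite le_eqVlt => /predU1P[<-|x0]; first by rewrite sin0.
have D (t : R) : t \in `]0, x[ -> is_derive t 1 sin (cos t).
  by move=> _; exact: is_derive_sin.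
have Cn : {within `[0, x], continuous (@sin R)}.
  by apply: continuous_subspaceT => t; exact: continuous_sin.
have [c _] := MVT x0 D Cn.
rewrite sin0 !subr0 => ->; rewrite normrM ler_piMl//; exact: cos_max.
Qed.

(** Equal to [|2 sin (u y / 2)|^(2 m)], hence of order [|u y|^(2 m)] near zero, and at the same time
    a cosine polynomial in [u y]. *)
Definition trig_pow (m : nat) u y := (2 - 2 * cos (u * y)) ^+ m.

Let two_sub_cos x : 2 - 2 * cos x = (2 * sin (x / 2)) ^+ 2.
Proof.
have {1}-> : x = (x / 2) *+ 2 by rewrite -mulr_natr; field.
by rewrite cos_mulr2n exprMn sin2cos2 -mulr_natr; ring.
Qed.

Lemma trig_powE m u y : trig_pow m u y = `|2 * sin (u * y / 2)| `^ (m.*2)%:R.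
Proof. by rewrite /trig_pow two_sub_cos powR_mulrn// -exprM mul2n -normrX ger0_norm// exprn_even_ge0// odd_double. Qed.

Lemma trig_pow_ge0 m u y : 0 <= trig_pow m u y.
Proof. by rewrite trig_powE powR_ge0. Qed.

Lemma trig_pow_le m u y : trig_pow m u y <= 4 ^+ m.
Proof.
have c1 := cos_geN1 (u * y); have c2 := cos_le1 (u * y).
by apply: lerXn2r; rewrite ?nnegrE; lra.
Qed.

Lemma trig_pow_small m u y : trig_pow m u y <= `|u * y| `^ (m.*2)%:R.
Proof.
rewrite trig_powE; apply: ge0_ler_powR; rewrite ?nnegrE//.
rewrite normrM ger0_norm//; have := normr_sin_le (u * y / 2).
by rewrite [in X in _ <= X -> _]normrM (@ger0_norm _ 2^-1)//; lra.
Qed.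

(** By the addition formula [2 sin (u (y + x) / 2) = A + D] and [2 sin (u (y - x) / 2) = A - D],
    with [|D| <= |2 sin (u x / 2)|]. Averaging the two expansions around [A] cancels the linear
    terms and leaves a remainder of second order in [x], which is what integrability of [min 1 x^2]
    can pay for; jumps with [1 <= |x|] are listed separately. *)
Lemma trig_pow_shift m : (0 < m)%N -> exists2 C, 0 < C & forall u x y, 0 <= u ->
  (trig_pow m u (y + x) + trig_pow m u (y - x)) / 2 <= trig_pow m u y +
   C * (Num.min 1 (x ^+ 2) * (trig_pow m u y + u `^ (m.*2)%:R) +
        (if 1 <= `|x| then trig_pow m u x else 0)).
Proof.
move=> m0; set r : R := (m.*2)%:R.
have r2 : 2 <= r by rewrite /r ler_nat; case: m m0 @r.
have [C C0 taylor] := powR_taylor2 r2; exists (2 * C) => [|u x y u0]; first lra.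
pose a := 2 * sin (u * y / 2); pose t := 2 * sin (u * x / 2).
pose A := a * cos (u * x / 2); pose D := t * cos (u * y / 2).
have Fa : trig_pow m u y = `|a| `^ r by rewrite trig_powE.
have Ft : trig_pow m u x = `|t| `^ r by rewrite trig_powE.
have FpE : trig_pow m u (y + x) = `|A + D| `^ r.
  by rewrite trig_powE mulrDr mulrDl sinD /A /D /a /t; congr (`|_| `^ _); ring.
have FmE : trig_pow m u (y - x) = `|A + - D| `^ r.
  by rewrite trig_powE mulrBr mulrBl sinB /A /D /a /t; congr (`|_| `^ _); ring.
have cle z (w : R) : `|w * cos z| <= `|w|.
  by rewrite normrM ler_piMr//; exact: cos_max.
have lA : `|A| <= `|a| by exact: cle.
have lD : `|D| <= `|t| by exact: cle.
have mono (s z w : R) : 0 <= s -> `|z| <= `|w| -> `|z| `^ s <= `|w| `^ s.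
  by move=> s0 zw; apply: ge0_ler_powR; rewrite ?nnegrE.
have r20 : 0 <= r - 2 by rewrite subr_ge0.
have r0 : 0 <= r by rewrite /r ler0n.
have D2 : D ^+ 2 <= t ^+ 2.
  by rewrite -(real_normK (num_real D)) -(real_normK (num_real t)) lerXn2r ?nnegrE.
have b1 : (trig_pow m u (y + x) + trig_pow m u (y - x)) / 2 <=
    `|a| `^ r + C * (`|a| `^ (r - 2) * t ^+ 2 + `|t| `^ r).
  have h1 := taylor A D; have h2 := taylor A (- D).
  rewrite -FpE in h1; rewrite -FmE sqrrN normrN mulrN in h2.
  have h3 : `|A| `^ (r - 2) * D ^+ 2 <= `|a| `^ (r - 2) * t ^+ 2.
    by apply: ler_pM; rewrite ?powR_ge0 ?sqr_ge0 ?mono.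
  have h4 : C * (`|A| `^ (r - 2) * D ^+ 2 + `|D| `^ r) <=
            C * (`|a| `^ (r - 2) * t ^+ 2 + `|t| `^ r).
    by rewrite ler_pM2l// lerD ?mono.
  have := mono r A a r0 lA.
  by move: h1 h2 h4; clear; lra.
apply: (le_trans b1); rewrite Fa Ft lerD2l [2 * C]mulrC -[leRHS]mulrA ler_pM2l//.
have split (z w : R) : `|z| `^ (r - 2) * w ^+ 2 <= `|z| `^ r + `|w| `^ r.
  have [zw|/ltW zw] := leP `|z| `|w|.
    apply: (@le_trans _ _ (`|w| `^ r)); last by rewrite lerDr powR_ge0.
    by rewrite -(powRBM2 w r2) ler_wpM2r ?sqr_ge0 ?mono.
  apply: (@le_trans _ _ (`|z| `^ r)); last by rewrite lerDl powR_ge0.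
  rewrite -(powRBM2 z r2) ler_wpM2l ?powR_ge0//.
  by rewrite -(real_normK (num_real z)) -(real_normK (num_real w)) lerXn2r ?nnegrE.
have a0 : 0 <= `|a| `^ r by exact: powR_ge0.
have ur0 : 0 <= u `^ r by exact: powR_ge0.
have t0 : 0 <= `|t| `^ r by exact: powR_ge0.
case: ifPn => [x1|]; last rewrite -ltNge => x1.
  rewrite (_ : Num.min 1 (x ^+ 2) = 1); last first.
    by apply/min_idPl; rewrite -(real_normK (num_real x)) exprn_ege1.
  by have := split a t; move: a0 ur0 t0; clear; lra.
have x2 : x ^+ 2 <= 1 by rewrite -(real_normK (num_real x)) exprn_ile1// ltW.
rewrite (min_idPr x2) addr0.
have tu : `|t| <= `|u * x|.
  rewrite /t normrM ger0_norm//; have := normr_sin_le (u * x / 2).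
  by rewrite [in X in _ <= X -> _]normrM (@ger0_norm _ 2^-1)//; lra.
have t2 : t ^+ 2 <= u ^+ 2 * x ^+ 2.
  rewrite -exprMn -(real_normK (num_real t)) -(real_normK (num_real (u * x))).
  by rewrite lerXn2r ?nnegrE.
have e1 : `|a| `^ (r - 2) * t ^+ 2 <= x ^+ 2 * (`|a| `^ r + u `^ r).
  apply: (@le_trans _ _ (`|a| `^ (r - 2) * (u ^+ 2 * x ^+ 2))).
    by rewrite ler_wpM2l ?powR_ge0.
  rewrite mulrA [leRHS]mulrC ler_wpM2r ?sqr_ge0//.
  by have := split a u; rewrite (ger0_norm u0).
have e2 : `|t| `^ r <= x ^+ 2 * u `^ r.
  apply: (le_trans (mono r _ _ r0 tu)); rewrite normrM powRM// (ger0_norm u0).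
  rewrite mulrC ler_wpM2r// -(powRBM2 x r2) ler_piMl ?sqr_ge0//.
  have p1 : 1 `^ (r - 2) = 1 :> R by rewrite powR1.
  by rewrite -[leRHS]p1; apply: ge0_ler_powR; rewrite ?nnegrE// ltW.
move: e1 e2 (mulr_ge0 (sqr_ge0 x) ur0) (mulr_ge0 (sqr_ge0 x) a0); clear; lra.
Qed.

Definition cos_sum (l : seq (R * nat)) (x : R) := \sum_(p <- l) p.1 * cos (p.2%:R * x).

Lemma trig_pow_cos_sum m : exists l, forall u y, trig_pow m u y = cos_sum l (u * y).
Proof.
suff [l H] : exists l, forall x, (2 - 2 * cos x) ^+ m = cos_sum l x.
  by exists l => u y; rewrite /trig_pow H.
elim: m => [|m [l IH]].
  by exists [:: (1, 0%N)] => x; rewrite /cos_sum big_seq1 expr0 mul1r mul0r cos0.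
(* Multiplying [cos (k x)] by [2 - 2 cos x] produces the frequencies [k], [k + 1] and [k - 1]. For
   [k = 0] the frequency [-1] is recorded as [1], the cosine being even. *)
exists ([seq (2 * p.1, p.2) | p <- l] ++ [seq (- p.1, p.2.+1) | p <- l] ++
        [seq (- p.1, p.2.-1) | p <- l & p.2 != 0%N] ++
        [seq (- p.1, 1%N) | p <- l & p.2 == 0%N]) => x.
rewrite exprS IH /cos_sum !big_cat !big_map !big_filter /=.
have -> : (\sum_(i <- l | i.2 != 0%N) - i.1 * cos ((i.2.-1)%:R * x)) +
  (\sum_(i <- l | i.2 == 0%N) - i.1 * cos (1%:R * x)) =
  \sum_(i <- l) (- i.1 * cos ((i.2%:R - 1) * x)).
  rewrite [RHS](bigID (fun i => i.2 != 0%N)) /=; congr (_ + _).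
    by apply: eq_bigr => -[g [|k]]//= _; rewrite -natr1 addrK.
  apply: eq_big => [i|[g k]/= /eqP ->]; first by rewrite negbK.
  by rewrite sub0r mulN1r mul1r cosN.
rewrite mulr_sumr -!big_split /=; apply: eq_bigr => -[g k] _ /=.
have -> : (k%:R - 1) * x = k%:R * x - x by ring.
have -> : k.+1%:R * x = k%:R * x + x by rewrite -natr1 mulrDl mul1r.
by rewrite cosD cosB; ring.
Qed.
End TrigPower.

(** * Positive functionals on bounded measurable functions *)

Section JumpFunctional.
Context {R : realType}.

Definition bdm (f : R -> R) := measurable_fun setT f /\ exists B, forall x, `|f x| <= B.

Lemma bdm_lin a b f g : bdm f -> bdm g -> bdm (fun x => a * f x + b * g x).
Proof.
move=> [mf [B HB]] [mg [B' HB']]; split.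
  by apply: measurable_funD; apply: measurable_funM.
exists (`|a| * B + `|b| * B') => x; apply: (le_trans (ler_normD _ _)).
by rewrite !normrM lerD// ler_wpM2l.
Qed.

Lemma bdm_cst a : bdm (fun=> a).
Proof. by split; [exact: measurable_cst|exists `|a|]. Qed.

Lemma bdm_cos v : bdm (fun x => cos (v * x)).
Proof.
split; last by exists 1 => x; exact: cos_max.
apply: (@measurableT_comp _ _ _ _ _ _ (@cos R) _ (fun x => v * x)).
  by apply: continuous_measurable_fun; exact: continuous_cos.
exact: mulrl_measurable.
Qed.

Lemma bdm_scale a f : bdm f -> bdm (fun x => a * f x).
Proof.
move=> hf; have := bdm_lin a 0 hf (bdm_cst 0).
by rewrite (_ : (fun x => _) = (fun x => a * f x))//; apply/funext => x; rewrite mulr0 addr0.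
Qed.

Lemma bdm_sum (I : Type) (s : seq I) (F : I -> R -> R) :
  (forall i, bdm (F i)) -> bdm (fun x => \sum_(i <- s) F i x).
Proof.
move=> H; elim: s => [|i s IH].
  by rewrite (_ : (fun _ => _) = fun=> 0); [exact: bdm_cst|apply/funext => x; rewrite big_nil].
have := bdm_lin 1 1 (H i) IH.
by rewrite (_ : (fun x => 1 * _ + 1 * _) = (fun x => \sum_(j <- i :: s) F j x))//;
  apply/funext => x; rewrite big_cons !mul1r.
Qed.

Variable J : (R -> R) -> R.
Hypothesis Jlin : forall a b f g, bdm f -> bdm g ->
  J (fun x => a * f x + b * g x) = a * J f + b * J g.
Hypothesis Jmono : forall f g, bdm f -> bdm g -> (forall x, f x <= g x) -> J f <= J g.

Let J0 : J (fun=> 0) = 0.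
Proof.
have := Jlin 0 0 (bdm_cst 0) (bdm_cst 0); rewrite !mul0r addr0 => H; rewrite -[RHS]H.
by congr J; apply/funext => x; rewrite mul0r addr0.
Qed.

Let Jscale a f : bdm f -> J (fun x => a * f x) = a * J f.
Proof.
move=> hf; transitivity (a * J f + 0 * J (fun=> 0)); last by rewrite mul0r addr0.
by rewrite -Jlin//; [congr J; apply/funext => x; ring|exact: bdm_cst].
Qed.

Let Jsum (I : Type) (s : seq I) (F : I -> R -> R) : (forall i, bdm (F i)) ->
  J (fun x => \sum_(i <- s) F i x) = \sum_(i <- s) J (F i).
Proof.
move=> H; elim: s => [|i s IH].
  by rewrite big_nil -[RHS]J0; congr J; apply/funext => x; rewrite big_nil.
rewrite big_cons -IH -[J (F i)]mul1r -[X in _ + X]mul1r -Jlin//; last exact: bdm_sum.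
by congr J; apply/funext => x; rewrite big_cons !mul1r.
Qed.

Lemma trig_pow_bdm m u : bdm (trig_pow m u).
Proof.
have [l H] := @trig_pow_cos_sum R m.
rewrite (_ : trig_pow m u = fun x => \sum_(p <- l) p.1 * cos (p.2%:R * u * x)).
  by apply: bdm_sum => p; apply: bdm_scale; exact: bdm_cos.
by apply/funext => x; rewrite H /cos_sum; apply: eq_bigr => p _; rewrite mulrA.
Qed.

Lemma trig_pow_tail_bdm m u : bdm (fun x => if 1 <= `|x| then trig_pow m u x else 0).
Proof.
split; last first.
  exists (4 ^+ m) => x; case: ifP => _; last by rewrite normr0 exprn_ge0.
  by rewrite ger0_norm ?trig_pow_ge0 ?trig_pow_le.
apply: measurable_fun_ifT.
- apply: measurable_fun_ler; [exact: measurable_cst|exact: normr_measurable].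
- by have [] := trig_pow_bdm m u.
- exact: measurable_cst.
Qed.

Lemma minr_sqr_bdm : bdm (fun x : R => Num.min 1 (x ^+ 2)).
Proof.
split; last first.
  by exists 1 => x; rewrite ger0_norm ?ge_min ?lexx// le_min ler01 sqr_ge0.
apply: measurable_minr; first exact: measurable_cst.
exact: measurable_funX.
Qed.

(** Iterating the positive operator [F |-> J (x |-> (F (y + x) + F (y - x)) / 2)],
    for which cosines are eigenfunctions, gives the bound term by term in the
    exponential series. *)
Lemma jump_functional_bound m (C c M W u : R) l : (0 < m)%N -> 0 <= C -> 0 <= c -> 0 <= u ->
  (forall x y : R, (trig_pow m u (y + x) + trig_pow m u (y - x)) / 2 <= trig_pow m u y +
   C * (Num.min 1 (x ^+ 2) * (trig_pow m u y + u `^ (m.*2)%:R) +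
        (if 1 <= `|x| then trig_pow m u x else 0))) ->
  (forall y, trig_pow m u y = cos_sum l (u * y)) ->
  J (fun x => Num.min 1 (x ^+ 2)) <= M ->
  J (fun x => if 1 <= `|x| then trig_pow m u x else 0) <= W ->
  \sum_(p <- l) p.1 * expR (c * (J (fun x => cos (p.2%:R * (u * x))) - J (fun=> 1))) <=
  (u `^ (m.*2)%:R + W) * (expR (c * (C * (M + 1))) - 1).
Proof.
move=> m0 C0 c0 u0 shift FE hM hW.
set r : R := (m.*2)%:R in shift *; set lam := J (fun=> 1).
pose b (p : R * nat) := J (fun x => cos (p.2%:R * (u * x))).
have bc (p : R * nat) : bdm (fun x => cos (p.2%:R * (u * x))).
  rewrite (_ : (fun _ => _) = fun x => cos (p.2%:R * u * x)); first exact: bdm_cos.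
  by apply/funext => x; rewrite mulrA.
have Jge0 f : bdm f -> (forall x, 0 <= f x) -> 0 <= J f.
  by move=> hf f0; rewrite -J0; apply: Jmono => //; exact: bdm_cst.
have lam0 : 0 <= lam by apply: Jge0 => //; exact: bdm_cst.
have M0 : 0 <= M.
  by apply: le_trans hM; apply: Jge0 => [|x]; [exact: minr_sqr_bdm|rewrite le_min ler01 sqr_ge0].
have W0 : 0 <= W.
  apply: le_trans hW; apply: Jge0 => [|x]; first exact: trig_pow_tail_bdm.
  by case: ifP => // _; exact: trig_pow_ge0.
have ur0 : 0 <= u `^ r by exact: powR_ge0.
set F := trig_pow m u.
(* The [j]-th iterate of the operator applied to [F]: every cosine picks up its eigenvalue [b p]. *)
pose Fj j (y : R) : R := \sum_(p <- l) p.1 * b p ^+ j * cos (p.2%:R * (u * y)).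
have F0E y : Fj 0%N y = F y.
  by rewrite /F FE /Fj /cos_sum; apply: eq_bigr => p _; rewrite expr0 mulr1.
have FjS j y : Fj j.+1 y = J (fun x => (Fj j (y + x) + Fj j (y - x)) / 2).
  transitivity (J (fun x => \sum_(p <- l)
      (p.1 * b p ^+ j * cos (p.2%:R * (u * y))) * cos (p.2%:R * (u * x)))).
    rewrite Jsum; last by move=> p; apply: bdm_scale; exact: bc.
    by apply: eq_bigr => p _; rewrite Jscale// -/(b p) exprSr; ring.
  congr J; apply/funext => x; rewrite /Fj -big_split mulr_suml; apply: eq_bigr => p _ /=.
  by rewrite !mulrDr !mulrN cosD cosB; field.
have Fjb j : bdm (Fj j) by apply: bdm_sum => p; apply: bdm_scale; exact: bc.
have shiftb (G : R -> R) y : bdm G -> bdm (fun x => (G (y + x) + G (y - x)) / 2).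
  move=> [mG [B HB]]; split.
    apply: measurable_funM; last exact: measurable_cst.
    apply: measurable_funD; apply: (measurableT_comp mG).
      by apply: measurable_funD; [exact: measurable_cst|exact: measurable_id].
    by apply: measurable_funB; [exact: measurable_cst|exact: measurable_id].
  exists B => x; rewrite normrM (ger0_norm (_ : 0 <= 2^-1))//.
  by have := HB (y + x); have := HB (y - x); have := ler_normD (G (y + x)) (G (y - x)); lra.
pose C1 := C * (M + 1); pose W2 := u `^ r + W.
have C10 : 0 <= C1 by rewrite mulr_ge0// addr_ge0.
have W20 : 0 <= W2 by rewrite addr_ge0.
have Fy0 y : 0 <= F y by exact: trig_pow_ge0.
(* One application multiplies [F] by at most [lam + C1] and a constant by exactly [lam], and it adds
   a constant of at most [C1 * W2] times the current coefficient of [F]. Summing these contributions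
   gives the difference of powers. *)
have claim j y : Fj j y <= (lam + C1) ^+ j * F y + W2 * ((lam + C1) ^+ j - lam ^+ j).
  elim: j y => [|j IH] y; first by rewrite F0E !expr0 subrr mulr0 mul1r addr0.
  set al := (lam + C1) ^+ j in IH; set be := W2 * (al - lam ^+ j) in IH.
  have al0 : 0 <= al by rewrite exprn_ge0// addr_ge0.
  pose G x := al * C * (F y + u `^ r) * Num.min 1 (x ^+ 2) +
              (al * C) * (if 1 <= `|x| then F x else 0).
  have hG : bdm G.
    by apply: bdm_lin; [exact: minr_sqr_bdm|exact: trig_pow_tail_bdm].
  have JG : J (fun x => (al * F y + be) * 1 + 1 * G x) =
     (al * F y + be) * lam + (al * C * (F y + u `^ r) * J (fun x => Num.min 1 (x ^+ 2)) +
        (al * C) * J (fun x => if 1 <= `|x| then F x else 0)).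
    rewrite Jlin//; last exact: bdm_cst.
    rewrite mul1r Jlin//; [exact: minr_sqr_bdm|exact: trig_pow_tail_bdm].
  rewrite FjS; apply: (@le_trans _ _ (J (fun x => (al * F y + be) * 1 + 1 * G x))).
    apply: Jmono; [exact: shiftb|by apply: bdm_lin => //; exact: bdm_cst|].
    move=> x; have h1 := IH (y + x); have h2 := IH (y - x); have := ler_wpM2l al0 (shift x y).
    by rewrite /G -/F; move: h1 h2; clear; move: (Num.min _ _) (if _ then _ else _) => X1 X2; lra.
  rewrite JG.
  have aC : 0 <= al * C by rewrite mulr_ge0.
  have e1 : al * C * (F y + u `^ r) * J (fun x => Num.min 1 (x ^+ 2)) <= al * C * (F y + u `^ r) * M.
    by rewrite ler_wpM2l// mulr_ge0// addr_ge0.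
  have e2 := ler_wpM2l aC hW.
  have e3 : 0 <= al * C * (F y + u `^ r) by rewrite mulr_ge0// addr_ge0.
  have e4 : 0 <= al * C * (M * W) by rewrite !mulr_ge0.
  have e5 : 0 <= al * C * F y by rewrite !mulr_ge0.
  have e6 : 0 <= al * C * u `^ r by rewrite !mulr_ge0.
  rewrite [(lam + C1) ^+ j.+1]exprSr [lam ^+ j.+1]exprSr -/al.
  rewrite (_ : lam ^+ j = al - (al - lam ^+ j)); last by ring.
  move: e1 e2 e3 e4 e5 e6; rewrite /be /C1 /W2 -/F.
  move: (J _) (J _) (lam ^+ j) => X1 X2 lj; clear; lra.
have lim_exp (x : R) : (\sum_(0 <= j < n) x ^+ j / j`!%:R) @[n --> \oo] --> expR x.
  have := @is_cvg_series_exp_coeff R x; rewrite /expR => /cvg_ex[y cy].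
  by rewrite (cvg_lim _ cy).
pose Sn n := \sum_(0 <= j < n) c ^+ j / j`!%:R * Fj j 0.
have cS : Sn n @[n --> \oo] --> \sum_(p <- l) p.1 * expR (c * b p).
  rewrite (_ : Sn = (fun n => \sum_(p <- l) p.1 * \sum_(0 <= j < n) (c * b p) ^+ j / j`!%:R)); last first.
    apply/funext => n; rewrite /Sn.
    under [in RHS]eq_bigr do rewrite mulr_sumr.
    rewrite exchange_big; apply: eq_bigr => j _.
    rewrite /Fj mulr_sumr; apply: eq_bigr => p _.
    by rewrite !mulr0 cos0 mulr1 exprMn; ring.
  elim: l {FE Fj F0E FjS Fjb claim Sn} => [|p s IH].
    rewrite (_ : (fun _ => _) = fun=> 0); last by apply/funext => n; rewrite big_nil.
    by rewrite big_nil; exact: cvg_cst.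
  rewrite (_ : (fun _ => _) = fun n => p.1 * (\sum_(0 <= j < n) (c * b p) ^+ j / j`!%:R) +
    \sum_(p <- s) p.1 * \sum_(0 <= j < n) (c * b p) ^+ j / j`!%:R); last first.
    by apply/funext => n; rewrite big_cons.
  by rewrite big_cons; apply: cvgD => //; apply: cvgMr; exact: lim_exp.
have cT : (W2 * (\sum_(0 <= j < n) (c * (lam + C1)) ^+ j / j`!%:R -
     \sum_(0 <= j < n) (c * lam) ^+ j / j`!%:R)) @[n --> \oo] -->
     W2 * (expR (c * (lam + C1)) - expR (c * lam)).
  by apply: cvgMr; apply: cvgB; exact: lim_exp.
have le_lim : \sum_(p <- l) p.1 * expR (c * b p) <= W2 * (expR (c * (lam + C1)) - expR (c * lam)).
  apply: (ler_cvg_to cS cT); apply: nearW => n.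
  rewrite -sumrB mulr_sumr; apply: ler_sum => j _.
  (* Since [m > 0], [F] vanishes at the origin and only the term in [W2] remains. *)
  have := claim j 0; rewrite {1}/F /trig_pow mulr0 cos0 mulr1 subrr expr0n gtn_eqF//= mulr0 add0r.
  have cj0 : 0 <= c ^+ j / j`!%:R by rewrite divr_ge0 ?exprn_ge0.
  move=> /(ler_wpM2l cj0) /le_trans; apply; rewrite !exprMn le_eqVlt; apply/orP; left; apply/eqP.
  by ring.
(* The factor [exp (- c lam)] removes the total mass [lam], which may grow without bound as the
   truncation of the Levy measure is refined. *)
have em0 := expR_ge0 (- (c * lam)).
have := ler_wpM2r em0 le_lim; rewrite mulr_suml => H.
rewrite (_ : \sum_(p <- l) _ = \sum_(i <- l) i.1 * expR (c * b i) * expR (- (c * lam))); last first.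
  by apply: eq_bigr => p _; rewrite -/(b p) -mulrA -expRD mulrBr.
apply: (le_trans H); rewrite -/W2 -mulrA ler_wpM2l// mulrBl -!expRD subrr expR0.
by rewrite le_eqVlt; apply/orP; left; apply/eqP; congr (expR _ - 1); rewrite /C1; ring.
Qed.
End JumpFunctional.

(** * Approximation of the Levy exponent by finite jump measures *)

Section LevyTruncation.
Context {R : realType}.
Variables (nu : {measure set R -> \bar R}) (s2 : R).
Hypothesis levy : levy_measure nu.
Hypothesis s20 : 0 <= s2.

Definition outside (e : R) : set R := [set x | e < `|x|].

Lemma measurable_outside e : measurable (outside e).
Proof.
have m : measurable_fun setT (fun x : R => `|x|) by exact: normr_measurable.
have := measurable_fun_ltr (@measurable_cst _ _ _ _ setT e) m.
by move=> /(_ measurableT [set true]); rewrite setTI => H; exact: H.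
Qed.

Let minr_sqr_ge0 (x : R) : 0 <= Num.min 1 (x ^+ 2).
Proof. by rewrite le_min ler01 sqr_ge0. Qed.

Let mmin : measurable_fun setT (fun x : R => Num.min 1 (x ^+ 2)).
Proof. by have [] := @minr_sqr_bdm R. Qed.

Lemma integrable_minr_sqr : nu.-integrable setT (EFin \o (fun x => Num.min 1 (x ^+ 2))).
Proof.
have [_ H] := levy; apply/integrableP; split; first exact/measurable_EFinP.
by under eq_integral do rewrite /= ger0_norm//.
Qed.

Lemma outside_finite e : 0 < e -> (nu (outside e) < +oo)%E.
Proof.
move=> e0; have [_ H] := levy; set c := Num.min 1 (e ^+ 2).
have c0 : 0 < c by rewrite /c lt_min ltr01 exprn_gt0.
have : (c%:E * nu (outside e) <= \int[nu]_x (Num.min 1 (x ^+ 2))%:E)%E.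
  rewrite -integral_cst; last exact: measurable_outside.
  rewrite integral_mkcond; apply: ge0_le_integral_nm => x.
    by apply: erestrict_ge0 => y _; rewrite lee_fin ltW.
  rewrite patchE; case: ifPn => [|_]; last by rewrite lee_fin.
  rewrite inE /outside /= => ex; rewrite lee_fin /c le_min2//.
  by rewrite -(real_normK (num_real x)) lerXn2r ?nnegrE// ltW.
move=> /le_lt_trans /(_ H); rewrite -lte_pdivlMl//.
by move=> /lt_le_trans; apply; rewrite leey.
Qed.

Lemma integrable_bdm_outside e f : 0 < e -> bdm f ->
  nu.-integrable (outside e) (EFin \o f).
Proof.
move=> e0 [mf [B HB]]; apply: measurable_bounded_integrable.
- exact: measurable_outside.
- exact: outside_finite.
- exact: measurable_funTS.
- by exists B; split; [exact: num_real|move=> M BM x _ /=; apply: (le_trans (HB x)); exact: ltW].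
Qed.

(** Jumps larger than [e], together with an atom of mass [w] at [e] that imitates the Gaussian
    component. The resulting measure is finite, so that bounded functions can be integrated. *)
Definition jump_int (e w : R) (f : R -> R) := \int[nu]_(x in outside e) f x + w * f e.

Lemma jump_int_lin e w a b f g : 0 < e -> bdm f -> bdm g ->
  jump_int e w (fun x => a * f x + b * g x) = a * jump_int e w f + b * jump_int e w g.
Proof.
move=> e0 hf hg; have mo := measurable_outside e.
have if_ := integrable_bdm_outside e0 hf; have ig := integrable_bdm_outside e0 hg.
have ia := integrable_bdm_outside e0 (bdm_scale a hf).
have ib := integrable_bdm_outside e0 (bdm_scale b hg).
by rewrite /jump_int RintegralD// !RintegralZl//; ring.
Qed.

Lemma jump_int_mono e w f g : 0 < e -> 0 <= w -> bdm f -> bdm g ->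
  (forall x, f x <= g x) -> jump_int e w f <= jump_int e w g.
Proof.
move=> e0 w0 hf hg fg; apply: lerD; last exact: ler_wpM2l.
apply: le_Rintegral => //; [exact: measurable_outside|exact: integrable_bdm_outside..].
Qed.

(** Minus the real part of the Levy-Khintchine exponent; drift and compensator only enter the
    imaginary part. *)
Definition levy_kappa (v : R) := s2 * v ^+ 2 / 2 + \int[nu]_x (1 - cos (v * x)).

Let one_sub_cos (x : R) : 1 - cos x = 2 * sin (x / 2) ^+ 2.
Proof.
have {1}-> : x = (x / 2) *+ 2 by rewrite -mulr_natr; field.
by rewrite cos_mulr2n sin2cos2 -mulr_natr; ring.
Qed.

Let cos_minr (v x : R) : 0 <= 1 - cos (v * x) <= (2 + v ^+ 2) * Num.min 1 (x ^+ 2).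
Proof.
have c1 := cos_le1 (v * x); have c2 := cos_geN1 (v * x).
rewrite subr_ge0 c1 /= minr_pMr ?addr_ge0 ?sqr_ge0// le_min; apply/andP; split.
  by have := sqr_ge0 v; lra.
rewrite one_sub_cos.
have : sin (v * x / 2) ^+ 2 <= (v * x / 2) ^+ 2.
  rewrite -(real_normK (num_real (sin _))) -(real_normK (num_real (v * x / 2))).
  by rewrite lerXn2r ?nnegrE// normr_sin_le.
have := sqr_ge0 (v * x); have := sqr_ge0 x; rewrite !exprMn.
move: (v ^+ 2) (x ^+ 2) => V Z; nra.
Qed.

Lemma integrable_levy_cos v : nu.-integrable setT (EFin \o (fun x => 1 - cos (v * x))).
Proof.
have := integrableZl measurableT (2 + v ^+ 2) integrable_minr_sqr.
apply: le_integrable => //.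
  apply/measurable_EFinP; apply: measurable_funB; first exact: measurable_cst.
  by have [] := @bdm_cos R v.
move=> x _; have /andP[h1 h2] := cos_minr v x.
rewrite /= lee_fin ger0_norm// ger0_norm//.
by rewrite mulr_ge0// addr_ge0// sqr_ge0.
Qed.

(** The shift by two keeps the truncation level strictly below 1, so the atom placed there never
    counts among the jumps with [1 <= |x|]. *)
Definition eps_ (n : nat) : R := n.+2%:R^-1.

Let eps0 n : 0 < eps_ n. Proof. by rewrite invr_gt0. Qed.
Let epsc : eps_ n @[n --> \oo] --> (0 : R).
Proof.
have := @cvg_harmonic R; rewrite -(cvg_shiftS _).
by apply: cvg_trans; apply: near_eq_cvg; apply: nearW => n.
Qed.

(** With this mass the atom at [e = eps_ n] contributes [s2 (1 - cos (v e)) / e^2], which tends to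
    [s2 v^2 / 2]. *)
Definition jump_n n := jump_int (eps_ n) (s2 / eps_ n ^+ 2).

Lemma jump_n_kappa v : (jump_n n (fun=> 1) - jump_n n (fun x => cos (v * x))) @[n --> \oo]
  --> levy_kappa v.
Proof.
pose f (x : R) := 1 - cos (v * x).
have E n : jump_n n (fun=> 1) - jump_n n (fun x => cos (v * x)) =
    s2 * (2 * (sin (v * eps_ n / 2) / eps_ n) ^+ 2) + \int[nu]_(x in outside (eps_ n)) f x.
  rewrite /jump_n /jump_int /f RintegralB//; last 3 first.
  - exact: measurable_outside.
  - exact: integrable_bdm_outside (bdm_cst 1).
  - exact: integrable_bdm_outside (bdm_cos v).
  have -> : cos (v * eps_ n) = 1 - 2 * sin (v * eps_ n / 2) ^+ 2.
    by rewrite -one_sub_cos; ring.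
  by have e0 := eps0 n; field; rewrite gt_eqF.
under eq_cvg do rewrite E.
rewrite /levy_kappa; apply: cvgD.
  have -> : s2 * v ^+ 2 / 2 = s2 * (2 * (v / 2) ^+ 2) by field.
  apply: cvgMr; apply: cvgMr; rewrite expr2; under eq_cvg do rewrite expr2.
  suff H : sin (v * eps_ n / 2) / eps_ n @[n --> \oo] --> v / 2 by apply: cvgM.
  (* The limit of [sin (v e / 2) / e] is read as a derivative at the origin, taken along the
     sequence [eps_]. *)
  have D : is_derive (0 : R) (1 : R) (fun t => sin (v / 2 * t)) (v / 2).
    have dl : is_derive (0 : R) (1 : R) (fun t : R => v / 2 * t) (v / 2).
      by have := is_deriveZ (v / 2) (is_derive_id (0 : R) (1 : R)); rewrite -[X in is_derive _ _ _ X]/(_ * _) mulr1.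
    have := is_derive1_comp (is_derive_sin (v / 2 * 0)) dl.
    by rewrite mulr0 cos0 mul1r.
  have := @ex_derive _ _ _ _ _ _ _ D; rewrite /derivable => /cvg_ex[l cl].
  have lE : l = v / 2.
    by rewrite -(@derive_val _ _ _ _ _ _ _ D) /derive; apply/esym/cvg_lim.
  rewrite lE in cl.
  have := (cvgr_dnbhsP _ _ _).1 cl eps_ _.
  move=> H; have {}H := H (conj (fun n => lt0r_neq0 (eps0 n)) epsc).
  apply: cvg_trans H; apply: near_eq_cvg; apply: nearW => n /=.
  rewrite addr0 mulr0 sin0 subr0 -[_ *: _]/(_ * _) -[eps_ n *: 1]/(eps_ n * 1) mulr1 mulrC.
  by congr (sin _ / _); rewrite mulrAC.
have fint := integrable_levy_cos v.
have mf : measurable_fun setT f.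
  by apply/measurable_EFinP; exact: (measurable_int nu).
under eq_cvg do rewrite Rintegral_mkcond.
have F0 (x : R) : 0 <= f x by have /andP[] := cos_minr v x.
pose fn n := EFin \o (f \_ (outside (eps_ n))).
have mfn n : measurable_fun setT (fn n).
  apply/measurable_EFinP; apply/(measurable_restrictT _ _).1; first exact: measurable_outside.
  exact: measurable_funTS.
have fnf : {ae nu, forall x, setT x -> fn ^~ x @ \oo --> (EFin \o f) x}.
  apply: aeW => x _; apply/fine_cvgP; split; first exact: nearW.
  have [->|x0] := eqVneq x 0.
    apply: (@cvg_trans _ (cst (f 0) n @[n --> \oo])); last exact: cvg_cst.
    apply: near_eq_cvg; apply: nearW => n /=; rewrite patchE.
    by case: ifP => //; rewrite /f mulr0 cos0 subrr.
  apply: (@cvg_trans _ (cst (f x) n @[n --> \oo])); last exact: cvg_cst.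
  apply: near_eq_cvg.
  have x00 : 0 < `|x| by rewrite normr_gt0.
  have /cvgrPdist_lt /(_ _ x00) := epsc; apply: filterS => n /=.
  rewrite sub0r normrN gtr0_norm// => h; rewrite patchE ifT// inE.
  exact: h.
have fnb : {ae nu, forall x n, setT x -> (`|fn n x| <= (EFin \o f) x)%E}.
  apply: aeW => x n _ /=; rewrite lee_fin patchE; case: ifP => _.
    by rewrite ger0_norm.
  by rewrite normr0.
have mEf : measurable_fun setT (EFin \o f) by exact/measurable_EFinP.
have [_ _ H] := dominated_convergence measurableT mfn mEf fnf fint fnb.
apply: (fine_cvg (a := \int[nu]_x f x)); rewrite /Rintegral fineK//.
exact: integrable_fin_num.
Qed.
End LevyTruncation.

(** * Dyadic sums comparable with a power *)

Section DyadicSums.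
Context {R : realType}.

Definition dyadic_sum (m : nat) (q : R) K (y : R) :=
  \sum_(0 <= k < K) q ^+ k * trig_pow m (2^-1 ^+ k) y.

(** Self-similarity: halving [y] shifts the scale by one. For [q = 2^r] the factor [q] is the ratio
    of [|y|^r] to [|y / 2|^r], so both comparisons with [|y|^r] become inductions along this
    recursion. *)
Lemma dyadic_sumS m q K y : dyadic_sum m q K.+1 y =
  trig_pow m 1 y + q * dyadic_sum m q K (y / 2).
Proof.
rewrite /dyadic_sum big_nat_recl// expr0 mul1r expr0; congr (_ + _).
rewrite mulr_sumr; apply: eq_bigr => k _; rewrite exprS mulrA; congr (_ * _).
by rewrite /trig_pow exprS; congr ((2 - 2 * cos _) ^+ _); rewrite mulrA mulrAC mulrC [2^-1 * _]mulrC mulrA.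
Qed.

Lemma dyadic_sum_ge0 m q K y : 0 <= q -> 0 <= dyadic_sum m q K y.
Proof. by move=> q0; apply: sumr_ge0 => k _; rewrite mulr_ge0 ?exprn_ge0 ?trig_pow_ge0. Qed.

Variables (m : nat) (r : R).
Hypothesis r0 : 0 < r.
Hypothesis rm : r < (m.*2)%:R.
Let q : R := 2 `^ r.

Let q1 : 1 < q.
Proof.
have p : 1 `^ r = 1 :> R by rewrite powR1.
by rewrite /q -[ltLHS]p; apply: gt0_ltr_powR; rewrite ?nnegrE// ltr1n.
Qed.
Let q0 : 0 < q. Proof. exact: lt_trans q1. Qed.

Let qt_lt1 : 0 <= q * (2^-1 ^+ (m.*2)) < 1.
Proof.
rewrite mulr_ge0 ?(ltW q0) ?exprn_ge0//= exprVn ltr_pdivrMr ?exprn_gt0// mul1r.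
rewrite /q -powR_mulrn// /powR (negbTE (lt0r_neq0 _))// ltr_expR ltr_pM2r//.
by apply: ln_gt0; rewrite ltr1n.
Qed.

(** The terms are the powers of [2^r / 2^(2 m)], a ratio below 1 because [r < 2 m]; this is what
    dictates the size of [m]. *)
Lemma dyadic_geo_bounded : exists2 B, 0 <= B & forall K,
  \sum_(0 <= k < K) q ^+ k * (2^-1 ^+ k) `^ (m.*2)%:R <= B.
Proof.
have /andP[t0 t1] := qt_lt1.
exists (1 - q * (2^-1 ^+ (m.*2)))^-1; first by rewrite invr_ge0 subr_ge0 ltW.
move=> K; apply: le_trans (geo_sum_le K (introT andP (conj t0 t1))); apply: ler_sum => k _.
by rewrite powR_mulrn ?exprn_ge0// exprMn -!exprM mulnC.
Qed.

Lemma dyadic_sum_le : exists2 A, 0 <= A & forall K (y : R), 1 <= `|y| ->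
  dyadic_sum m q K y <= A * `|y| `^ r.
Proof.
have [C1 C10 HC1] := dyadic_geo_bounded.
have q10 : 0 < q - 1 by rewrite subr_gt0.
(* The solution of [q B - 4^m = B]. In the strengthened bound [A |y|^r - B] the subtracted constant
   absorbs the term of size at most [4^m] that each halving creates. *)
pose B := 4 ^+ m / (q - 1).
have B0 : 0 <= B by rewrite divr_ge0 ?exprn_ge0// ltW.
pose A := (C1 + B) * q.
have A0 : 0 <= A by rewrite mulr_ge0 ?addr_ge0// ltW.
have AB : B <= A.
  by apply: (@le_trans _ _ (1 * (C1 + B))); [rewrite mul1r lerDr|rewrite /A mulrC ler_wpM2l ?addr_ge0// ltW].
exists A => // K y y1.
(* The range is widened to [1/2] so that halving a point with [1 <= |y|] stays inside it. *)
suff claim : forall K (y : R), 2^-1 <= `|y| -> dyadic_sum m q K y <= A * `|y| `^ r - B.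
  have := claim K y; rewrite (le_trans _ y1) ?invf_le1 ?ler1n// => /(_ isT).
  by move=> /le_trans; apply; rewrite gerBl.
elim=> [|{}K IH] {y1}y yh.
  rewrite /dyadic_sum big_geq// subr_ge0.
  have : C1 + B <= A * `|y| `^ r.
    rewrite /A -mulrA ler_peMr ?addr_ge0//.
    rewrite /q -powRM//.
    have p : 1 `^ r = 1 :> R by rewrite powR1.
    rewrite -[leLHS]p; apply: ge0_ler_powR; rewrite ?nnegrE ?mulr_ge0 ?(ltW r0)//; lra.
  by apply: le_trans; rewrite lerDr.
have [y1|y1] := ltP `|y| 1.
  have h : dyadic_sum m q K.+1 y <= C1.
    apply: le_trans (HC1 K.+1); apply: ler_sum => k _.
    rewrite ler_wpM2l ?exprn_ge0 ?(ltW q0)//; apply: (le_trans (trig_pow_small _ _ _)).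
    apply: ge0_ler_powR; rewrite ?nnegrE ?exprn_ge0//.
    by rewrite normrM (ger0_norm (exprn_ge0 _ _))// ler_piMr ?exprn_ge0// ltW.
  apply: (le_trans h); rewrite lerBrDr.
  rewrite /A -mulrA ler_peMr ?addr_ge0// /q -powRM//.
  have p : 1 `^ r = 1 :> R by rewrite powR1.
  rewrite -[leLHS]p; apply: ge0_ler_powR; rewrite ?nnegrE ?mulr_ge0 ?(ltW r0)//; lra.
rewrite dyadic_sumS.
have yE : `|y / 2| = `|y| / 2 by rewrite normrM (ger0_norm (_ : 0 <= 2^-1)).
have := IH (y / 2); rewrite yE => /(_ ltac:(lra)) h.
have e : q * (`|y| / 2) `^ r = `|y| `^ r.
  by rewrite /q -powRM ?divr_ge0//; congr (_ `^ _); field.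
apply: (@le_trans _ _ (4 ^+ m + q * (A * (`|y| / 2) `^ r - B))).
  by apply: lerD; [exact: trig_pow_le|rewrite ler_pM2l].
rewrite mulrBr mulrCA e /B.
by rewrite le_eqVlt; apply/orP; left; apply/eqP; field; rewrite lt0r_neq0.
Qed.

Lemma dyadic_sum_ge : exists2 c, 0 < c & forall K (y : R), 1 <= `|y| -> `|y| < 2 ^+ K ->
  c * `|y| `^ r <= dyadic_sum m q K y.
Proof.
have pi2 := @pi_ge2 R.
have c1 : cos 1 < 1 :> R.
  by rewrite -[ltRHS]cos0 ltr_cos// in_itv/= ?lexx ?ler01 ?pi_ge0//= (le_trans _ pi2)// ler1n.
pose c := (2 - 2 * cos 1) ^+ m / q.
have c0 : 0 < c by rewrite divr_gt0// exprn_gt0//; lra.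
exists c => // K; elim: K => [|K IH] y y1 yK; first by rewrite expr0 ltNge y1 in yK.
rewrite dyadic_sumS; have [y2|y2] := ltP `|y| 2.
  rewrite -[leLHS]addr0; apply: lerD; last first.
    by rewrite mulr_ge0 ?dyadic_sum_ge0// ltW.
  apply: (@le_trans _ _ (c * q)).
    rewrite ler_pM2l// /q; apply: ge0_ler_powR; rewrite ?nnegrE// ltW//.
  rewrite /c divfK ?lt0r_neq0// /trig_pow mul1r.
  (* The cosine decreases on [[0, pi]], which contains [[1, 2]]. *)
  have cy : cos y <= cos 1.
    rewrite -(cos_norm y) leNgt ltr_cos ?in_itv/= -?leNgt ?y1 ?normr_ge0 ?ler01//=.
      by rewrite (le_trans (ltW y2)).
    by rewrite (le_trans _ pi2)// ler1n.
  by apply: lerXn2r; rewrite ?nnegrE; have := cos_le1 y; lra.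
have yE : `|y / 2| = `|y| / 2 by rewrite normrM (ger0_norm (_ : 0 <= 2^-1)).
have e : q * (`|y| / 2) `^ r = `|y| `^ r.
  by rewrite /q -powRM ?divr_ge0//; congr (_ `^ _); field.
have := IH (y / 2); rewrite yE => /(_ ltac:(lra)).
rewrite ltr_pdivrMr// -exprSr => /(_ yK) h.
rewrite -e mulrCA; apply: (le_trans (ler_wpM2l (ltW q0) h)).
by rewrite lerDr trig_pow_ge0.
Qed.
End DyadicSums.

(** * Moments read off the characteristic function *)

Section LevyMoments.
Context d {T : measurableType d} {R : realType} (P : probability T R).
Variables (nu : {measure set R -> \bar R}) (s2 c : R) (Y : T -> R).
Hypothesis levy : levy_measure nu.
Hypothesis s20 : 0 <= s2.
Hypothesis c0 : 0 <= c.
Hypothesis mY : measurable_fun setT Y.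
Hypothesis cfY : forall v, \int[P]_w cos (v * Y w) = expR (- (c * levy_kappa nu s2 v)).

Let big : set R := [set x | 1 <= `|x|].

Let mbig : measurable big.
Proof.
have m : measurable_fun setT (fun x : R => `|x|) by exact: normr_measurable.
have := measurable_fun_ler (@measurable_cst _ _ R R setT (1 : R)) m.
by move=> /(_ measurableT [set true]); rewrite setTI => H; exact: H.
Qed.

Let bigsub : big `<=` outside 2^-1.
Proof. by move=> x; rewrite /big /outside /= => ?; lra. Qed.

Lemma integrable_bdm_big f : bdm f -> nu.-integrable big (EFin \o f).
Proof.
move=> hf; apply: (@integrableS _ _ _ nu (outside 2^-1)) => //.
  exact: measurable_outside.
by apply: integrable_bdm_outside => //; rewrite invr_gt0.
Qed.

Lemma levy_trig_pow_bound m : (0 < m)%N -> exists2 C, 0 <= C & forall u, 0 <= u ->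
  \int[P]_w trig_pow m u (Y w) <= C * (u `^ (m.*2)%:R + \int[nu]_(x in big) trig_pow m u x).
Proof.
move=> m0; have [C C0 shift] := @trig_pow_shift R m m0.
(* Dominates the integral of [min 1 x^2] under every truncation: the atom at [e] has mass [s2 / e^2]
   and [min 1 e^2 <= e^2]. Hence the constant is uniform in the truncation and survives its
   removal. *)
pose M := \int[nu]_x Num.min 1 (x ^+ 2) + s2.
exists (expR (c * (C * (M + 1))) - 1).
  rewrite subr_ge0 -expR0 ler_expR !mulr_ge0 ?(ltW C0)// !addr_ge0//.
  by apply: Rintegral_ge0 => x _; rewrite le_min ler01 sqr_ge0.
move=> u u0; rewrite mulrC; set W := \int[nu]_(x in big) _.
have [l Hl] := @trig_pow_cos_sum R m.
have mcY v : P.-integrable setT (EFin \o (fun w => cos (v * Y w))).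
  apply: measurable_bounded_integrable => //.
  - by rewrite (le_lt_trans (probability_le1 P measurableT))// ltry.
  - have [mc _] := @bdm_cos R v; exact: (measurableT_comp mc mY).
  - exists 1; split; [exact: num_real|move=> B B1 x _ /=].
    by apply: (le_trans (cos_max _)); exact: ltW.
have -> : \int[P]_w trig_pow m u (Y w) =
    \sum_(p <- l) p.1 * expR (- (c * levy_kappa nu s2 (p.2%:R * u))).
  transitivity (\int[P]_w \sum_(p <- l) p.1 * cos (p.2%:R * u * Y w)).
    apply: eq_Rintegral => w _; rewrite Hl /cos_sum; apply: eq_bigr => p _.
    by rewrite mulrA.
  elim: l {Hl} => [|p l IH].
    rewrite big_nil; under eq_Rintegral do rewrite big_nil.
    by rewrite Rintegral_cst// mul0r.
  rewrite big_cons -IH -cfY -RintegralZl// -RintegralD//.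
  - by apply: eq_Rintegral => w _; rewrite big_cons.
  - by have := integrableZl measurableT p.1 (mcY (p.2%:R * u)); apply: eq_integrable.
  - elim: l {IH} => [|p' l IH].
      have := finite_measure_integrable_cst P 0 measurableT.
      by apply: eq_integrable => // w _; rewrite /= big_nil.
    have := integrableD measurableT (integrableZl measurableT p'.1 (mcY (p'.2%:R * u))) IH.
    by apply: eq_integrable => // w _; rewrite /= big_cons EFinD EFinM.
have en0 n : 0 < eps_ n :> R by rewrite invr_gt0.
have en1 n : eps_ n < 1 :> R by rewrite invf_lt1// ltr1n.
have w0 n : 0 <= s2 / eps_ n ^+ 2 by rewrite divr_ge0 ?exprn_ge0// ltW.
pose S n := \sum_(p <- l) p.1 * expR (c *
  (jump_n nu s2 n (fun x => cos (p.2%:R * (u * x))) - jump_n nu s2 n (fun=> 1))).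
have cS : S n @[n --> \oo] --> \sum_(p <- l) p.1 * expR (- (c * levy_kappa nu s2 (p.2%:R * u))).
  rewrite /S; elim: l {Hl S} => [|p l IH].
    rewrite big_nil; apply: (@cvg_trans _ (cst (0 : R) n @[n --> \oo])); last exact: cvg_cst.
    by apply: near_eq_cvg; apply: nearW => n; rewrite big_nil.
  rewrite big_cons.
  under eq_cvg do rewrite big_cons.
  apply: cvgD => //; apply: cvgMr.
  have cA : c * (jump_n nu s2 n (fun x => cos (p.2%:R * (u * x))) - jump_n nu s2 n (fun=> 1))
      @[n --> \oo] --> - (c * levy_kappa nu s2 (p.2%:R * u)).
    rewrite -mulrN; apply: cvgMr.
    under eq_cvg => n.
      rewrite -opprB (_ : (fun x => cos (p.2%:R * (u * x))) = (fun x => cos (p.2%:R * u * x))); last first.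
        by apply/funext => x; rewrite mulrA.
      over.
    by apply: cvgN; exact: jump_n_kappa.
  exact: (cvg_comp _ _ cA (@continuous_expR R _)).
apply: (cvgr_to_le cS); apply: nearW => n.
apply: (@jump_functional_bound R (jump_n nu s2 n)) => //.
- by move=> a b f g; exact: jump_int_lin.
- by move=> f g; exact: jump_int_mono.
- exact: ltW.
- by move=> x y; exact: shift.
- rewrite /jump_n /jump_int /M; apply: lerD.
    rewrite /Rintegral; apply: fine_le.
    + apply: integrable_fin_num; first exact: measurable_outside.
      by apply: integrable_bdm_outside => //; exact: minr_sqr_bdm.
    + by apply: integrable_fin_num => //; exact: integrable_minr_sqr.
    rewrite integral_mkcond; apply: ge0_le_integral_nm => x.
      by apply: erestrict_ge0 => y _; rewrite lee_fin le_min ler01 sqr_ge0.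
    by rewrite patchE; case: ifPn => _ //; rewrite lee_fin le_min ler01 sqr_ge0.
  apply: (@le_trans _ _ (s2 / eps_ n ^+ 2 * (eps_ n ^+ 2))).
    by rewrite ler_wpM2l// ge_min lexx orbT.
  by rewrite divfK// expf_neq0// lt0r_neq0.
- rewrite /jump_n /jump_int ifF ?mulr0 ?addr0; last first.
    by rewrite gtr0_norm//; apply/negbTE; rewrite -ltNge.
  rewrite Rintegral_mkcond /W [leRHS]Rintegral_mkcond le_eqVlt; apply/orP; left; apply/eqP.
  apply: eq_Rintegral => x _; rewrite !patchE /outside /big.
  have [x1|x1] := boolP (1 <= `|x|).
    rewrite mem_set; last by rewrite /= (lt_le_trans _ x1).
    by rewrite mem_set.
  rewrite [in RHS]memNset; last by rewrite /=; exact/negP.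
  by case: ifP.
Qed.

(** The two comparisons are used on different sides: the lower one under the law of [Y], the upper
    one under [nu], where the moment is assumed. The trigonometric bound, scale by scale, links the
    two. *)
Lemma levy_moment (r : R) : 0 < r ->
  (\int[nu]_(x in [set x : R | (1 <= `|x|)%R]) ((`|x| `^ r)%R)%:E < +oo)%E ->
  P.-integrable setT (EFin \o (fun w => `|Y w| `^ r)).
Proof.
move=> r0 mom.
pose m := (Num.truncn r).+1.
have rm : r < (m.*2)%:R.
  by rewrite (lt_le_trans (truncnS_gt r))// ler_nat -addnn leq_addr.
have [C C0 HC] := @levy_trig_pow_bound m isT.
have [B B0 HB] := dyadic_geo_bounded r0 rm.
have [A A0 HA] := dyadic_sum_le r0 rm.
have [lo lo0 Hlo] := dyadic_sum_ge m r0.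
set q : R := 2 `^ r in HB HA Hlo.
have q0 : 0 <= q by exact: powR_ge0.
have mr : measurable_fun setT (fun x : R => `|x| `^ r).
  by have /measurable_EFinP := @measurable_EFin_powR _ R R r id ltac:(exact: measurable_id).
have inu : nu.-integrable big (EFin \o (fun x => `|x| `^ r)).
  apply/integrableP; split; first by apply/measurable_EFinP; exact: measurable_funTS.
  by under eq_integral do rewrite /= ger0_norm ?powR_ge0//.
pose I := \int[nu]_(x in big) `|x| `^ r.
have itp (k : nat) : P.-integrable setT (EFin \o (fun w => trig_pow m (2^-1 ^+ k) (Y w))).
  apply: measurable_bounded_integrable => //.
  - by rewrite (le_lt_trans (probability_le1 P measurableT))// ltry.
  - have [mc _] := @trig_pow_bdm R m (2^-1 ^+ k); exact: (measurableT_comp mc mY).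
  - exists (4 ^+ m); split; [exact: num_real|move=> z zB x _ /=].
    by rewrite ger0_norm ?trig_pow_ge0// (le_trans (trig_pow_le _ _ _))// ltW.
have bounded K : P.-integrable setT (EFin \o (fun w => dyadic_sum m q K (Y w))) /\
    \int[P]_w dyadic_sum m q K (Y w) <= C * (B + A * I).
  have E : P.-integrable setT (EFin \o (fun w => dyadic_sum m q K (Y w))) /\
     \int[P]_w dyadic_sum m q K (Y w) =
     \sum_(0 <= k < K) q ^+ k * \int[P]_w trig_pow m (2^-1 ^+ k) (Y w).
    rewrite /dyadic_sum; elim: (index_iota 0 K) => [|k s [IH1 IH2]].
      rewrite big_nil; split.
        have := finite_measure_integrable_cst P 0 measurableT.
        by apply: eq_integrable => // w _; rewrite /= big_nil.
      under eq_Rintegral do rewrite big_nil.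
      by rewrite Rintegral_cst// mul0r.
    have ik : P.-integrable setT (EFin \o (fun w => q ^+ k * trig_pow m (2^-1 ^+ k) (Y w))).
      by have := integrableZl measurableT (q ^+ k) (itp k); apply: eq_integrable.
    split.
      have := integrableD measurableT ik IH1.
      by apply: eq_integrable => // w _; rewrite /= big_cons.
    rewrite big_cons -IH2 -RintegralZl// -RintegralD//.
    by apply: eq_Rintegral => w _; rewrite big_cons.
  split; first exact: E.1.
  rewrite E.2.
  have E2 : \int[nu]_(x in big) dyadic_sum m q K x =
     \sum_(0 <= k < K) q ^+ k * \int[nu]_(x in big) trig_pow m (2^-1 ^+ k) x /\
     nu.-integrable big (EFin \o dyadic_sum m q K).
    rewrite /dyadic_sum; elim: (index_iota 0 K) => [|k s [IH2 IH1]].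
      rewrite big_nil; split.
        under eq_Rintegral do rewrite big_nil.
        by rewrite /Rintegral integral0.
      have := integrable_bdm_big (bdm_cst 0).
      by apply: eq_integrable => // w _; rewrite /= big_nil.
    have ik0 := integrable_bdm_big (trig_pow_bdm m (2^-1 ^+ k)).
    have ik : nu.-integrable big (EFin \o (fun w => q ^+ k * trig_pow m (2^-1 ^+ k) w)).
      exact: integrable_bdm_big (bdm_scale _ (trig_pow_bdm _ _)).
    split.
      rewrite big_cons -IH2 -RintegralZl// -RintegralD//.
      by apply: eq_Rintegral => w _; rewrite big_cons.
    have := integrableD mbig ik IH1.
    by apply: eq_integrable => // w _; rewrite /= big_cons.
  apply: (@le_trans _ _ (C * (\sum_(0 <= k < K) q ^+ k * (2^-1 ^+ k) `^ (m.*2)%:R +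
                              \int[nu]_(x in big) dyadic_sum m q K x))).
    rewrite E2.1 -big_split mulr_sumr; apply: ler_sum => k _ /=.
    rewrite -mulrDr mulrCA ler_wpM2l ?exprn_ge0//.
    by apply: HC; rewrite exprn_ge0.
  rewrite ler_wpM2l// lerD// /I -RintegralZl//.
  apply: le_Rintegral => //; first exact: E2.2.
    by have := integrableZl mbig A inu; apply: eq_integrable.
  by move=> x; exact: HA.
pose D := C * (B + A * I) / lo.
(* The lower comparison reaches only up to [2^K]; this cut-off is removed afterwards by Fatou's
   lemma, the bound being uniform in [K]. *)
pose f (K : nat) w := `|Y w| `^ r * (if (1 <= `|Y w|) && (`|Y w| < 2 ^+ K) then 1 else 0).
have mf K : measurable_fun setT (f K).
  apply: measurable_funM; first exact: (measurableT_comp mr mY).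
  apply: measurable_fun_ifT; [|exact: measurable_cst|exact: measurable_cst].
  have mn : measurable_fun setT (fun w => `|Y w|) by exact: measurableT_comp.
  apply: measurable_and.
    by apply: measurable_fun_ler => //; exact: measurable_cst.
  by apply: measurable_fun_ltr => //; exact: measurable_cst.
have f0 K w : 0 <= f K w by rewrite mulr_ge0 ?powR_ge0//; case: ifP.
have I0 : 0 <= I by apply: Rintegral_ge0 => x _; exact: powR_ge0.
have D0 : 0 <= D by rewrite divr_ge0 ?(ltW lo0)// mulr_ge0// addr_ge0// mulr_ge0.
have hf K : Lb P 1 D (f K).
  split; [exact: D0|exact: mf|].
  have [iS bS] := bounded K.
  apply: (@le_trans _ _ (\int[P]_w (lo^-1 * dyadic_sum m q K (Y w))%:E)%E).
    apply: ge0_le_integral_nm => w; first by rewrite lee_fin powR_ge0.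
    rewrite lee_fin powRr1// ger0_norm// /f; case: ifPn => [/andP[y1 y2]|_].
      by rewrite mulr1 -ler_pdivrMl ?invr_gt0// invrK Hlo.
    by rewrite mulr0 mulr_ge0 ?invr_ge0 ?(ltW lo0)// dyadic_sum_ge0.
  under eq_integral do rewrite EFinM.
  rewrite integralZl// powRr1//.
  have -> : (\int[P]_w (dyadic_sum m q K (Y w))%:E = (\int[P]_w dyadic_sum m q K (Y w))%:E)%E.
    by rewrite /Rintegral fineK//; exact: integrable_fin_num.
  by rewrite -EFinM lee_fin /D mulrC ler_wpM2r// invr_ge0 ltW.
pose g w := `|Y w| `^ r * (if 1 <= `|Y w| then 1 else 0).
have hg : Lb P 1 D g.
  apply: (Lb_fatou (f_ := f)) => // w.
  apply: (@cvg_trans _ (cst (g w) n @[n --> \oo])); last exact: cvg_cst.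
  apply: near_eq_cvg.
  have [N _ HN] : \forall n \near \oo, `|Y w| < 2 ^+ n.
    near=> n; apply: (@lt_le_trans _ _ n%:R); last first.
      by rewrite -natrX ler_nat ltnW// ltn_expl.
    near: n; exact: nbhs_infty_gtr.
  exists N => // n /HN /= h; rewrite /f /g h andbT.
  by [].
have ig := Lb_integrable (lexx 1) hg.
have i1 : P.-integrable setT (EFin \o (fun w => 1 + g w)).
  have := integrableD measurableT (finite_measure_integrable_cst P 1 measurableT) ig.
  by apply: eq_integrable => // w _; rewrite /= EFinD.
apply: (le_integrable _ _ _ i1) => //; first exact: measurable_EFin_powR.
move=> w _; rewrite /= lee_fin (ger0_norm (powR_ge0 _ _)).
have g0 : 0 <= g w by rewrite /g mulr_ge0 ?powR_ge0//; case: ifP.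
rewrite [leRHS]ger0_norm ?addr_ge0//.
rewrite /g; case: ifPn => [_|]; first by rewrite mulr1 lerDr.
rewrite -ltNge mulr0 addr0 => y1.
have p : 1 `^ r = 1 :> R by rewrite powR1.
by rewrite -[leRHS]p; apply: ge0_ler_powR; rewrite ?nnegrE// ltW.
Unshelve. all: by end_near. Qed.
End LevyMoments.

(** * Symmetrisation of the increments and its reversal *)

Section IncrementMoments.
Context d {T : measurableType d} {R : realType} (P : probability T R).
Variable X : int -> T -> R.
Hypothesis iidX : iid P X.
Variables (h b s2 : R) (nu : {measure set R -> \bar R}).
Hypothesis levy : levy_measure nu.
Hypothesis s20 : 0 <= s2.
Hypothesis h0 : 0 < h.
Let phi := levy_increment_cf h b s2 nu.
Hypothesis cfX : forall v, \int[P]_w cos (v * X 0 w) = complex.Re (phi v) /\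
  \int[P]_w sin (v * X 0 w) = complex.Im (phi v).
Hypothesis intX : P.-integrable setT (EFin \o X 0).

Let mX n : measurable_fun setT (X n). Proof. by have [] := iidX. Qed.

Let msin v : measurable_fun setT (fun x : R => sin (v * x)).
Proof.
apply: (@measurableT_comp _ _ _ _ _ _ (@sin R) _ (fun x => v * x)).
  by apply: continuous_measurable_fun; exact: continuous_sin.
exact: mulrl_measurable.
Qed.

Lemma bounded_integrable (f : T -> R) (B : R) : measurable_fun setT f -> (forall w, `|f w| <= B) ->
  P.-integrable setT (EFin \o f).
Proof.
move=> mf fB; apply: measurable_bounded_integrable => //.
- by rewrite (le_lt_trans (probability_le1 P measurableT))// ltry.
- exists B; split; [exact: num_real|move=> z zB x _ /=].
  by apply: (le_trans (fB x)); exact: ltW.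
Qed.

(** The difference of two independent copies has characteristic function [|phi|^2], in which drift
    and compensator cancel; only the real part of the exponent is left, doubled. *)
Lemma cf_increment_difference v :
  \int[P]_w cos (v * (X 1 w - X 0 w)) = expR (- (2 * h * levy_kappa nu s2 v)).
Proof.
have [_ [_ _]] := iidX.
have mc := (@bdm_cos R v).1.
have oc : off_index X 1 (fun w => cos (v * X 0 w)).
  by apply: (measurableT_comp mc); exact: off_index_X.
have os : off_index X 1 (fun w => sin (v * X 0 w)).
  by apply: (measurableT_comp (msin v)); exact: off_index_X.
have ic i : P.-integrable setT (EFin \o (fun w => cos (v * X i w))).
  by apply: (@bounded_integrable _ 1) => [|w]; [exact: (measurableT_comp mc)|exact: cos_max].
have is_ i : P.-integrable setT (EFin \o (fun w => sin (v * X i w))).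
  by apply: (@bounded_integrable _ 1) => [|w]; [exact: (measurableT_comp (msin v))|exact: sin_max].
have icc : P.-integrable setT (EFin \o (fun w => cos (v * X 0 w) * cos (v * X 1 w))).
  apply: (@bounded_integrable _ 1) => [|w].
    by apply: measurable_funM; exact: (measurableT_comp mc).
  by rewrite normrM mulr_ile1 ?cos_max.
have iss : P.-integrable setT (EFin \o (fun w => sin (v * X 0 w) * sin (v * X 1 w))).
  apply: (@bounded_integrable _ 1) => [|w].
    by apply: measurable_funM; exact: (measurableT_comp (msin v)).
  by rewrite normrM mulr_ile1 ?sin_max.
transitivity (\int[P]_w (cos (v * X 0 w) * cos (v * X 1 w) + sin (v * X 0 w) * sin (v * X 1 w))).
  by apply: eq_Rintegral => w _; rewrite mulrBr cosB; ring.
rewrite RintegralD//.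
have := RintegralM_off_index iidX (n := 1) mc oc (ic 0) (ic 0); rewrite /= => ->.
have := RintegralM_off_index iidX (n := 1) (msin v) os (is_ 0) (is_ 0); rewrite /= => ->.
have [-> ->] := cfX v.
rewrite /phi /levy_increment_cf /cexp.
set z := ((h%:C)%C * _)%R.
have zre : complex.Re z = h * (- levy_kappa nu s2 v).
  rewrite /z /lk_exponent /levy_kappa /= mul0r subr0; congr (h * _).
  rewrite opprD mulNr; congr (_ + _).
  transitivity (\int[nu]_x (-1 * (1 - cos (v * x)))).
    by congr fine; apply: eq_integral => x _; congr EFin; ring.
  rewrite RintegralZl// ?mulN1r//; exact: (integrable_levy_cos levy v).
clearbody z; rewrite /= zre.
set E := expR _; set c := cos _; set s := sin _.
have -> : E * c * (E * c) + E * s * (E * s) = E * E * (c ^+ 2 + s ^+ 2) by ring.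
by rewrite cos2Dsin2 mulr1 -expRD; congr expR; ring.
Qed.

(** Desymmetrisation: on the event [|X 0| <= A] one has [|X 1|^r <= 2^r (|X 1 - X 0|^r + A^r)]. The
    event is independent of [X 1] and has positive probability, so dividing by that probability
    gives a finite moment. *)
Lemma increment_moment (r : R) : 0 < r ->
  (\int[nu]_(x in [set x : R | (1 <= `|x|)%R]) ((`|x| `^ r)%R)%:E < +oo)%E ->
  exists K, Lb P r K (X 0).
Proof.
move=> r0 mom.
have mY : measurable_fun setT (fun w => X 1 w - X 0 w) by exact: measurable_funB.
have h20 : 0 <= 2 * h by rewrite mulr_ge0// ltW.
have iY := levy_moment levy s20 h20 mY cf_increment_difference r0 mom.
(* By Markov's inequality the probability of [|X 0| > A] is at most [E|X 0| / A < 1]. *)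
pose A := \int[P]_w `|X 0 w| + 1.
have A1 : 1 <= A by rewrite lerDr Rintegral_ge0.
have A0 : 0 < A by exact: lt_le_trans A1.
pose g (x : R) : R := if `|x| <= A then 1 else 0.
have mg : measurable_fun setT g.
  apply: measurable_fun_ifT; [|exact: measurable_cst|exact: measurable_cst].
  by apply: measurable_fun_ler; [exact: normr_measurable|exact: measurable_cst].
have g01 x : 0 <= g x <= 1 by rewrite /g; case: ifP; rewrite ?lexx ?ler01.
have ig : P.-integrable setT (EFin \o (fun w => g (X 0 w))).
  apply: (@bounded_integrable _ 1) => [|w]; first exact: measurableT_comp.
  by have /andP[? ?] := g01 (X 0 w); rewrite ger0_norm.
have inX : P.-integrable setT (EFin \o (fun w => `|X 0 w|)) by exact: integrable_norm.
have inA : P.-integrable setT (EFin \o (fun w => A^-1 * `|X 0 w|)).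
  by have := integrableZl measurableT A^-1 inX; apply: eq_integrable.
have p0 : 0 < \int[P]_w g (X 0 w).
  have : 1 <= \int[P]_w g (X 0 w) + A^-1 * \int[P]_w `|X 0 w|.
    rewrite -RintegralZl// -RintegralD//.
    have <- : \int[P]_w (1 : R) = 1.
      by rewrite Rintegral_cst// mul1r [X in fine X]probability_setT.
    apply: le_Rintegral => //.
    + exact: (finite_measure_integrable_cst P 1 measurableT).
    + by have := integrableD measurableT ig inA; apply: eq_integrable.
    + move=> w _; rewrite /g; case: ifPn => [_|].
        by rewrite lerDl mulr_ge0 ?invr_ge0 ?(ltW A0).
      by rewrite -ltNge add0r ler_pdivlMl// mulr1; exact: ltW.
  have : A^-1 * \int[P]_w `|X 0 w| < 1.
    by rewrite ltr_pdivrMl// mulr1 /A ltrDl.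
  lra.
have mr : measurable_fun setT (fun x : R => `|x| `^ r).
  by have /measurable_EFinP := @measurable_EFin_powR _ R R r id ltac:(exact: measurable_id).
have og : off_index X 1 (fun w => g (X 0 w)).
  by apply: (measurableT_comp mg); exact: off_index_X.
have prod : (\int[P]_w (g (X 0 w) * `|X 1 w| `^ r)%:E =
   \int[P]_w (g (X 0 w))%:E * \int[P]_w (`|X 1 w| `^ r)%:E)%E.
  apply: ge0_expectationM_indep.
  - exact: measurableT_comp.
  - exact: (measurableT_comp mr).
  - apply: (indep2_comp (f := id) (g := fun x => `|x| `^ r) _ mr (off_index_indep2 iidX og)).
    exact: measurable_id.
  - by move=> w; have /andP[] := g01 (X 0 w).
  - by move=> w; exact: powR_ge0.
have fin : (\int[P]_w (g (X 0 w) * `|X 1 w| `^ r)%:E < +oo)%E.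
  pose B w := 2 `^ r * (`|X 1 w - X 0 w| `^ r + A `^ r).
  have iB : P.-integrable setT (EFin \o B).
    have := integrableZl measurableT (2 `^ r) (integrableD measurableT iY
      (finite_measure_integrable_cst P (A `^ r) measurableT)).
    by apply: eq_integrable => // w _; rewrite /= -EFinD -EFinM.
  have /integrableP[_] := iB; apply: le_lt_trans.
  apply: ge0_le_integral_nm => w.
    by rewrite lee_fin mulr_ge0 ?powR_ge0//; have /andP[] := g01 (X 0 w).
  rewrite /= lee_fin [leRHS]ger0_norm; last by rewrite mulr_ge0 ?addr_ge0 ?powR_ge0.
  rewrite /g; case: ifPn => [XA|_]; last by rewrite mul0r mulr_ge0 ?addr_ge0 ?powR_ge0.
  rewrite mul1r; apply: (@le_trans _ _ ((`|X 1 w - X 0 w| + A) `^ r)).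
    apply: ge0_ler_powR; rewrite ?nnegrE ?(ltW r0)//.
      by rewrite addr_ge0// ltW.
    have := ler_normD (X 1 w - X 0 w) (X 0 w); rewrite subrK => /le_trans; apply.
    by rewrite lerD2l.
  by apply: powRD_le => //; exact: ltW.
have fin1 : (\int[P]_w (`|X 1 w| `^ r)%:E < +oo)%E.
  have ge0 : (0 <= \int[P]_w (`|X 1%R w| `^ r)%:E)%E.
    by apply: integral_ge0 => w _; rewrite lee_fin powR_ge0.
  move: fin; rewrite prod.
  have -> : (\int[P]_w (g (X 0 w))%:E = (\int[P]_w g (X 0 w))%:E)%E.
    by rewrite /Rintegral fineK//; exact: integrable_fin_num.
  move: ge0; case: (\int[P]_w _)%E => [x| |]//; rewrite ?ltry//.
  by rewrite gt0_muley ?lte_fin.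
apply: integrable_powR_Lb => //.
apply/integrableP; split; first exact: measurable_EFin_powR.
under eq_integral do rewrite /= ger0_norm ?powR_ge0//.
by rewrite -(ge0_integral_X iidX 1 mr)// => x; exact: powR_ge0.
Qed.
End IncrementMoments.

(** * Partial derivatives and perturbed roots *)

Section DirectionalMVT.
Context {R : realType} {V : normedModType R}.
Implicit Types (f : V -> R) (x v : V).

Lemma derive_line f x v (t : R) :
  (fun h : R => h^-1 *: (((fun s : R => f (x + s *: v)) \o shift t) (h *: (1 : R)) -
     f (x + t *: v))) =
  (fun h : R => h^-1 *: ((f \o shift (x + t *: v)) (h *: v) - f (x + t *: v))).
Proof.
apply/funext => h /=; congr (_ *: (f _ - _)).
by rewrite -[h *: 1]/(h * 1) mulr1 scalerDl addrCA addrC -!addrA; congr (_ + _); rewrite addrC.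
Qed.

Lemma is_derive_line f x v (t : R) : derivable f (x + t *: v) v ->
  is_derive t (1 : R) (fun s : R => f (x + s *: v)) ('D_v f (x + t *: v)).
Proof.
move=> df; have := df; rewrite /derivable -derive_line => dg.
by apply: DeriveDef => //; rewrite /derive derive_line.
Qed.

Lemma MVT_direction f x v (d : R) : 0 <= d ->
  (forall t, 0 <= t <= d -> derivable f (x + t *: v) v) ->
  exists2 t, 0 <= t <= d & f (x + d *: v) - f x = d * 'D_v f (x + t *: v).
Proof.
move=> d0 df; pose g (s : R) := f (x + s *: v).
have [||c] := @MVT_segment R g (fun t => 'D_v f (x + t *: v)) 0 d d0.
- by move=> t; rewrite in_itv/= => /andP[t0 td]; apply: is_derive_line; apply: df; rewrite !ltW.
- apply: derivable_within_continuous => t; rewrite in_itv/= => td.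
  by have [] := is_derive_line (df t td).
rewrite in_itv/= subr0 => cd E; exists c => //.
by rewrite mulrC -E /g scale0r addr0.
Qed.
End DirectionalMVT.

Section PartialDerivatives.
Context {R : realType} {p : nat}.
Implicit Types (f g : 'rV[R]_p -> R) (x y : 'rV[R]_p).

Lemma rv_norm_le x (M : R) : 0 <= M -> (forall i, `|x 0 i| <= M) -> `|x| <= M.
Proof.
move=> M0 H; rewrite [leLHS]/Num.Def.normr/= mx_normrE; apply: bigmax_le => //=.
by move=> -[a i] _; rewrite /= ord1.
Qed.

Lemma rv_coord_le x i : `|x 0 i| <= `|x|.
Proof.
rewrite [leRHS]/Num.Def.normr/= mx_normrE; apply/bigmax_geP; right => /=.
by exists (0, i).
Qed.

Lemma is_derive_coord (i j : 'I_p) x :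
  is_derive x (unitv R i) (fun z : 'rV[R]_p => z 0 j) ((j == i)%:R).
Proof.
have E : (fun h : R => h^-1 *: (((fun z : 'rV[R]_p => z 0 j) \o shift x) (h *: unitv R i) - x 0 j))
   @ 0^' --> ((j == i)%:R : R).
  apply: (@cvg_trans _ ((fun=> (j == i)%:R : R) @ 0^')); last exact: cvg_cst.
  apply: near_eq_cvg; near=> h; rewrite /= !mxE /= addrK.
  have h0 : h != 0 by near: h; exact: nbhs_dnbhs_neq.
  by rewrite -[_ *: _]/(_ * _) mulrA mulVf// mul1r.
apply: DeriveDef; first by apply/cvg_ex; eexists; exact: E.
exact/cvg_lim.
Unshelve. all: by end_near. Qed.

Lemma pderiv_step f i x (d M : R) :
  (forall t, `|t| <= `|d| -> 0 <= t * d -> derivable f (x + t *: unitv R i) (unitv R i) /\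
     `|pderiv f i (x + t *: unitv R i)| <= M) ->
  `|f (x + d *: unitv R i) - f x| <= M * `|d|.
Proof.
move=> H; set e := unitv R i.
have [d0|/ltW d0] := leP 0 d.
  have Hd t : 0 <= t <= d -> derivable f (x + t *: e) e /\ `|pderiv f i (x + t *: e)| <= M.
    by move=> /andP[t0 td]; apply: H; rewrite ?ger0_norm ?mulr_ge0.
  have [t td ->] := MVT_direction d0 (fun t td => (Hd t td).1).
  by rewrite normrM mulrC ler_wpM2r//; exact: (Hd t td).2.
have d0' : 0 <= - d by rewrite oppr_ge0.
have Hd t : 0 <= t <= - d -> derivable f (x + d *: e + t *: e) e /\
    `|pderiv f i (x + d *: e + t *: e)| <= M.
  move=> /andP[t0 td]; rewrite -addrA -scalerDl; apply: H; last by nra.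
  by rewrite !ler0_norm; lra.
have [t td E] := MVT_direction d0' (fun t td => (Hd t td).1).
move: E; rewrite -addrA -scalerDl subrr scale0r addr0 => E.
rewrite distrC E normrM normrN mulrC ler_wpM2r//.
exact: (Hd t td).2.
Qed.

(** The first-order bound is used twice, on [f] minus its affine part and on [pderiv f i]; hence
    [M d^2] without the factor one half. *)
Lemma pderiv_taylor2 f i x (d M : R) :
  (forall t, `|t| <= `|d| -> [/\ derivable f (x + t *: unitv R i) (unitv R i),
     derivable (pderiv f i) (x + t *: unitv R i) (unitv R i) &
     `|pderiv (pderiv f i) i (x + t *: unitv R i)| <= M]) ->
  `|f (x + d *: unitv R i) - f x - d * pderiv f i x| <= M * d ^+ 2.
Proof.
move=> H; set e := unitv R i; set c := pderiv f i x.
have M0 : 0 <= M by have [_ _ /(le_trans (normr_ge0 _))] := H 0 ltac:(by rewrite normr0).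
pose g z := f z - c * (z 0 i - x 0 i).
have gd t : `|t| <= `|d| -> is_derive (x + t *: e) e g (pderiv f i (x + t *: e) - c).
  move=> td; have [df _ _] := H t td.
  have D1 : is_derive (x + t *: e) e f (pderiv f i (x + t *: e)) by exact: DeriveDef.
  have D2 := is_deriveZ c (is_deriveB (is_derive_coord i i (x + t *: e)) (is_derive_cst (x 0 i) (x + t *: e) e)).
  by have := is_deriveB D1 D2; rewrite eqxx subr0 -[c *: 1]/(c * 1) mulr1.
have := @pderiv_step g i x d (M * `|d|).
rewrite -/e; have -> : g (x + d *: e) - g x = f (x + d *: e) - f x - d * c.
  by rewrite /g !mxE !eqxx /=; ring.
rewrite -mulrA -expr2 real_normK ?num_real//; apply => t td tpos.
have D := gd t td; split; first exact: ex_derive.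
rewrite /pderiv -/e (@derive_val _ _ _ _ _ _ _ D).
apply: (@le_trans _ _ (M * `|t|)); last by rewrite ler_wpM2l.
apply: pderiv_step => s st _.
by have [_ d2 b] := H s (le_trans st td).
Qed.

Let telescope_row x y k : 'rV[R]_p := \row_i (if (i < k)%N then x 0 i else y 0 i).

(** The norm is the maximum of the coordinates, so balls are boxes and the coordinates can be
    exchanged one at a time without leaving the ball. Only partial derivatives enter, at the cost of
    the factor [p]. *)
Lemma pderiv_lipschitz f (c : 'rV[R]_p) (rho M : R) :
  (forall y, `|y - c| <= rho -> forall i, derivable f y (unitv R i) /\ `|pderiv f i y| <= M) ->
  forall x y, `|x - c| <= rho -> `|y - c| <= rho -> `|f x - f y| <= p%:R * M * `|x - y|.
Proof.
move=> H x y xc yc.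
have rho0 : 0 <= rho by exact: le_trans xc.
have claim k : (k <= p)%N -> `|f (telescope_row x y k) - f y| <= k%:R * M * `|x - y|.
  elim: k => [|k IH] kp.
    rewrite (_ : telescope_row x y 0 = y) ?subrr ?normr0 ?mul0r//.
    by apply/rowP => i; rewrite mxE.
  set i := Ordinal kp; set z := telescope_row x y k; set d := x 0 i - y 0 i.
  have zE : telescope_row x y k.+1 = z + d *: unitv R i.
    apply/rowP => j; rewrite !mxE eqxx /=.
    have [->|ji] := eqVneq j i.
      by rewrite /= ltnSn ltnn mulr1 /d addrC subrK.
    by rewrite mulr0 addr0 ltnS leq_eqVlt -[j == k :> nat]/(j == i) (negbTE ji).
  have step : `|f (z + d *: unitv R i) - f z| <= M * `|d|.
    apply: pderiv_step => t td tpos.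
    suff B : `|z + t *: unitv R i - c| <= rho by exact: H.
    apply: rv_norm_le => // j; rewrite !mxE eqxx /=.
    have [->|ji] := eqVneq j i.
      rewrite /= ltnn mulr1.
      have /ler_normlP[h1 h2] := le_trans (rv_coord_le (x - c) i) xc.
      have /ler_normlP[h3 h4] := le_trans (rv_coord_le (y - c) i) yc.
      rewrite !mxE in h1 h2 h3 h4.
      rewrite /d in td tpos; apply/ler_normlP; split.
        have [t0|t0] := leP 0 t; first by clear -h3 h4 t0; lra.
        have dneg : x 0 i - y 0 i <= 0 by rewrite leNgt; apply/negP => dp; nra.
        by rewrite (ltr0_norm t0) (ler0_norm dneg) in td; lra.
      have [t0|t0] := leP t 0; first by lra.
      have dpos : 0 <= x 0 i - y 0 i by rewrite leNgt; apply/negP => dp; nra.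
      by rewrite (gtr0_norm t0) (ger0_norm dpos) in td; lra.
    rewrite mulr0 addr0; case: ifP => _.
      by have := le_trans (rv_coord_le (x - c) j) xc; rewrite !mxE.
    by have := le_trans (rv_coord_le (y - c) j) yc; rewrite !mxE.
  have M0 : 0 <= M by have [_] := H y yc i; exact: le_trans.
  rewrite zE; apply: (le_trans (ler_distD (f z) _ _)).
  apply: (le_trans (lerD step (IH (ltnW kp)))).
  rewrite -natr1 !mulrDl mul1r addrC lerD2l ler_wpM2l//.
  by have := rv_coord_le (x - y) i; rewrite !mxE.
have := claim p (leqnn p).
by rewrite (_ : telescope_row x y p = x)//; apply/rowP => i; rewrite mxE ltn_ord.
Qed.

Lemma pderiv_first_order (G : 'I_p -> 'rV[R]_p -> R) (H : 'M[R]_p) (c : 'rV[R]_p) (rho M : R) :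
  0 <= M -> (forall y, `|y - c| <= rho -> forall i j, derivable (G j) y (unitv R i) /\
     `|pderiv (G j) i y - H i j| <= M) ->
  forall x y, `|x - c| <= rho -> `|y - c| <= rho ->
  `|(\row_j (G j x - G j y)) - (x - y) *m H| <= p%:R * M * `|x - y|.
Proof.
move=> M0 hG x y xc yc; apply: rv_norm_le => [|j]; first by rewrite !mulr_ge0.
pose g z := G j z - \sum_(i < p) H i j *: (z : 'rV[R]_p) 0 i.
have -> : (\row_j (G j x - G j y) - (x - y) *m H) 0 j = g x - g y.
  rewrite !mxE /g opprB addrACA -opprB addrC -[in RHS]addrC.
  have -> : \sum_(i < p) (x - y) 0 i * H i j =
    \sum_(i < p) H i j *: x 0 i - \sum_(i < p) H i j *: y 0 i.
    by rewrite -sumrB; apply: eq_bigr => i _; rewrite !mxE -[in RHS]mulrBr mulrC.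
  by ring.
apply: (@pderiv_lipschitz g c rho M) => // z zc i.
have [dG bG] := hG z zc i j.
have D1 : is_derive z (unitv R i) (G j) (pderiv (G j) i z) by exact: DeriveDef.
have D2 : is_derive z (unitv R i) (fun z : 'rV[R]_p => \sum_(k < p) H k j *: z 0 k) (H i j).
  have := @is_derive_sum R _ _ p (fun k (z : 'rV[R]_p) => H k j *: z 0 k) z (unitv R i)
     (fun k => H k j *: ((k == i)%:R : R)) (fun k => is_deriveZ _ (is_derive_coord i k z)).
  rewrite fct_sumE (bigD1 i)//= eqxx big1 ?addr0 => [|k ki]; last first.
    by rewrite (negbTE ki) scaler0.
  by rewrite -[H i j *: 1]/(H i j * 1) mulr1.
have D := is_deriveB D1 D2.
split; first exact: (@ex_derive _ _ _ _ _ _ _ D).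
by rewrite /pderiv (@derive_val _ _ _ _ _ _ _ D).
Qed.

(** Differentiability certified by a quadratic remainder: such a remainder bound passes to pointwise
    limits, which is how limits of smooth criteria are differentiated later. *)
Lemma is_derive_quadratic f i x (g C rho : R) : 0 < rho ->
  (forall t, `|t| <= rho -> `|f (x + t *: unitv R i) - f x - t * g| <= C * t ^+ 2) ->
  is_derive x (unitv R i) f g.
Proof.
move=> rho0 H; set e := unitv R i.
have C1 : 0 < `|C| + 1 by rewrite ltr_wpDl.
have E : (fun h : R => h^-1 *: ((f \o shift x) (h *: e) - f x)) @ 0^' --> g.
  apply/cvgrPdist_le => /= z z0; near=> h.
  have h0 : h != 0 by near: h; exact: nbhs_dnbhs_neq.
  have hr : `|h| <= rho.
    near: h; apply: dnbhs0_le => //.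
  have hz : `|h| <= z / (`|C| + 1).
    by near: h; apply: dnbhs0_le; rewrite divr_gt0.
  have := H h hr; rewrite -/e (addrC x) => Hh.
  have -> : g - h^-1 *: (f (h *: e + x) - f x) = - (h^-1 * (f (h *: e + x) - f x - h * g)).
    by rewrite -[_ *: _]/(_ * _); field.
  rewrite normrN normrM normfV ler_pdivrMl ?normr_gt0//.
  apply: (le_trans Hh); rewrite -(real_normK (num_real h)) expr2 mulrCA ler_wpM2l//.
  apply: (@le_trans _ _ ((`|C| + 1) * `|h|)).
    by rewrite ler_wpM2r// (le_trans (ler_norm C))// lerDl.
  by rewrite mulrC -ler_pdivlMr.
apply: DeriveDef; first by apply/cvg_ex; eexists; exact: E.
exact/cvg_lim.
Unshelve. all: by end_near. Qed.
End PartialDerivatives.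

Section IteratedPartials.
Context {R : realType} {p : nat}.
Variable G : set 'rV[R]_p.
Hypothesis oG : open G.
Implicit Types (f g : 'rV[R]_p -> R) (s : seq 'I_p).

(** The derivability half of [Ck]; sizes of the derivatives are tracked separately by explicit
    bounds. *)
Definition smooth (k : nat) f := forall s, (size s < k)%N ->
  forall i x, G x -> derivable (pD s f) x (unitv R i).

Let nearG x : G x -> \forall y \near x, G y.
Proof. by move=> Gx; exact: open_nbhs_nbhs. Qed.

Lemma pD_eq f g : (forall x, G x -> f x = g x) -> forall s x, G x -> pD s f x = pD s g x.
Proof.
move=> fg; elim=> [|i s IH] x Gx /=; first exact: fg.
apply: near_eq_derive; apply: filterS (nearG Gx) => y Gy; exact: IH.
Qed.

Lemma smooth_eq k f g : (forall x, G x -> f x = g x) -> smooth k f -> smooth k g.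
Proof.
move=> fg sf s sk i x Gx; have := sf s sk i x Gx; apply: near_eq_derivable.
by apply: filterS (nearG Gx) => y Gy; exact: pD_eq.
Qed.

Lemma pD_cst (c : R) s x : pD s (fun=> c) x = if s is [::] then c else 0.
Proof.
elim: s x => [//|i s IH] x /=.
rewrite /pderiv (_ : pD s (fun=> c) = cst (if s is [::] then c else 0)); last first.
  by apply/funext => y; rewrite IH.
exact: derive_cst.
Qed.

Lemma smooth_cst k c : smooth k (fun=> c).
Proof.
move=> s _ i x _.
rewrite (_ : pD s (fun=> c) = cst (if s is [::] then c else 0)); last first.
  by apply/funext => y; rewrite pD_cst.
exact: derivable_cst.
Qed.

Lemma pD_lin k f g (a b : R) : smooth k f -> smooth k g ->
  forall s, (size s <= k)%N -> forall x, G x ->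
  pD s (fun y => a * f y + b * g y) x = a * pD s f x + b * pD s g x.
Proof.
move=> sf sg; elim=> [//|i s IH] sk x Gx /=.
have Df : is_derive x (unitv R i) (pD s f) (pderiv (pD s f) i x) by apply: DeriveDef => //; exact: sf.
have Dg : is_derive x (unitv R i) (pD s g) (pderiv (pD s g) i x) by apply: DeriveDef => //; exact: sg.
have D := is_deriveD (is_deriveZ a Df) (is_deriveZ b Dg).
rewrite -[RHS](@derive_val _ _ _ _ _ _ _ D); apply: near_eq_derive.
by apply: filterS (nearG Gx) => y Gy; exact: IH (ltnW sk) y Gy.
Qed.

Lemma smooth_lin k f g (a b : R) : smooth k f -> smooth k g ->
  smooth k (fun y => a * f y + b * g y).
Proof.
move=> sf sg s sk i x Gx.
have := derivableD (derivableZ (k := a) (sf s sk i x Gx)) (derivableZ (k := b) (sg s sk i x Gx)).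
apply: near_eq_derivable; apply: filterS (nearG Gx) => y Gy.
by apply/esym; exact: (pD_lin a b sf sg (ltnW sk) Gy).
Qed.

Lemma smooth_sum k (I : Type) (r : seq I) (F : I -> 'rV[R]_p -> R) :
  (forall i, smooth k (F i)) -> smooth k (fun x => \sum_(i <- r) F i x).
Proof.
move=> H; elim: r => [|i r IH].
  rewrite (_ : (fun x => _) = fun=> 0); first exact: smooth_cst.
  by apply/funext => x; rewrite big_nil.
rewrite (_ : (fun x => _) = fun y => 1 * F i y + 1 * (\sum_(j <- r) F j y)).
  exact: smooth_lin.
by apply/funext => x; rewrite big_cons !mul1r.
Qed.

Lemma pD_sum k (I : Type) (r : seq I) (F : I -> 'rV[R]_p -> R) :
  (forall i, smooth k (F i)) -> forall s, (size s <= k)%N -> forall x, G x ->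
  pD s (fun x => \sum_(i <- r) F i x) x = \sum_(i <- r) pD s (F i) x.
Proof.
move=> H s sk x Gx; elim: r => [|i r IH].
  rewrite big_nil (@pD_eq _ (fun=> 0)) ?pD_cst//; first by case: s {sk}.
  by move=> y _; rewrite big_nil.
rewrite big_cons -IH -[pD s (F i) x]mul1r -[X in _ + X]mul1r.
rewrite -(pD_lin 1 1 (H i) (smooth_sum H) sk Gx).
by apply: pD_eq => // y _; rewrite big_cons !mul1r.
Qed.

Lemma pD_scale k f (a : R) : smooth k f -> forall s, (size s <= k)%N ->
  forall x, G x -> pD s (fun y => a * f y) x = a * pD s f x.
Proof.
move=> sf s sk x Gx; have := pD_lin a 0 sf sf sk Gx; rewrite mul0r addr0 => <-.
by apply: pD_eq => // y _; rewrite mul0r addr0.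
Qed.

Lemma smooth_scale k f (a : R) : smooth k f -> smooth k (fun y => a * f y).
Proof.
move=> sf; rewrite (_ : (fun y => _) = fun y => a * f y + 0 * f y).
  exact: smooth_lin.
by apply/funext => x; rewrite mul0r addr0.
Qed.

(** The index set of the Leibniz rule: every way of handing each derivative to one of two factors,
    with repetitions. Its [2 ^ size s] entries explain the powers of two in the product bounds. *)
Fixpoint splits s : seq (seq 'I_p * seq 'I_p) :=
  if s is i :: s' then [seq (i :: a.1, a.2) | a <- splits s'] ++
                       [seq (a.1, i :: a.2) | a <- splits s']
  else [:: ([::], [::])].

Lemma size_splits s : size (splits s) = (2 ^ size s)%N.
Proof. by elim: s => //= i s IH; rewrite size_cat !size_map IH expnS mul2n addnn. Qed.

Lemma splits_size s a : a \in splits s -> (size a.1 <= size s)%N /\ (size a.2 <= size s)%N.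
Proof.
elim: s a => [|i s IH] a /=; first by rewrite inE => /eqP ->.
rewrite mem_cat => /orP[] /mapP[b /IH[h1 h2] ->] /=; split => //; exact: leqW.
Qed.

Let smooth_is_derive k f s i x : smooth k f -> (size s < k)%N -> G x ->
  is_derive x (unitv R i) (pD s f) (pD (i :: s) f x).
Proof. by move=> sf sk Gx; apply: DeriveDef => //; exact: sf. Qed.

Lemma pD_mul k f g : smooth k f -> smooth k g ->
  forall s, (size s <= k)%N -> forall x, G x ->
  pD s (fun y => f y * g y) x = \sum_(a <- splits s) pD a.1 f x * pD a.2 g x.
Proof.
move=> sf sg; elim=> [|i s IH] sk x Gx /=; first by rewrite big_seq1.
rewrite big_cat !big_map /= -big_split /=.
have D : is_derive x (unitv R i) (fun y => \sum_(a <- splits s) pD a.1 f y * pD a.2 g y)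
   (\sum_(a <- splits s) (pD (i :: a.1) f x * pD a.2 g x + pD a.1 f x * pD (i :: a.2) g x)).
  have : {subset splits s <= [pred a | (size a.1 < k)%N && (size a.2 < k)%N]}.
    move=> a /splits_size[h1 h2]; rewrite inE.
    by rewrite (leq_ltn_trans h1 sk) (leq_ltn_trans h2 sk).
  elim: (splits s) => [_|a l IHl sub].
    rewrite big_nil (_ : (fun y => _) = cst 0); first exact: is_derive_cst.
    by apply/funext => y; rewrite big_nil.
  have /andP[a1 a2] := sub a (mem_head _ _).
  rewrite big_cons.
  have D1 := is_deriveM (smooth_is_derive i sf a1 Gx) (smooth_is_derive i sg a2 Gx).
  have sub' : {subset l <= [pred a | (size a.1 < k)%N && (size a.2 < k)%N]}.
    by move=> b bl; apply: sub; rewrite inE bl orbT.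
  have D2 := IHl sub'.
  have D3 := is_deriveD D1 D2.
  rewrite (_ : (fun y => \sum_(b <- a :: l) pD b.1 f y * pD b.2 g y) =
     pD a.1 f * pD a.2 g + (fun y => \sum_(b <- l) pD b.1 f y * pD b.2 g y)); last first.
    by apply/funext => y; rewrite big_cons.
  rewrite [X in is_derive _ _ _ (X + _)](_ : _ =
    pD a.1 f x *: pD (i :: a.2) g x + pD a.2 g x *: pD (i :: a.1) f x); first exact: D3.
  by rewrite -![_ *: _]/(_ * _) addrC [X in _ + X]mulrC.
rewrite -(@derive_val _ _ _ _ _ _ _ D); apply: near_eq_derive.
by apply: filterS (nearG Gx) => y Gy; exact: IH (ltnW sk) y Gy.
Qed.

Lemma smooth_mul k f g : smooth k f -> smooth k g -> smooth k (fun y => f y * g y).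
Proof.
move=> sf sg s sk i x Gx.
suff : derivable (fun y => \sum_(a <- splits s) pD a.1 f y * pD a.2 g y) x (unitv R i).
  apply: near_eq_derivable; apply: filterS (nearG Gx) => y Gy.
  by apply/esym; exact: (pD_mul sf sg (ltnW sk) Gy).
have : {subset splits s <= [pred a | (size a.1 < k)%N && (size a.2 < k)%N]}.
  move=> a /splits_size[h1 h2]; rewrite inE.
  by rewrite (leq_ltn_trans h1 sk) (leq_ltn_trans h2 sk).
elim: (splits s) => [_|a l IHl sub].
  rewrite (_ : (fun y => _) = cst 0); first exact: derivable_cst.
  by apply/funext => y; rewrite big_nil.
have /andP[a1 a2] := sub a (mem_head _ _).
rewrite (_ : (fun y => \sum_(b <- a :: l) pD b.1 f y * pD b.2 g y) =
     pD a.1 f * pD a.2 g + (fun y => \sum_(b <- l) pD b.1 f y * pD b.2 g y)); last first.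
  by apply/funext => y; rewrite big_cons.
apply: derivableD; last by apply: IHl => b bl; apply: sub; rewrite inE bl orbT.
by apply: derivableM; [exact: sf|exact: sg].
Qed.

Lemma pD_mul_le k f g (A B : R) x : smooth k f -> smooth k g -> G x ->
  (forall s, (size s <= k)%N -> `|pD s f x| <= A) ->
  (forall s, (size s <= k)%N -> `|pD s g x| <= B) ->
  forall s, (size s <= k)%N -> `|pD s (fun y => f y * g y) x| <= 2 ^+ k * (A * B).
Proof.
move=> sf sg Gx fA gB s sk; rewrite (pD_mul sf sg sk Gx).
apply: (le_trans (ler_norm_sum _ _ _)).
have A0 : 0 <= A by exact: le_trans (fA [::] isT).
have B0 : 0 <= B by exact: le_trans (gB [::] isT).
apply: (@le_trans _ _ (\sum_(a <- splits s) A * B)).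
  rewrite big_seq [leRHS]big_seq; apply: ler_sum => a /splits_size[h1 h2].
  by rewrite normrM ler_pM// ?fA ?gB// (leq_trans _ sk).
rewrite big_const_seq count_predT size_splits iter_addr_0 -[leLHS]mulr_natl natrX.
by rewrite ler_wpM2r ?mulr_ge0// ler_weXn2l// ler1n.
Qed.
End IteratedPartials.

(** * Roots of perturbed maps *)

Section PerturbedRoot.
Context {R : realType} {p : nat}.
Implicit Types (x y : 'rV[R]_p) (D : set 'rV[R]_p).

Lemma compact_cluster_seq D (u : nat -> 'rV[R]_p) : compact D -> (forall n, D (u n)) ->
  exists2 x, D x & forall e : R, 0 < e -> forall N, exists2 n, (N <= n)%N & `|u n - x| < e.
Proof.
move=> cD Du; have PF : ProperFilter (u @ \oo) by exact: fmap_proper_filter.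
have [|x [Dx clx]] := cD (u @ \oo) PF; first by exists 0%N => // n _; exact: Du.
exists x => // e e0 N.
have A : (u @ \oo) (u @` [set n | (N <= n)%N]).
  by exists N => // n Nn; exists n.
have B : nbhs x (ball x e) by exact: nbhsx_ballx.
have [_ [[n Nn <-]]] := clx _ _ A B.
by rewrite -ball_normE /ball_/= distrC => h; exists n.
Qed.

Lemma mulmx_row_le (A : 'M[R]_p) x : `|x *m A| <= (\sum_i \sum_j `|A i j|) * `|x|.
Proof.
have S0 : 0 <= \sum_i \sum_j `|A i j| by apply: sumr_ge0 => i _; exact: sumr_ge0.
apply: rv_norm_le => [|j]; first by rewrite mulr_ge0.
rewrite mxE (le_trans (ler_norm_sum _ _ _))// mulr_suml; apply: ler_sum => i _.
rewrite normrM mulrC ler_pM// ?rv_coord_le//.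
by rewrite (bigD1 j)//= lerDl sumr_ge0.
Qed.

(** Otherwise points far from [x0] with [G] tending to zero would cluster in [D]; the local
    Lipschitz bound makes the cluster point a second zero. *)
Lemma compact_away_zero D (G : 'rV[R]_p -> 'rV[R]_p) x0 (r : R) : compact D -> 0 < r ->
  (forall x, D x -> exists e C : R, [/\ 0 < e, 0 <= C &
     forall y, D y -> `|y - x| <= e -> `|G y - G x| <= C * `|y - x|]) ->
  (forall x, D x -> G x = 0 -> x = x0) ->
  exists2 m, 0 < m & forall x, D x -> `|G x| < m -> `|x - x0| < r.
Proof.
move=> cD r0 lipG uniq; apply: contrapT => H.
have {}H n : exists x, [/\ D x, `|G x| < n.+1%:R^-1 & r <= `|x - x0|].
  apply: contrapT => Hn; apply: H; exists n.+1%:R^-1; first by rewrite invr_gt0.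
  move=> x Dx Gx; rewrite ltNge; apply/negP => xr; apply: Hn; by exists x.
have [u Hu] := choice H.
have [x Dx clx] := compact_cluster_seq cD (fun n => let: And3 a _ _ := Hu n in a).
have [e [C [e0 C0 lip]]] := lipG x Dx.
have Gx0 : G x = 0.
  apply/eqP; rewrite -normr_le0; apply/ler_addgt0Pr => z z0; rewrite add0r.
  have d0 : 0 < Num.min e (z / (2 * (C + 1))).
    by rewrite lt_min e0/= divr_gt0// mulr_gt0// ltr_wpDl.
  have [N _ HN] : \forall n \near \oo, n.+1%:R^-1 <= z / 2 :> R.
    have z20 : 0 < z / 2 by rewrite divr_gt0.
    have := @cvg_harmonic R => /cvgrPdist_le /(_ _ z20); apply: filterS => n.
    by rewrite sub0r normrN ger0_norm ?invr_ge0.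
  have [n Nn] := clx _ d0 N; rewrite lt_min => /andP[ne nz].
  have [Dn Gn _] := Hu n.
  have h1 := lip (u n) Dn (ltW ne).
  have h2 : C * `|u n - x| <= z / 2.
    apply: (@le_trans _ _ ((C + 1) * (z / (2 * (C + 1))))).
      by apply: ler_pM => //; [rewrite lerDl|exact: ltW].
    have C1 : C + 1 != 0 by rewrite lt0r_neq0// ltr_wpDl.
    by rewrite le_eqVlt; apply/orP; left; apply/eqP; field; rewrite C1.
  have h3 := HN n Nn; have := ler_distD (G (u n)) (G x) 0; rewrite !subr0 distrC.
  by move: h1 h2 h3 (ltW Gn); move: (n.+1%:R^-1) => q; clear; lra.
have [n _] := clx r r0 0%N; have [_ _] := Hu n.
by rewrite (uniq x Dx Gx0) leNgt => /negP.
Qed.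

(** The steps of the iteration shrink geometrically, so a cluster point of the iterates, provided by
    compactness of the ball, is fixed. *)
Lemma contraction_root (U : 'rV[R]_p -> 'rV[R]_p) x0 (r : R) : 0 <= r ->
  (forall x y, `|x - x0| <= r -> `|y - x0| <= r -> `|U x - U y| <= 2^-1 * `|x - y|) ->
  `|U x0 - x0| <= r / 2 -> exists2 x, `|x - x0| <= r & U x = x.
Proof.
move=> r0 lipU U0; pose B := [set x | `|x - x0| <= r].
have UB x : B x -> B (U x).
  rewrite /B /= => xr; apply: (le_trans (ler_distD (U x0) _ _)).
  have := lipU x x0 xr; rewrite subrr normr0 => /(_ r0); lra.
have cB : compact B.
  apply: bounded_closed_compact.
    exists (`|x0| + r); split; first exact: num_real.
    move=> M HM x Bx; apply: ltW; apply: le_lt_trans HM.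
    by rewrite -[x](subrK x0) addrC (le_trans (ler_normD _ _))// lerD2l.
  rewrite (_ : B = closed_ball_ Num.norm x0 r); first exact: closed_closed_ball_.
  by apply/seteqP; split => x; rewrite /B /closed_ball_ /= distrC.
pose u n := iter n U x0.
have Bu n : B (u n).
  elim: n => [|n IH]; last exact: UB.
  by rewrite /B /= subrr normr0.
have step n : `|u n.+1 - u n| <= 2^-1 ^+ n * (r / 2).
  elim: n => [|n IH]; first by rewrite expr0 mul1r.
  apply: (le_trans (lipU _ _ (Bu n.+1) (Bu n))).
  by rewrite exprS -mulrA ler_wpM2l.
have [x Bx clx] := compact_cluster_seq cB Bu; exists x => //.
apply/eqP; rewrite -subr_eq0 -normr_le0; apply/ler_addgt0Pr => z z0; rewrite add0r.
have [N _ HN] : \forall n \near \oo, 2^-1 ^+ n * (r / 2) <= z / 3 :> R.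
  have z30 : 0 < z / 3 by rewrite divr_gt0.
  have g : (2^-1 : R) ^+ n * (r / 2) @[n --> \oo] --> (0 : R).
    rewrite -(mul0r (r / 2)); apply: cvgMl; apply: cvg_expr.
    by rewrite ger0_norm// invf_lt1// ltr1n.
  have := g => /cvgrPdist_le /(_ _ z30); apply: filterS => n.
  by rewrite sub0r normrN => /(le_trans (ler_norm _)).
have [n Nn nz] := clx (z / 3) (divr_gt0 z0 (ltr0Sn _ 2)) N.
have h1 := le_trans (step n) (HN n Nn).
have h2 := lipU x (u n) Bx (Bu n).
have h3 := ler_distD (U (u n)) (U x) x; have h4 := ler_distD (u n) (U (u n)) x.
move: nz h1 h2 h3 h4; rewrite [`|x - u n|]distrC /=.
by move: (normr_ge0 (u n - x)); clear; lra.
Qed.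

(** A perturbation [F] of [G] which is small in [C^0] on [D] and in the
    Lipschitz sense near the simple zero [x0] of [G] has a zero, obtained as a
    fixed point of the simplified Newton map [x |-> x - F x *m invmx H]. *)
Lemma perturbed_root D (G : 'rV[R]_p -> 'rV[R]_p) x0 (H : 'M[R]_p) (rho L : R) :
  compact D -> 0 < rho -> 0 <= L -> (forall x, `|x - x0| <= rho -> D x) ->
  (forall x, D x -> exists e C : R, [/\ 0 < e, 0 <= C &
     forall y, D y -> `|y - x| <= e -> `|G y - G x| <= C * `|y - x|]) ->
  (forall x, D x -> G x = 0 -> x = x0) -> G x0 = 0 -> H \in unitmx ->
  (forall (r : R) x y, r <= rho -> `|x - x0| <= r -> `|y - x0| <= r ->
     `|G x - G y - (x - y) *m H| <= L * r * `|x - y|) ->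
  exists2 dl, 0 < dl & exists2 C, 0 <= C & forall (F : 'rV[R]_p -> 'rV[R]_p) (eta : R),
    0 <= eta -> eta <= dl -> (forall x, D x -> `|F x - G x| <= eta) ->
    (forall x y, `|x - x0| <= rho -> `|y - x0| <= rho ->
       `|(F x - G x) - (F y - G y)| <= eta * `|x - y|) ->
    (exists x, D x /\ F x = 0) /\
    forall x, D x -> F x = 0 -> `|x - x0| <= C * eta /\
      `|x - x0 + F x0 *m invmx H| <= C * eta ^+ 2.
Proof.
move=> cD rho0 L0 BD lipG uniqG G0 uH first.
pose h := \sum_i \sum_j `|invmx H i j| + 1.
have h1 : 1 <= h by rewrite lerDr; apply: sumr_ge0 => i _; exact: sumr_ge0.
have h0 : 0 < h by exact: lt_le_trans h1.
have hn : h != 0 by exact: lt0r_neq0.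
have hle x : `|x *m invmx H| <= h * `|x|.
  by apply: (le_trans (mulmx_row_le _ _)); rewrite ler_wpM2r// lerDl.
(* Within this radius the nonlinearity of [G] contributes at most [1/4] to the Lipschitz constant of
   the Newton map. *)
pose r1 := Num.min rho (4 * h * (L + 1))^-1.
have hL0 : 0 < 4 * h * (L + 1) by rewrite !mulr_gt0// ltr_wpDl.
have r10 : 0 < r1 by rewrite lt_min rho0 invr_gt0.
have r1rho : r1 <= rho by rewrite ge_min lexx.
have hLr : h * (L * r1) <= 4^-1.
  apply: (@le_trans _ _ (h * ((L + 1) * (4 * h * (L + 1))^-1))).
    by rewrite ler_wpM2l ?(ltW h0)// ler_pM ?(ltW r10)// ?lerDl// ge_min lexx orbT.
  have L1 : L + 1 != 0 by rewrite lt0r_neq0// ltr_wpDl.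
  by rewrite le_eqVlt; apply/orP; left; apply/eqP; field; rewrite ?hn ?L1.
have [m m0 Hm] := compact_away_zero cD r10 lipG uniqG.
(* The first entry forces every root of [F] into the ball of radius [r1]; the second lets the
   perturbation contribute at most another [1/4] to the Lipschitz constant; the third makes the
   first Newton step at most [r1 / 2]. *)
pose dl := Num.min (m / 2) (Num.min (4 * h)^-1 (r1 / (2 * h))).
have dl0 : 0 < dl by rewrite !lt_min !divr_gt0 ?invr_gt0 ?mulr_gt0.
exists dl => //.
pose C := 2 * h + h * (L * (2 * h) ^+ 2 + 2 * h).
have hh0 : 0 <= h by exact: ltW.
have C20 : 0 <= h * (L * (2 * h) ^+ 2 + 2 * h).
  by rewrite mulr_ge0// addr_ge0 ?mulr_ge0// sqr_ge0.
have C0 : 0 <= C by rewrite addr_ge0// mulr_ge0.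
exists C => // F eta eta0; rewrite !le_min => /and3P[em e4 er] FG lipP.
have he : h * eta <= 4^-1.
  by move: (ler_wpM2l (ltW h0) e4); rewrite invfM mulrCA divff ?mulr1// lt0r_neq0.
have invK x : x *m H *m invmx H = x by rewrite mulmxK.
have Dx0 : D x0 by apply: BD; rewrite subrr normr0 ltW.
split.
  pose U x := x - F x *m invmx H.
  have [||x xr Ux] := @contraction_root U x0 r1 (ltW r10).
  - move=> x y xr yr; rewrite /U.
    have -> : x - F x *m invmx H - (y - F y *m invmx H) =
       - ((G x - G y - (x - y) *m H + ((F x - G x) - (F y - G y))) *m invmx H).
      have -> : G x - G y - (x - y) *m H + ((F x - G x) - (F y - G y)) =
          F x - F y - (x - y) *m H.
        move: (_ *m H) => w; apply/rowP => i; rewrite !mxE; ring.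
      rewrite mulmxBl invK mulmxBl; move: (_ *m _) (_ *m _) => w w'.
      by apply/rowP => i; rewrite !mxE; ring.
    rewrite normrN (le_trans (hle _))//.
    have e1 := first r1 x y r1rho xr yr.
    have e2 := lipP x y (le_trans xr r1rho) (le_trans yr r1rho).
    have e3 := ler_normD (G x - G y - (x - y) *m H) ((F x - G x) - (F y - G y)).
    have := ler_wpM2l (ltW h0) (le_trans e3 (lerD e1 e2)).
    move/le_trans; apply.
    rewrite mulrDr [h * (_ * _)]mulrA [h * (eta * _)]mulrA -mulrDl ler_wpM2r//.
    by move: hLr he; clear; lra.
  - have -> : U x0 - x0 = - (F x0 *m invmx H) by rewrite /U addrAC subrr add0r.
    rewrite normrN (le_trans (hle _))//.
    have := FG x0 Dx0; rewrite G0 subr0 => h2.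
    have := ler_wpM2l (ltW h0) (le_trans h2 er).
    move/le_trans; apply; rewrite le_eqVlt; apply/orP; left; apply/eqP.
    by field; rewrite hn.
  exists x; split; first by apply: BD; exact: le_trans xr r1rho.
  have F0 : F x *m invmx H = 0.
    by move/eqP: Ux; rewrite /U subr_eq addrC -subr_eq subrr eq_sym => /eqP.
  by rewrite -(mulmxKV uH (F x)) F0 mul0mx.
move=> x Dx Fx.
have Gx : `|G x| <= eta by have := FG x Dx; rewrite Fx sub0r normrN.
have xr : `|x - x0| < r1.
  apply: Hm => //; apply: (le_lt_trans Gx); apply: (le_lt_trans em).
  by move: m0; clear; lra.
set t := `|x - x0| in xr *.
have t0 : 0 <= t by exact: normr_ge0.
have trho : t <= rho by exact: le_trans (ltW xr) r1rho.
have x0r s : 0 <= s -> `|x0 - x0| <= s by rewrite subrr normr0.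
have E1 := first t x x0 trho (lexx _) (x0r t t0).
rewrite G0 subr0 -/t in E1.
have P1 : `|(F x - G x) - (F x0 - G x0)| <= eta * t.
  by apply: lipP => //; exact: x0r (ltW rho0).
rewrite Fx G0 sub0r subr0 in P1.
have tle : t <= 2 * h * eta.
  have e1 : t <= h * (L * t * t + eta).
    rewrite /t -[in leLHS](invK (x - x0)) (le_trans (hle _))// ler_wpM2l//.
    have := ler_distD (G x) ((x - x0) *m H) 0; rewrite !subr0.
    rewrite distrC in E1; rewrite -/t; move: E1 Gx; clear; lra.
  have e2 : h * (L * t * t) <= 4^-1 * t.
    rewrite [L * t * t]mulrC mulrCA [t * _]mulrC ler_wpM2r//.
    by apply: le_trans hLr; rewrite ler_wpM2l// ler_wpM2l// ltW.
  have he0 : 0 <= h * eta by rewrite mulr_ge0.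
  by move: e1 e2 he0; rewrite mulrDr; clear; lra.
split.
  by apply: (le_trans tle); rewrite ler_wpM2r// /C lerDl.
(* The first difference is the linearisation error of [G]. As [F x = 0] and [G x0 = 0], the sum
   [G x + F x0] is minus the increment of [F - G] between [x0] and [x]. Both are of second order in
   the size of the perturbation. *)
have -> : x - x0 + F x0 *m invmx H =
    ((x - x0) *m H - G x + (G x + F x0)) *m invmx H.
  by rewrite addrA subrK mulmxDl invK.
rewrite (le_trans (hle _))//.
have E3 : `|(x - x0) *m H - G x + (G x + F x0)| <= L * t * t + eta * t.
  rewrite (le_trans (ler_normD _ _))// lerD//; first by rewrite distrC.
  by rewrite -normrN opprD.
apply: (le_trans (ler_wpM2l hh0 E3)).
apply: (@le_trans _ _ (h * (L * (2 * h * eta) ^+ 2 + eta * (2 * h * eta)))).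
  rewrite ler_wpM2l// lerD//; last by rewrite ler_wpM2l.
  by rewrite -mulrA -expr2 ler_wpM2l// lerXn2r ?nnegrE ?mulr_ge0.
have -> : h * (L * (2 * h * eta) ^+ 2 + eta * (2 * h * eta)) =
  h * (L * (2 * h) ^+ 2 + 2 * h) * eta ^+ 2 by ring.
by rewrite ler_wpM2r ?sqr_ge0// /C lerDr mulr_ge0.
Qed.
End PerturbedRoot.

(** * Filtered noise *)

Section SummableVersion.
Context d {T : measurableType d} {R : realType} (P : probability T R).
Variable X : int -> T -> R.
Hypothesis iidX : iid P X.

Lemma iid_modification (N : set T) (X' : int -> T -> R) : measurable N -> P N = 0%E ->
  (forall n, measurable_fun setT (X' n)) -> (forall n w, ~ N w -> X' n w = X n w) ->
  iid P X'.
Proof.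
move=> mN N0 mX' XX'; have [mX [indX idX]] := iidX.
have PE (A B : set T) : measurable A -> measurable B ->
    (forall w, ~ N w -> (A w <-> B w)) -> P A = P B.
  move=> mA mB AB; rewrite -[in LHS](setIT A) -[in RHS](setIT B) -!integral_indic//.
  apply: (ae_eq_integral_nm mN N0) => w Nw; congr (_%:E); rewrite !indicE.
  by congr (nat_of_bool _)%:R; apply/idP/idP; rewrite !inE => /(AB w Nw).
have mpre (Y : int -> T -> R) n B : (forall n, measurable_fun setT (Y n)) -> measurable B ->
    measurable (Y n @^-1` B).
  by move=> mY mB; rewrite -[X in measurable X]setTI; exact: mY.
split; first exact: mX'.
split=> [s B us mB|n B mB].
- transitivity (P (\big[setI/setT]_(i <- s) (X i @^-1` B i))).
    apply: PE; [by apply: bigsetI_measurable => i _; exact: mpre|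
                by apply: bigsetI_measurable => i _; exact: mpre|].
    move=> w Nw; elim: s {us} => [|i s IH]; first by rewrite !big_nil.
    rewrite !big_cons; split=> -[h1 h2]; (split; last exact/IH).
      by move: h1; rewrite /preimage/= XX'.
    by rewrite /preimage/= XX'.
  rewrite indX//; apply: eq_bigr => i _; apply: PE; [exact: mpre|exact: mpre|].
  by move=> w Nw; rewrite /preimage/= XX'.
- transitivity (P (X n @^-1` B)).
    by apply: PE; [exact: mpre|exact: mpre|move=> w Nw; rewrite /preimage/= XX'].
  rewrite idX//; apply: PE; [exact: mpre|exact: mpre|].
  by move=> w Nw; rewrite /preimage/= XX'.
Qed.

(** Discarding a null set makes the moving average converge at every point, so
    that the filtered process is measurable. *)
Lemma summable_version (beta K : R) : 0 < beta < 1 -> Lb P 1 K (X 0) ->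
  exists (X' : int -> T -> R) (N : set T), [/\ iid P X', measurable N, P N = 0%E,
    forall n w, ~ N w -> X' n w = X n w &
    forall n w, exists B, forall M, \sum_(0 <= j < M) beta ^+ j * `|X' (n - j%:Z) w| <= B].
Proof.
move=> /andP[b0 b1] LX; have [mX _] := iidX.
pose f j w := (beta ^+ j * `|X (- j%:Z) w|)%:E.
have f0 j w : (0 <= f j w)%E by rewrite lee_fin mulr_ge0// exprn_ge0// ltW.
have mf j : measurable_fun setT (f j).
  by apply/measurable_EFinP; apply: measurable_funM => //; exact: measurableT_comp.
pose S w := (\sum_(0 <= j <oo) f j w)%E.
have mS : measurable_fun setT S by apply: ge0_emeasurable_sum.
have S0 w : (0 <= S w)%E by exact: nneseries_ge0.
have LXn n : (\int[P]_w (`|X n w|)%:E <= K%:E)%E.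
  have [K0 _] := Lb_X iidX n (@measurable_id _ R setT) LX.
  by rewrite powRr1//; under eq_integral do rewrite powRr1//.
have K0 : 0 <= K by case: LX.
have SK : (\int[P]_w S w <= (K / (1 - beta))%:E)%E.
  rewrite integral_nneseries//.
  apply: lime_le.
    by apply: is_cvg_nneseries => n _ _; apply: integral_ge0 => w _; exact: f0.
  near=> n.
  apply: (@le_trans _ _ (\sum_(0 <= j < n) (beta ^+ j * K)%:E)%E).
    apply: lee_sum => j _; under eq_integral do rewrite /f EFinM.
    rewrite ge0_integralZl ?lee_fin ?exprn_ge0 ?(ltW b0)//; last first.
      by apply/measurable_EFinP; exact: measurableT_comp.
    by rewrite EFinM lee_wpmul2l// lee_fin exprn_ge0// ltW.
  rewrite sumEFin lee_fin -mulr_suml mulrC ler_wpM2l//.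
  by apply: geo_sum_le; rewrite ltW.
pose N := S @^-1` [set +oo%E].
have mN : measurable N by rewrite -[N]setTI; apply: mS.
have N0 : P N = 0%E.
  have iS : P.-integrable setT S.
    apply/integrableP; split => //; under eq_integral do rewrite gee0_abs//.
    by apply: le_lt_trans SK _; exact: ltry.
  apply: (measure_negligible mN).
  move: (integrable_ae measurableT iS) => [A [mA A0 hA]]; exists A; split => // w Nw.
  by apply: hA => /= /(_ I); rewrite Nw.
pose X' n w := X n w * (\1_(~` N) w : R).
have XX' n w : ~ N w -> X' n w = X n w.
  by move=> Nw; rewrite /X' indicE mem_set// mulr1.
have X'0 n w : N w -> X' n w = 0.
  by move=> Nw; rewrite /X' indicE memNset ?mulr0//; exact.
exists X', N; split => //.
  apply: (iid_modification mN N0) => // n; apply: measurable_funM => //.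
  by apply: measurable_indic; exact: measurableC.
move=> n w; have [Nw|Nw] := pselect (N w).
  by exists 0 => M; rewrite big1// => j _; rewrite X'0// normr0 mulr0.
have [B HB] : exists B, forall M, \sum_(0 <= j < M) beta ^+ j * `|X (- j%:Z) w| <= B.
  have Sfin : S w \is a fin_num by rewrite ge0_fin_numE// ltey; apply/eqP.
  exists (fine (S w)) => M; rewrite -lee_fin fineK// -sumEFin.
  by apply: nneseries_lim_ge => j _ _; exact: f0.
suff [B' HB'] : exists B, forall M, \sum_(0 <= j < M) beta ^+ j * `|X (n - j%:Z) w| <= B.
  by exists B' => M; under eq_bigr do rewrite XX'//.
have B0 : 0 <= B by have := HB 0%N; rewrite big_geq.
(* Summability was arranged at time zero only; a shift by one multiplies the weighted sum by [beta]
   or its inverse, up to one term, which reaches all times. *)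
elim/int_rect: n => [|n [B' IH]|n [B' IH]].
- by exists B => M; under eq_bigr do rewrite sub0r.
- exists (`|X n.+1 w| + beta * B') => -[|M].
    by rewrite big_geq// addr_ge0// mulr_ge0 ?(ltW b0)//; have := IH 0%N; rewrite big_geq.
  rewrite big_nat_recl//= expr0 mul1r subr0 lerD2l.
  apply: (le_trans _ (ler_wpM2l (ltW b0) (IH M))); rewrite mulr_sumr.
  apply: ler_sum => j _; rewrite mulrA -exprS.
  by rewrite (_ : n.+1%:Z - j.+1%:Z = n%:Z - j%:Z)//; lia.
- exists (beta^-1 * B') => M; rewrite ler_pdivlMl//.
  apply: (le_trans _ (IH M.+1)); rewrite big_nat_recl//= mulr_sumr ler_wpDl//.
    by rewrite mulr_ge0// exprn_ge0// ltW.
  apply: ler_sum => j _; rewrite mulrA -exprS.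
  by rewrite (_ : - n.+1%:Z - j%:Z = - n%:Z - j.+1%:Z)//; lia.
Unshelve. all: by end_near. Qed.
End SummableVersion.

Section AbsoluteSeries.
Context {R : realType}.

Lemma cvg_sumr {S I : Type} (F : set_system S) {FF : Filter F} (s : seq I)
    (f : I -> S -> R) (l : I -> R) : (forall i, f i @ F --> l i) ->
  (fun n => \sum_(i <- s) f i n) @ F --> \sum_(i <- s) l i.
Proof.
move=> fl; elim: s => [|i s IH].
  rewrite big_nil (_ : (fun n => _) = cst 0); first exact: cvg_cst.
  by apply/funext => n; rewrite big_nil.
rewrite big_cons (_ : (fun n => _) = f i \+ (fun n => \sum_(j <- s) f j n)).
  exact: cvgD.
by apply/funext => n; rewrite big_cons.
Qed.

Lemma nonneg_series_cvg (u : nat -> R) (B : R) : (forall j, 0 <= u j) ->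
  (forall M, \sum_(0 <= j < M) u j <= B) ->
  (fun M => \sum_(0 <= j < M) u j) @ \oo --> rseries u.
Proof.
move=> u0 uB; apply: nondecreasing_is_cvgn; last by exists B => _ [M _ <-].
move=> m n mn; rewrite (big_cat_nat (leq0n m) mn)//= lerDl.
exact: sumr_ge0.
Qed.

Lemma abs_series_cvg (u : nat -> R) (B : R) : (forall M, \sum_(0 <= j < M) `|u j| <= B) ->
  (fun M => \sum_(0 <= j < M) u j) @ \oo --> rseries u.
Proof.
move=> uB; apply: (@normed_cvg _ _ u).
by apply/cvg_ex; exists (rseries (fun j => `|u j|)); apply: nonneg_series_cvg uB.
Qed.

Lemma abs_series_le (u : nat -> R) (B : R) : (forall M, \sum_(0 <= j < M) `|u j| <= B) ->
  `|rseries u| <= B.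
Proof.
move=> uB.
have c : `|\sum_(0 <= j < M) u j| @[M --> \oo] --> `|rseries u|.
  by apply: cvg_norm; exact: abs_series_cvg uB.
apply: (cvgr_to_le c); near=> M.
exact: le_trans (ler_norm_sum _ _ _) (uB M).
Unshelve. all: by end_near. Qed.

Lemma nonneg_series_ge (u : nat -> R) (B : R) M : (forall j, 0 <= u j) ->
  (forall M, \sum_(0 <= j < M) u j <= B) -> \sum_(0 <= j < M) u j <= rseries u.
Proof.
move=> u0 uB; apply: (cvgr_to_ge (nonneg_series_cvg u0 uB)); near=> n.
have Mn : (M <= n)%N by near: n; exists M.
by rewrite (big_cat_nat (leq0n M) Mn)//= lerDl sumr_ge0.
Unshelve. all: by end_near. Qed.
End AbsoluteSeries.

Section BilinearLimit.
Context d {T : measurableType d} {R : realType} (P : probability T R).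
Implicit Types (u v : nat -> T -> R) (D : T -> R).

Lemma Rintegral_sum (I : Type) (s : seq I) (f : I -> T -> R) :
  (forall i, P.-integrable setT (EFin \o f i)) ->
  \int[P]_w (\sum_(i <- s) f i w) = \sum_(i <- s) \int[P]_w f i w.
Proof.
move=> fi; rewrite /Rintegral.
transitivity (fine (\int[P]_w (\sum_(i <- s) (f i w)%:E))%E).
  by congr fine; apply: eq_integral => w _; rewrite sumEFin.
rewrite (integral_sum measurableT fi) -sum_fine// => i _.
exact: integrable_fin_num.
Qed.

(** Dominated convergence with majorant [D^2], since all partial sums of both series stay below [D].
    It serves the autocovariances and the prediction error criterion alike. *)
Lemma bilinear_limit u v D K : Lb P 2 K D ->
  (forall j, measurable_fun setT (u j)) -> (forall j, measurable_fun setT (v j)) ->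
  (forall w M, \sum_(0 <= j < M) `|u j w| <= D w) ->
  (forall w M, \sum_(0 <= j < M) `|v j w| <= D w) ->
  (fun M => \sum_(0 <= i < M) \sum_(0 <= j < M) \int[P]_w (u i w * v j w)) @ \oo -->
  \int[P]_w (rseries (u ^~ w) * rseries (v ^~ w)).
Proof.
move=> LD mu mv uD vD.
have iD : P.-integrable setT (EFin \o (fun w => D w ^+ 2)).
  have := Lb_integrable_powR LD; apply: eq_integrable => // w _ /=.
  by rewrite powR_mulrn// real_normK ?num_real.
have one (f : nat -> T -> R) j w : (forall M, \sum_(0 <= j < M) `|f j w| <= D w) ->
    `|f j w| <= D w.
  by move=> fD; apply: le_trans (fD j.+1); rewrite big_nat_recr//= lerDr sumr_ge0.
have dom (a b : R) w : `|a| <= D w -> `|b| <= D w -> `|a * b| <= D w ^+ 2.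
  by move=> aD bD; rewrite normrM expr2 ler_pM.
have iuv i j : P.-integrable setT (EFin \o (fun w => u i w * v j w)).
  apply: (le_integrable _ _ _ iD) => //.
    by apply/measurable_EFinP; apply: measurable_funM.
  move=> w _; rewrite /= lee_fin [leRHS]ger0_norm ?sqr_ge0//.
  by apply: dom; apply: one.
pose F M w := (\sum_(0 <= i < M) u i w) * (\sum_(0 <= j < M) v j w).
have FE : (fun M => \sum_(0 <= i < M) \sum_(0 <= j < M) \int[P]_w (u i w * v j w)) =
    (fun M => \int[P]_w F M w).
  apply/funext => M; under eq_bigr do rewrite -Rintegral_sum//.
  rewrite -Rintegral_sum => [|i]; last first.
    have := integrable_sum measurableT (index_iota 0 M) (P := xpredT) (fun j _ => iuv i j).
    by apply: eq_integrable => // w _; rewrite /= sumEFin.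
  by congr Rintegral; apply/funext => w; rewrite /F mulr_suml; apply: eq_bigr => i _; rewrite mulr_sumr.
rewrite FE.
have cF w : F ^~ w @ \oo --> rseries (u ^~ w) * rseries (v ^~ w).
  by apply: cvgM; [exact: abs_series_cvg (uD w)|exact: abs_series_cvg (vD w)].
have Fdom M w : `|F M w| <= D w ^+ 2.
  by apply: dom; apply: le_trans (ler_norm_sum _ _ _) _.
have mF M : measurable_fun setT (F M).
  by apply: measurable_funM; apply: measurable_sum.
have lim_dom w : `|rseries (u ^~ w) * rseries (v ^~ w)| <= D w ^+ 2.
  by apply: dom; [exact: abs_series_le (uD w)|exact: abs_series_le (vD w)].
apply: fine_cvg; rewrite fineK; last first.
  apply: integrable_fin_num => //; apply: (le_integrable _ _ _ iD) => //.
    apply/measurable_EFinP; apply: (measurable_fun_cvg mF) => w _; exact: cF.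
  by move=> w _; rewrite /= lee_fin [leRHS]ger0_norm ?sqr_ge0.
apply: (@dominated_cvg _ _ _ _ _ _ (fun M w => (F M w)%:E) _ (fun w => (D w ^+ 2)%:E)) => //.
- by move=> M; apply/measurable_EFinP.
- by move=> w _; apply/fine_cvgP; split; [exact: nearW|exact: cF].
- by move=> M w _; rewrite /= lee_fin.
Qed.
End BilinearLimit.

Lemma cvg_mulrn_geo {R : realType} (x : R) : 0 <= x < 1 -> n%:R * x ^+ n @[n --> \oo] --> (0 : R).
Proof.
move=> /andP[x0 x1]; set z := Num.sqrt x.
have z0 : 0 <= z by exact: sqrtr_ge0.
have z1 : z < 1 by rewrite -[ltRHS]sqrtr1 ltr_sqrt.
have zx : z ^+ 2 = x by rewrite sqr_sqrtr.
have cz : (1 - z)^-1 * z ^+ n @[n --> \oo] --> (1 - z)^-1 * 0.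
  by apply: cvgMr; apply: cvg_expr; rewrite ger0_norm.
rewrite mulr0 in cz; apply: (squeeze_cvgr _ (cvg_cst 0) cz); apply: nearW => n.
rewrite mulr_ge0 ?exprn_ge0//= -zx exprAC expr2 mulrA ler_wpM2r ?exprn_ge0//.
by apply: mulrn_geo_le; rewrite z0.
Qed.

Section FilteredNoise.
Context d {T : measurableType d} {R : realType} (P : probability T R).
Variables (X : int -> T -> R) (beta c : R) (a : nat -> R).
Hypothesis iidX : iid P X.
Hypothesis beta01 : 0 < beta < 1.
Hypothesis sumX : forall n w, exists B, forall M,
  \sum_(0 <= j < M) beta ^+ j * `|X (n - j%:Z) w| <= B.
Hypothesis c0 : 0 <= c.
Hypothesis a_le : forall j, `|a j| <= c * (beta ^+ 2) ^+ j.

Let b0 : 0 <= beta. Proof. by case/andP: beta01 => /ltW. Qed.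
Let b1 : beta < 1. Proof. by case/andP: beta01. Qed.
Let b01 : 0 <= beta < 1. Proof. by rewrite b0. Qed.
Let g0 : 0 <= (1 - beta)^-1. Proof. by rewrite invr_ge0 subr_ge0 ltW. Qed.
Let mX n : measurable_fun setT (X n). Proof. by case: iidX. Qed.

(** The coefficients decay like [beta^(2 j)]. One factor [beta^j] is spent on this random variable,
    which dominates everything built from the past; the other remains to sum over lags and to absorb
    polynomial factors. *)
Definition past_weight n w := rseries (fun j => beta ^+ j * `|X (n - j%:Z) w|).
Local Notation Lam := past_weight.
Definition filtered (n : int) (w : T) : R := rseries (fun j => a j * X (n - j%:Z)%R w).
Local Notation y := filtered.

Let term_ge0 n w j : 0 <= beta ^+ j * `|X (n - j%:Z) w|.
Proof. by rewrite mulr_ge0// exprn_ge0. Qed.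

Lemma past_weight_ge n w M : \sum_(0 <= j < M) beta ^+ j * `|X (n - j%:Z) w| <= Lam n w.
Proof. by have [B HB] := sumX n w; exact: nonneg_series_ge HB. Qed.

Lemma past_weight_cvg n w :
  (fun M => \sum_(0 <= j < M) beta ^+ j * `|X (n - j%:Z) w|) @ \oo --> Lam n w.
Proof. by have [B HB] := sumX n w; exact: nonneg_series_cvg HB. Qed.

Lemma past_weight_ge0 n w : 0 <= Lam n w.
Proof. by have := past_weight_ge n w 0; rewrite big_geq. Qed.

Lemma past_weight_shift n j w : beta ^+ j * Lam (n - j%:Z) w <= Lam n w.
Proof.
have cv : beta ^+ j * (\sum_(0 <= i < M) beta ^+ i * `|X (n - j%:Z - i%:Z) w|) @[M --> \oo]
    --> beta ^+ j * Lam (n - j%:Z) w.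
  by apply: cvgMr; exact: past_weight_cvg.
apply: (cvgr_to_le cv); apply: nearW => M.
apply: (le_trans _ (past_weight_ge n w (j + M))).
rewrite (big_cat_nat (leq0n j) (leq_addr M j))//= ler_wpDl ?sumr_ge0//.
rewrite -[X in _ <= \sum_(X <= _ < _) _]add0n big_addn addKn mulr_sumr.
apply: ler_sum => i _; rewrite mulrA -exprD addnC.
by rewrite (_ : n - (i + j)%N%:Z = n - j%:Z - i%:Z)//; lia.
Qed.

Lemma Lb_past_weight r K n : 1 <= r -> Lb P r K (X 0) -> Lb P r (K / (1 - beta)) (Lam n).
Proof.
move=> r1 LX; apply: (@Lb_fatou _ _ _ _ r _ (fun M w => \sum_(0 <= j < M) beta ^+ j * `|X (n - j%:Z) w|) _ r1);
  last by move=> w; exact: past_weight_cvg.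
move=> M.
have r0 : 0 <= r by lra.
have K0 : 0 <= K by case: LX.
apply: (@Lb_le _ _ _ _ _ (\sum_(0 <= j < M) `|beta ^+ j| * K)) => //.
  rewrite -mulr_suml mulrC ler_wpM2l//.
  by under eq_bigr do rewrite ger0_norm ?exprn_ge0//; exact: geo_sum_le.
apply: (@Lb_sum _ _ _ P _ (index_iota 0 M) r (fun j => `|beta ^+ j| * K)
  (fun j w => beta ^+ j * `|X (n - j%:Z) w|) r1) => j.
apply: (LbZ (beta ^+ j) r0); apply: Lb_norm.
exact: (Lb_X iidX (n - j%:Z) (@measurable_id _ R setT) LX).
Qed.

Lemma filtered_abs_le n w M : \sum_(0 <= j < M) `|a j * X (n - j%:Z) w| <= c * Lam n w.
Proof.
apply: (le_trans _ (ler_wpM2l c0 (past_weight_ge n w M))); rewrite mulr_sumr.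
apply: ler_sum => j _; rewrite normrM mulrA ler_wpM2r//; apply: (le_trans (a_le j)).
by rewrite ler_wpM2l// exprAC expr2 ler_piMr ?exprn_ge0// exprn_ile1// ltW.
Qed.

Lemma filtered_cvg n w : (fun M => \sum_(0 <= j < M) a j * X (n - j%:Z) w) @ \oo --> y n w.
Proof. exact: abs_series_cvg (filtered_abs_le n w). Qed.

Lemma filtered_le n w : `|y n w| <= c * Lam n w.
Proof. exact: abs_series_le (filtered_abs_le n w). Qed.

Lemma measurable_filtered n : measurable_fun setT (y n).
Proof.
apply: (@measurable_fun_cvg _ _ _ _ (fun M w => \sum_(0 <= j < M) a j * X (n - j%:Z) w)).
  by move=> M; apply: measurable_sum => j; apply: measurable_funM.
by move=> w _; exact: filtered_cvg.
Qed.

Lemma Lb_filtered r K n : 1 <= r -> Lb P r K (X 0) -> Lb P r (c * (K / (1 - beta))) (y n).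
Proof.
move=> r1 LX; have r0 : 0 <= r by lra.
have := LbZ c r0 (Lb_past_weight n r1 LX); rewrite (ger0_norm c0).
apply: Lb_mono => //; first exact: measurable_filtered.
by move=> w; rewrite [leRHS]ger0_norm ?filtered_le// mulr_ge0 ?past_weight_ge0.
Qed.

Section InverseFilter.
Variable b : nat -> R.
Hypothesis b_le : forall j, `|b j| <= c * (beta ^+ 2) ^+ j.

Lemma refiltered_abs_le n w M :
  \sum_(0 <= j < M) `|b j * y (n - j%:Z) w| <= c ^+ 2 / (1 - beta) * Lam n w.
Proof.
have L0 := past_weight_ge0 n w.
apply: (@le_trans _ _ (c ^+ 2 * Lam n w * \sum_(0 <= j < M) beta ^+ j)); last first.
  by rewrite [leRHS]mulrAC ler_wpM2l ?geo_sum_le// mulr_ge0// sqr_ge0.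
rewrite mulr_sumr; apply: ler_sum => j _; rewrite normrM.
apply: (le_trans (ler_pM (normr_ge0 _) (normr_ge0 _) (b_le j) (filtered_le _ _))).
have := past_weight_shift n j w => h.
have -> : c * (beta ^+ 2) ^+ j * (c * Lam (n - j%:Z) w) =
    c ^+ 2 * beta ^+ j * (beta ^+ j * Lam (n - j%:Z) w) by rewrite exprAC; ring.
have -> : c ^+ 2 * Lam n w * beta ^+ j = c ^+ 2 * beta ^+ j * Lam n w by rewrite mulrAC.
by apply: ler_wpM2l h; rewrite mulr_ge0 ?sqr_ge0 ?exprn_ge0.
Qed.

Hypothesis ab0 : a 0 * b 0 = 1.
Hypothesis abj : forall j, (0 < j)%N -> \sum_(i < j.+1) a i * b (j - i)%N = 0.

(** Cutting the inverse filter after [M] terms leaves the product of the two filters exact at lags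
    below [M]. For [M = n] this measures the effect of starting the inverse filter at time one from
    zero initial conditions. *)
Lemma inverse_filter_le n w M : (0 < M)%N ->
  `|\sum_(0 <= j < M) b j * y (n - j%:Z) w - X n w| <= c ^+ 2 * (M%:R * beta ^+ M) * Lam n w.
Proof.
(* The filter delayed by [j], so that all delayed outputs become series in the same variables and a
   finite sum over [j] can be exchanged with the series. *)
move=> M0; pose a' j m := if (j <= m)%N then a (m - j)%N else 0.
have cva j : (fun L => \sum_(0 <= m < L) a' j m * X (n - m%:Z) w) @ \oo --> y (n - j%:Z) w.
  rewrite -(cvg_shiftn j).
  rewrite (_ : (fun L => _) = fun L => \sum_(0 <= i < L) a i * X (n - j%:Z - i%:Z) w).
    exact: filtered_cvg.
  apply/funext => L; rewrite (big_cat_nat (leq0n j) (leq_addl L j))//=.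
  rewrite big_nat big1 ?add0r => [|m /andP[_ mj]]; last first.
    by rewrite /a' leqNgt mj mul0r.
  rewrite -[X in \sum_(X <= _ < _) _]add0n big_addn addnK; apply: eq_bigr => i _.
  rewrite /a' leq_addl addnK; congr (_ * X _ _); lia.
pose g m := \sum_(0 <= j < M) b j * a' j m.
have cv : (fun L => \sum_(0 <= m < L) g m * X (n - m%:Z) w) @ \oo -->
    \sum_(0 <= j < M) b j * y (n - j%:Z) w.
  rewrite (_ : (fun L => _) = fun L => \sum_(0 <= j < M) b j * \sum_(0 <= m < L) a' j m * X (n - m%:Z) w).
    by apply: cvg_sumr => j; apply: cvgMr; exact: cva.
  apply/funext => L; under [RHS]eq_bigr do rewrite mulr_sumr.
  rewrite [RHS]exchange_big; apply: eq_bigr => m _; rewrite /g mulr_suml.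
  by apply: eq_bigr => j _; rewrite mulrA.
have g_small m : (m < M)%N -> g m = (m == 0%N)%:R.
  move=> mM; rewrite /g (big_cat_nat (leq0n m.+1) mM)//=.
  rewrite [X in _ + X]big_nat [X in _ + X]big1 ?addr0 => [|j /andP[mj _]]; last first.
    by rewrite /a' leqNgt mj mulr0.
  rewrite big_mkord (eq_bigr (fun i : 'I_m.+1 => b i * a (m - i)%N)) => [|i _]; last first.
    by rewrite /a' -ltnS ltn_ord.
  case: m {mM} => [|m]; first by rewrite big_ord1 mulrC ab0.
  rewrite (reindex_inj rev_ord_inj)/= -[RHS](abj (ltn0Sn m)).
  by apply: eq_bigr => i _; rewrite subSS subKn 1?mulrC// -ltnS ltn_ord.
(* There are [M] products, each at most [c^2 beta^(2 m)]; one factor [beta^m] is bounded by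
   [beta^M], the other is kept as the weight in [past_weight]. *)
have g_big m : (M <= m)%N -> `|g m| <= c ^+ 2 * (M%:R * beta ^+ M) * beta ^+ m.
  move=> Mm; apply: (@le_trans _ _ (\sum_(0 <= j < M) c ^+ 2 * (beta ^+ 2) ^+ m)).
    rewrite /g; apply: (le_trans (ler_norm_sum _ _ _)).
    rewrite big_nat [leRHS]big_nat; apply: ler_sum => j /andP[_ jM].
    have jm : (j <= m)%N by rewrite ltnW// (leq_trans jM).
    rewrite normrM /a' jm; apply: (le_trans (ler_pM (normr_ge0 _) (normr_ge0 _) (b_le j) (a_le _))).
    by rewrite mulrACA -expr2 -exprD subnKC.
  rewrite big_const_nat subn0 iter_addr_0 -[leLHS]mulr_natl.
  rewrite exprAC expr2 (_ : c ^+ 2 * _ * _ = M%:R * (c ^+ 2 * (beta ^+ M * beta ^+ m))); last by ring.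
  rewrite ler_wpM2l// ler_wpM2l ?sqr_ge0// ler_wpM2r ?exprn_ge0//.
  by rewrite ler_wiXn2l// ltW.
have cv' : `|\sum_(0 <= m < L) g m * X (n - m%:Z) w - X n w| @[L --> \oo] -->
   `|\sum_(0 <= j < M) b j * y (n - j%:Z) w - X n w|.
  by apply: cvg_norm; apply: cvgB; [exact: cv|exact: cvg_cst].
have C0 : 0 <= c ^+ 2 * (M%:R * beta ^+ M).
  by rewrite mulr_ge0 ?sqr_ge0// mulr_ge0// exprn_ge0.
apply: (cvgr_to_le cv'); near=> L.
have ML : (M <= L)%N by near: L; exists M.
apply: (le_trans _ (ler_wpM2l C0 (past_weight_ge n w L))); rewrite mulr_sumr.
have L0 : (0 < L)%N by exact: leq_trans ML.
have -> : \sum_(0 <= m < L) g m * X (n - m%:Z) w - X n w =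
    \sum_(0 <= m < L) (g m - (m == 0%N)%:R) * X (n - m%:Z) w.
  under [RHS]eq_bigr do rewrite mulrBl.
  rewrite sumrB; congr (_ - _); rewrite big_ltn//= mul1r subr0.
  by rewrite big_nat big1 ?addr0// => m /andP[m0 _]; rewrite gtn_eqF// mul0r.
apply: (le_trans (ler_norm_sum _ _ _)); apply: ler_sum => m _.
rewrite normrM [leRHS]mulrA ler_wpM2r//; have [mM|Mm] := ltnP m M.
  by rewrite g_small// subrr normr0 mulr_ge0// exprn_ge0.
by rewrite gtn_eqF ?subr0 ?g_big// (leq_trans M0).
Unshelve. all: by end_near. Qed.

Lemma inverse_filterK n w : rseries (fun j => b j * y (n - j%:Z) w) = X n w.
Proof.
have cv := abs_series_cvg (refiltered_abs_le n w).
have cv' : `|\sum_(0 <= j < M) b j * y (n - j%:Z) w - X n w| @[M --> \oo] -->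
   `|rseries (fun j => b j * y (n - j%:Z) w) - X n w|.
  by apply: cvg_norm; apply: cvgB; [exact: cv|exact: cvg_cst].
have z : c ^+ 2 * (M%:R * beta ^+ M) * Lam n w @[M --> \oo] --> c ^+ 2 * 0 * Lam n w.
  by apply: cvgMl; apply: cvgMr; exact: cvg_mulrn_geo.
apply/eqP; rewrite -subr_eq0 -normr_le0 -[leRHS](mul0r (Lam n w)) -[X in X * _](mulr0 (c ^+ 2)).
apply: (ler_cvg_to cv' z); near=> M; apply: inverse_filter_le.
by near: M; exists 1%N.
Unshelve. all: by end_near. Qed.
End InverseFilter.
End FilteredNoise.

Lemma normrM_le_sqrD {R : realDomainType} (x z : R) : `|x * z| <= x ^+ 2 + z ^+ 2.
Proof. by rewrite ler_norml; apply/andP; split; nra. Qed.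

Lemma lag_index (k0 : int) (i m l : nat) : (m <= l)%N ->
  k0 - m%:Z + i%:Z - (l - m)%N%:Z = k0 + i%:Z - l%:Z.
Proof. by lia. Qed.

(** * Products of noise and of filtered noise *)

Section FilteredCovariance.
Context d {T : measurableType d} {R : realType} (P : probability T R).
Variables (X : int -> T -> R) (beta c : R) (a : nat -> R).
Hypothesis iidX : iid P X.
Hypothesis beta01 : 0 < beta < 1.
Hypothesis sumX : forall n w, exists B, forall M,
  \sum_(0 <= j < M) beta ^+ j * `|X (n - j%:Z) w| <= B.
Hypothesis c0 : 0 <= c.
Hypothesis a_le : forall j, `|a j| <= c * (beta ^+ 2) ^+ j.
Variables (r K : R).
Hypothesis r2 : 2 <= r.
Hypothesis LX : Lb P (2 * r) K (X 0).
Hypothesis X_mean0 : \int[P]_w X 0 w = 0.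
Local Notation Lam := (past_weight X beta).
Local Notation y := (filtered X a).

Let r1 : 1 <= r. Proof. by apply: le_trans r2; rewrite ler1n. Qed.
Let r0 : 0 <= r. Proof. exact: le_trans r1. Qed.
Let mX n : measurable_fun setT (X n). Proof. by case: iidX. Qed.

Lemma Lb_sqr (s L : R) (f : T -> R) : 0 <= s -> Lb P (2 * s) L f -> Lb P s (L ^+ 2) (fun w => f w ^+ 2).
Proof.
move=> s0 [L0 mf H]; have E (x : R) : `|x| `^ (2 * s) = `|x ^+ 2| `^ s.
  by rewrite powRrM powR_mulrn// normrX.
split; [exact: sqr_ge0|exact: measurable_funX|].
under eq_integral do rewrite -E.
by rewrite -[L ^+ 2]ger0_norm ?sqr_ge0// -E ger0_norm.
Qed.

Let LX1 : exists L, Lb P r L (X 0).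
Proof. by apply: (Lb_subpow _ _ LX); have := r2; lra. Qed.

Let LX2 : exists L, Lb P 2 L (X 0).
Proof. by apply: (Lb_subpow _ _ LX); have := r2; lra. Qed.

Let iX n : P.-integrable setT (EFin \o X n).
Proof.
have [L H] := LX1; apply: (Lb_integrable r1).
exact: (Lb_X iidX n (@measurable_id _ R setT) H).
Qed.

Let LXX n : exists L, Lb P r L (fun w => X n w ^+ 2).
Proof.
exists (K ^+ 2); apply: (Lb_sqr r0).
exact: (Lb_X iidX n (@measurable_id _ R setT) LX).
Qed.

Definition noise_var := \int[P]_w X 0 w ^+ 2.

Lemma noise_cov m n : \int[P]_w (X m w * X n w) = if m == n then noise_var else 0.
Proof.
have [->|mn] := eqVneq m n.
  rewrite /noise_var -(Rintegral_X iidX n (f := fun x => x ^+ 2)).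
  - by apply: eq_Rintegral => w _; rewrite expr2.
  - exact: exprn_measurable.
  - by have [L H] := LXX 0; exact: (Lb_integrable r1 H).
rewrite (RintegralM_off_index iidX (g := id)) ?X_mean0 ?mulr0//.
- exact: off_index_X.
- exact: iX.
Qed.

(** Different lags give an orthogonal sum, equal lags an i.i.d. sum of centred squares; the squares
    account for the moments of order [2 r]. The constant is the same for all lags, which makes a
    later summation over lags possible. *)
Lemma noise_product_sum : exists2 C, 0 <= C & forall k0 m l n,
  Lb P r (C * Num.sqrt n%:R) (fun w => \sum_(0 <= i < n)
    (X (k0 + i%:Z - m%:Z) w * X (k0 + i%:Z - l%:Z) w - (if m == l then noise_var else 0))).
Proof.
have [L HL] := LX1.
have [C1 C10 H1] := moment_lagged_sum iidX r2 HL X_mean0.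
have [C2 C20 H2] := moment_iid_sum iidX r2.
have [L2 HL2] := LXX 0.
have Lg := LbB r1 HL2 (Lb_cst P noise_var r0).
have L20 : 0 <= L2 + `|noise_var| by case: Lg.
exists (C1 + C2 * (L2 + `|noise_var|)); first by rewrite addr_ge0 ?mulr_ge0.
have lag k0 m l n : (m < l)%N -> Lb P r (C1 * Num.sqrt n%:R)
    (fun w => \sum_(0 <= i < n) X (k0 + i%:Z - l%:Z) w * X (k0 + i%:Z - m%:Z) w).
  move=> ml; have lm : (0 < l - m)%N by rewrite subn_gt0.
  have := H1 (k0 - m%:Z) _ n lm; apply: Lb_eq => w; apply: eq_bigr => i _.
  by rewrite (lag_index _ _ (ltnW ml)) (addrAC k0 (- m%:Z) i%:Z).
move=> k0 m l n; have [<-|ml] := eqVneq m l.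
  apply: (@Lb_le _ _ _ _ _ (C2 * (L2 + `|noise_var|) * Num.sqrt n%:R)) => //.
    by rewrite ler_wpM2r ?sqrtr_ge0// lerDr.
  have mg : measurable_fun setT (fun x : R => x ^+ 2 - noise_var).
    by apply: measurable_funB => //; exact: exprn_measurable.
  have g0 : \int[P]_w (X 0 w ^+ 2 - noise_var) = 0.
    have i2 := Lb_integrable r1 HL2.
    have i3 := finite_measure_integrable_cst P noise_var measurableT.
    rewrite RintegralB// /Rintegral -/(Rintegral _ _ _) integral_cst//.
    by rewrite [X in (_ * X)%E]probability_setT mule1/= subrr.
  have := H2 (k0 - m%:Z) (fun x => x ^+ 2 - noise_var) _ mg Lg g0 n.
  apply: Lb_eq => w; apply: eq_bigr => i _.
  by rewrite -expr2 (addrAC k0 (- m%:Z) i%:Z).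
apply: (@Lb_le _ _ _ _ _ (C1 * Num.sqrt n%:R)) => //.
  by rewrite ler_wpM2r ?sqrtr_ge0// lerDl mulr_ge0.
case: (ltngtP m l) ml => // ml _.
  have := lag k0 m l n ml; apply: Lb_eq => w; apply: eq_bigr => i _.
  by rewrite subr0 mulrC.
by have := lag k0 l m n ml; apply: Lb_eq => w; apply: eq_bigr => i _; rewrite subr0.
Qed.

Definition autocov (j l : nat) := \int[P]_w (y (- j%:Z) w * y (- l%:Z) w).

(** The noise covariances depend on the lags only through the equation [j + p = l + q]. Hence the
    expectation computed at time zero centres the products at every time. *)
Lemma autocov_cvg j l : (fun M => \sum_(0 <= p < M) \sum_(0 <= q < M)
    a p * a q * (if (j + p == l + q)%N then noise_var else 0)) @ \oo --> autocov j l.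
Proof.
have [L HL] := LX2.
have b0 : 1 <= 2 :> R by rewrite ler1n.
have LD := LbZ c (ler0n R 2) (LbD b0 (Lb_past_weight iidX beta01 sumX (- j%:Z) b0 HL)
  (Lb_past_weight iidX beta01 sumX (- l%:Z) b0 HL)).
have dom (n n' : int) w M : \sum_(0 <= p < M) `|a p * X (n - p%:Z) w| <= c * (Lam n w + Lam n' w).
  apply: (le_trans (filtered_abs_le beta01 sumX c0 a_le n w M)).
  by rewrite ler_wpM2l// lerDl; exact: past_weight_ge0.
have := @bilinear_limit _ _ _ P (fun p w => a p * X (- j%:Z - p%:Z) w)
   (fun p w => a p * X (- l%:Z - p%:Z) w) _ _ LD.
rewrite (_ : (fun M => _) = (fun M => \sum_(0 <= p < M) \sum_(0 <= q < M)
    a p * a q * (if (j + p == l + q)%N then noise_var else 0))); last first.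
  apply/funext => M; apply: eq_bigr => p _; apply: eq_bigr => q _.
  have -> : (j + p == l + q)%N = (- j%:Z - p%:Z == - l%:Z - q%:Z).
    by apply/eqP/eqP; lia.
  rewrite -noise_cov -RintegralZl//; last first.
    have [L1 HL1] := LXX (- j%:Z - p%:Z); have [L3 HL3] := LXX (- l%:Z - q%:Z).
    have i1 := Lb_integrable r1 (LbD r1 HL1 HL3).
    apply: (le_integrable _ _ _ i1) => //.
      by apply/measurable_EFinP; apply: measurable_funM.
    move=> w _ /=; rewrite lee_fin [leRHS]ger0_norm ?addr_ge0 ?sqr_ge0//.
    exact: normrM_le_sqrD.
  by apply: eq_Rintegral => w _; rewrite mulrACA.
apply.
- by move=> p; apply: measurable_funM.
- by move=> p; apply: measurable_funM.
- by move=> w M; exact: dom.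
- by move=> w M; rewrite addrC; exact: dom.
Qed.

Lemma autocov_bounded : exists2 B, 0 <= B & forall j l, `|autocov j l| <= B.
Proof.
have [L HL] := LX2; have b0 : 1 <= 2 :> R by rewrite ler1n.
set L' := c * (L / (1 - beta)).
have Ly n : Lb P 2 L' (y n) := Lb_filtered iidX beta01 sumX c0 a_le n b0 HL.
have L1 n : Lb P 1 (L' ^+ 2) (fun w => y n w ^+ 2).
  by apply: Lb_sqr => //; rewrite mulr1; exact: Ly.
have i2 n : P.-integrable setT (EFin \o (fun w => y n w ^+ 2)) := Lb_integrable (lexx 1) (L1 n).
have I2 n : \int[P]_w y n w ^+ 2 <= L' ^+ 2.
  have [s0 _] := L1 n; rewrite powRr1// => h.
  rewrite -lee_fin /Rintegral fineK; last exact: integrable_fin_num (i2 n).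
  apply: le_trans h; apply: ge0_le_integral_nm => w; rewrite lee_fin ?sqr_ge0//.
  by rewrite powRr1// ler_norm.
exists (L' ^+ 2 + L' ^+ 2) => [|j l]; first by rewrite addr_ge0 ?sqr_ge0.
have my n : measurable_fun setT (y n) by case: (Ly n).
have dom w : `|y (- j%:Z) w * y (- l%:Z) w| <= y (- j%:Z) w ^+ 2 + y (- l%:Z) w ^+ 2.
  exact: normrM_le_sqrD.
have i3 := integrableD measurableT (i2 (- j%:Z)) (i2 (- l%:Z)).
have iyy : P.-integrable setT (EFin \o (fun w => y (- j%:Z) w * y (- l%:Z) w)).
  apply: (le_integrable _ _ _ i3) => //.
    by apply/measurable_EFinP; apply: measurable_funM.
  by move=> w _; rewrite /= lee_fin [leRHS]ger0_norm ?addr_ge0 ?sqr_ge0.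
rewrite /autocov; apply: (le_trans (le_normr_Rintegral measurableT iyy)).
apply: (@le_trans _ _ (\int[P]_w (y (- j%:Z) w ^+ 2 + y (- l%:Z) w ^+ 2))).
  apply: le_Rintegral => //.
  by have := integrable_norm iyy; apply: eq_integrable.
by rewrite RintegralD// lerD.
Qed.

(** Both factors are expanded in the noise; Minkowski's inequality sums the uniform bounds against
    the summable weights [|a p| |a q|], and Fatou's lemma removes the truncation of the
    expansion. *)
Lemma filtered_product_sum : exists2 C, 0 <= C & forall k0 j l n,
  Lb P r (C * Num.sqrt n%:R) (fun w => \sum_(0 <= i < n)
    (y (k0 + i%:Z - j%:Z) w * y (k0 + i%:Z - l%:Z) w - autocov j l)).
Proof.
have [C C0 HC] := noise_product_sum; have /andP[b0 b1] := beta01.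
have al01 : 0 <= beta ^+ 2 < 1 by rewrite sqr_ge0 expr_lt1// ltW.
pose S := c * (1 - beta ^+ 2)^-1.
have S0 : 0 <= S by rewrite mulr_ge0// invr_ge0 subr_ge0 ltW//; case/andP: al01.
have sa M : \sum_(0 <= p < M) `|a p| <= S.
  apply: (le_trans (ler_sum _ (fun p _ => a_le p))).
  by rewrite -mulr_sumr ler_wpM2l// geo_sum_le.
exists (S * S * C); first by rewrite mulr_ge0 ?(mulr_ge0 S0 S0).
move=> k0 j l n.
pose D (p q : nat) w := \sum_(0 <= i < n) (X (k0 + i%:Z - (j + p)%N%:Z) w *
  X (k0 + i%:Z - (l + q)%N%:Z) w - (if (j + p == l + q)%N then noise_var else 0)).
apply: (@Lb_fatou _ _ _ P r _ (fun M w =>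
    \sum_(0 <= p < M) \sum_(0 <= q < M) (a p * a q) * D p q w) _ r1) => [M|w].
  apply: (@Lb_le _ _ _ P r (\sum_(0 <= p < M) \sum_(0 <= q < M) `|a p * a q| * (C * Num.sqrt n%:R))).
  - exact: r0.
  - under eq_bigr do rewrite -mulr_suml.
    rewrite -mulr_suml mulrA ler_wpM2r ?sqrtr_ge0// ler_wpM2r//.
    under eq_bigr do under eq_bigr do rewrite normrM.
    under eq_bigr do rewrite -mulr_sumr.
    by rewrite -mulr_suml ler_pM// sumr_ge0.
  - apply: (@Lb_sum _ _ _ P _ _ r (fun p => \sum_(0 <= q < M) `|a p * a q| * (C * Num.sqrt n%:R))
      (fun p w => \sum_(0 <= q < M) (a p * a q) * D p q w) r1) => p.
    apply: (@Lb_sum _ _ _ P _ _ r (fun q => `|a p * a q| * (C * Num.sqrt n%:R))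
      (fun q w => (a p * a q) * D p q w) r1) => q.
    apply: (LbZ _ r0); exact: HC.
rewrite (_ : (fun M => _) = (fun M => \sum_(0 <= i < n)
   ((\sum_(0 <= p < M) a p * X (k0 + i%:Z - j%:Z - p%:Z) w) *
    (\sum_(0 <= q < M) a q * X (k0 + i%:Z - l%:Z - q%:Z) w) -
    \sum_(0 <= p < M) \sum_(0 <= q < M)
    a p * a q * (if (j + p == l + q)%N then noise_var else 0)))); last first.
  apply/funext => M.
  under eq_bigr do under eq_bigr do rewrite /D mulr_sumr.
  under eq_bigr do rewrite exchange_big.
  rewrite exchange_big; apply: eq_bigr => i _.
  rewrite mulr_suml -sumrB; apply: eq_bigr => p _.
  rewrite mulr_sumr -sumrB; apply: eq_bigr => q _.
  rewrite mulrBr; congr (_ - _); by rewrite [RHS]mulrACA !PoszD !opprD !addrA.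
apply: cvg_sumr => i; apply: cvgB; last exact: autocov_cvg.
by apply: cvgM; apply: (filtered_cvg beta01 sumX c0 a_le).
Qed.
End FilteredCovariance.

(** * Rates of the error terms *)

Section ErrorRates.
Context d {T : measurableType d} {R : realType} (P : probability T R).
Variables (X : int -> T -> R) (beta c : R) (a : nat -> R).
Hypothesis iidX : iid P X.
Hypothesis beta01 : 0 < beta < 1.
Hypothesis sumX : forall n w, exists B, forall M,
  \sum_(0 <= j < M) beta ^+ j * `|X (n - j%:Z) w| <= B.
Hypothesis c0 : 0 <= c.
Hypothesis a_le : forall j, `|a j| <= c * (beta ^+ 2) ^+ j.
Variables (r K : R).
Hypothesis r2 : 2 <= r.
Hypothesis LX : Lb P (2 * r) K (X 0).
Hypothesis X_mean0 : \int[P]_w X 0 w = 0.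
Local Notation Lam := (past_weight X beta).
Local Notation y := (filtered X a).
Local Notation gam := (autocov P X a).

Let r1 : 1 <= r. Proof. by apply: le_trans r2; rewrite ler1n. Qed.
Let r0 : 0 <= r. Proof. exact: le_trans r1. Qed.
Let b0 : 0 <= beta. Proof. by case/andP: beta01 => /ltW. Qed.
Let b01 : 0 <= beta < 1. Proof. by case/andP: beta01 => /ltW ->. Qed.
Let bp : 0 <= (1 - beta)^-1. Proof. by case/andP: b01 => _ ?; rewrite invr_ge0 subr_ge0 ltW. Qed.

(** The restriction to lags below [n] reproduces the zero initial conditions, so that the sum of
    squared estimated innovations is exactly a quadratic form in these quantities. *)
Definition sample_cov (N j l : nat) w := N%:R^-1 *
  \sum_(1 <= n < N.+1 | (j < n)%N && (l < n)%N) y (n%:Z - j%:Z) w * y (n%:Z - l%:Z) w.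

(** The weights are, up to a constant, the bounds on [b j * b l] and its derivatives, uniform in the
    parameter. *)
Definition cov_error (N : nat) w := \sum_(0 <= j < N) \sum_(0 <= l < N)
  (beta ^+ 2) ^+ (j + l) * `|sample_cov N j l w - gam j l|.

Lemma sqrtn_inv (N : nat) : (0 < N)%N -> N%:R^-1 * Num.sqrt N%:R = (Num.sqrt N%:R)^-1 :> R.
Proof.
move=> N0; have s0 : Num.sqrt N%:R != 0 :> R by rewrite lt0r_neq0// sqrtr_gt0 ltr0n.
rewrite -[X in X^-1 * _](sqr_sqrtr (ler0n R N)) expr2; move: s0; move: (Num.sqrt N%:R) => z z0.
by rewrite invfM -mulrA mulVf// mulr1.
Qed.

Lemma invn_le_sqrt (N : nat) : (0 < N)%N -> N%:R^-1 <= (Num.sqrt N%:R)^-1 :> R.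
Proof.
move=> N0; rewrite -sqrtn_inv// ler_peMr ?invr_ge0//.
by rewrite -[leLHS]sqrtr1 ler_wsqrtr// ler1n.
Qed.

(** The average misses its first [max j l] terms, a bias of at most [max j l / N] times the
    autocovariance. The polynomial factor in the lags accommodates it and is later absorbed by the
    geometric weights. *)
Lemma Lb_sample_cov : exists2 C, 0 <= C & forall N j l, (j < N)%N -> (l < N)%N ->
  Lb P r (C * ((1 + j%:R) * (1 + l%:R)) * (Num.sqrt N%:R)^-1)
    (fun w => sample_cov N j l w - gam j l).
Proof.
have [C1 C10 H1] := filtered_product_sum iidX beta01 sumX c0 a_le r2 LX X_mean0.
have [B B0 HB] := autocov_bounded iidX beta01 sumX c0 a_le r2 LX.
exists (C1 + B) => [|N j l jN lN]; first exact: addr_ge0.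
have N0 : (0 < N)%N by exact: leq_ltn_trans jN.
have Nn0 : N%:R != 0 :> R by rewrite pnatr_eq0 -lt0n.
pose m := maxn j l; have mN : (m < N)%N by rewrite gtn_max jN.
have E w : sample_cov N j l w - gam j l =
    N%:R^-1 * (\sum_(0 <= i < N - m) (y (m.+1%:Z + i%:Z - j%:Z) w * y (m.+1%:Z + i%:Z - l%:Z) w - gam j l))
    + - (m%:R / N%:R * gam j l).
  rewrite sumrB big_const_nat subn0 iter_addr_0 -[gam j l *+ _]mulr_natl natrB ?(ltnW mN)//.
  rewrite mulrBr /sample_cov -addrA; congr (_ * _ + _); last first.
    by move: (gam j l) => g; field.
  rewrite [RHS](_ : _ = \sum_(m.+1 <= n < N.+1) y (n%:Z - j%:Z) w * y (n%:Z - l%:Z) w).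
    rewrite [RHS](big_nat_widenl m.+1 1)//; apply: eq_bigl => n /=.
    by rewrite /m gtn_max.
  rewrite -[X in _ = \sum_(X <= _ < _) _]add0n big_addn subSS; apply: eq_bigr => i _.
  by have -> : m.+1%:Z + i%:Z = (i + m.+1)%N%:Z by rewrite PoszD addrC.
apply: (@Lb_eq _ _ _ P _ _ (fun w => N%:R^-1 * (\sum_(0 <= i < N - m)
  (y (m.+1%:Z + i%:Z - j%:Z) w * y (m.+1%:Z + i%:Z - l%:Z) w - gam j l))
    + - (m%:R / N%:R * gam j l))); first by move=> w; rewrite E.
have J1 := LbD r1 (LbZ N%:R^-1 r0 (H1 m.+1%:Z j l (N - m)%N)) (Lb_cst P (- (m%:R / N%:R * gam j l)) r0).
apply: (Lb_le r0 _ J1).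
have s0 : 0 <= (Num.sqrt N%:R)^-1 :> R by rewrite invr_ge0 sqrtr_ge0.
rewrite -[leRHS]mulrA [leRHS]mulrDl lerD//.
  apply: (@le_trans _ _ (C1 * (Num.sqrt N%:R)^-1)).
    rewrite ger0_norm ?invr_ge0// mulrCA ler_wpM2l// -sqrtn_inv// ler_wpM2l ?invr_ge0//.
    by rewrite ler_wsqrtr// ler_nat leq_subr.
  rewrite ler_wpM2l// ler_peMl// mulr_ege1// lerDl//.
rewrite normrN normrM normrM normfV !normr_nat mulrC; apply: ler_pM => //.
apply: ler_pM; rewrite ?invr_ge0 ?invn_le_sqrt//.
apply: (@le_trans _ _ (j%:R + l%:R)).
  by rewrite -natrD ler_nat geq_max leq_addr leq_addl.
rewrite (_ : (1 + _) * _ = j%:R + l%:R + (1 + j%:R * l%:R)); last by ring.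
by rewrite lerDl addr_ge0 ?mulr_ge0.
Qed.

Lemma Lb_cov_error : exists2 C, 0 <= C & forall N, (0 < N)%N ->
  Lb P r (C * (Num.sqrt N%:R)^-1) (cov_error N).
Proof.
have [C C0 H] := Lb_sample_cov.
pose g := 1 + (1 - beta)^-1; have g0 : 0 <= g by rewrite addr_ge0.
have gj j : (1 + j%:R) * (beta ^+ 2) ^+ j <= g * beta ^+ j.
  rewrite exprAC expr2 mulrA ler_wpM2r ?exprn_ge0// mulrDl mul1r lerD ?mulrn_geo_le//.
  by rewrite exprn_ile1// ltW//; case/andP: b01.
pose S := g * (1 - beta)^-1; have S0 : 0 <= S by exact: mulr_ge0.
have gS N : \sum_(0 <= j < N) (1 + j%:R) * (beta ^+ 2) ^+ j <= S.
  apply: (le_trans (ler_sum _ (fun j _ => gj j))).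
  by rewrite -mulr_sumr ler_wpM2l// geo_sum_le.
exists (C * (S * S)) => [|N N0]; first by rewrite mulr_ge0// mulr_ge0.
pose k := (Num.sqrt N%:R)^-1 : R; have k0 : 0 <= k by rewrite invr_ge0 sqrtr_ge0.
pose al := beta ^+ 2.
have al0 i : 0 <= al ^+ i by rewrite exprn_ge0// sqr_ge0.
apply: (@Lb_le _ _ _ _ _ (\sum_(0 <= j < N) \sum_(0 <= l < N)
   `|al ^+ (j + l)| * (C * ((1 + j%:R) * (1 + l%:R)) * k))); first exact: r0.
  rewrite [leLHS](_ : _ = C * ((\sum_(0 <= j < N) (1 + j%:R) * al ^+ j) *
    (\sum_(0 <= j < N) (1 + j%:R) * al ^+ j)) * k); last first.
    rewrite mulr_suml [C * _]mulr_sumr [RHS]mulr_suml; apply: eq_bigr => j _.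
    rewrite mulr_sumr [C * _]mulr_sumr [RHS]mulr_suml; apply: eq_bigr => l _.
    by rewrite ger0_norm// exprD; ring.
  have s0 : 0 <= \sum_(0 <= j < N) (1 + j%:R) * al ^+ j.
    by apply: sumr_ge0 => j _; rewrite mulr_ge0// addr_ge0.
  by rewrite ler_wpM2r// ler_wpM2l// ler_pM.
have mS j l : measurable_fun setT (fun w => sample_cov N j l w - gam j l).
  have my n := measurable_filtered iidX beta01 sumX c0 a_le n.
  apply: measurable_funB => //; apply: measurable_funM => //.
  rewrite /sample_cov; under eq_fun do rewrite -big_filter.
  by apply: measurable_sum => n; exact: measurable_funM.
pose f j l w := al ^+ (j + l) * `|sample_cov N j l w - gam j l|.
(* Unlike in [Lb_sum], bounds are asked for members of the list only, since the covariance bound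
   holds for lags below [N]. *)
have L0 (I : eqType) (s : seq I) (F : I -> T -> R) (L : I -> R) :
    (forall i, i \in s -> Lb P r (L i) (F i)) ->
    Lb P r (\sum_(i <- s) L i) (fun w => \sum_(i <- s) F i w).
  elim: s => [|i s IH] h.
    rewrite big_nil; apply: (@Lb_eq _ _ _ P _ _ (fun=> 0)); first by move=> w; rewrite big_nil.
    by have := Lb_cst P 0 r0; rewrite normr0.
  rewrite big_cons; apply: (@Lb_eq _ _ _ P _ _ (fun w => F i w + \sum_(j <- s) F j w)).
    by move=> w; rewrite big_cons.
  apply: (LbD r1); first by apply: h; rewrite mem_head.
  by apply: IH => j js; apply: h; rewrite inE js orbT.
apply: (@L0 _ (index_iota 0 N) (fun j w => \sum_(0 <= l < N) f j l w)
  (fun j => \sum_(0 <= l < N) `|al ^+ (j + l)| * (C * ((1 + j%:R) * (1 + l%:R)) * k))) => j.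
rewrite mem_index_iota => /andP[_ jN].
apply: (@L0 _ (index_iota 0 N) (fun l w => f j l w)
  (fun l => `|al ^+ (j + l)| * (C * ((1 + j%:R) * (1 + l%:R)) * k))) => l.
rewrite mem_index_iota => /andP[_ lN].
apply: (LbZ _ r0); apply: Lb_norm; exact: H.
Qed.

(** The average over [n] of the bound in [inverse_filter_le] with [M = n], up to the factor
    [c^2]. *)
Definition transient (N : nat) w := N%:R^-1 * \sum_(1 <= n < N.+1) (n%:R * beta ^+ n) * Lam n%:Z w.

Lemma Lb_transient : exists2 C, 0 <= C & forall N, (0 < N)%N ->
  Lb P r (C * (Num.sqrt N%:R)^-1) (transient N).
Proof.
have [|L HL] := Lb_subpow (q := 2 * r) (lt_le_trans ltr01 r1) _ LX.
  by rewrite ler_peMl// ler1n.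
have L0 : 0 <= L by case: HL.
pose z := Num.sqrt beta.
have z0 : 0 <= z by exact: sqrtr_ge0.
have z1 : z < 1 by rewrite -[ltRHS]sqrtr1 ltr_sqrt//; case/andP: b01.
have z01 : 0 <= z < 1 by rewrite z0.
have zb : z ^+ 2 = beta by rewrite sqr_sqrtr.
have zp : 0 <= (1 - z)^-1 by rewrite invr_ge0 subr_ge0 ltW.
have zS N : \sum_(0 <= n < N) n%:R * beta ^+ n <= (1 - z)^-1 * (1 - z)^-1.
  apply: (@le_trans _ _ (\sum_(0 <= n < N) (1 - z)^-1 * z ^+ n)).
    apply: ler_sum => n _; rewrite -zb exprAC expr2 mulrA ler_wpM2r ?exprn_ge0//.
    exact: mulrn_geo_le.
  by rewrite -mulr_sumr ler_wpM2l// geo_sum_le.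
pose S := (1 - z)^-1 * (1 - z)^-1 * (L * (1 - beta)^-1).
have S0 : 0 <= S by rewrite /S mulr_ge0// mulr_ge0.
exists S => // N N0.
have J := @Lb_sum _ _ _ P _ (index_iota 1 N.+1) r (fun n => `|n%:R * beta ^+ n| * (L / (1 - beta)))
  (fun n w => (n%:R * beta ^+ n) * Lam n%:Z w) r1
  (fun n => LbZ _ r0 (Lb_past_weight iidX beta01 sumX n%:Z r1 HL)).
apply: (Lb_le r0 _ (LbZ N%:R^-1 r0 J)).
rewrite ger0_norm ?invr_ge0// mulrC ler_pM ?invr_ge0// ?invn_le_sqrt//.
  by apply: sumr_ge0 => n _; rewrite !mulr_ge0.
rewrite -mulr_suml ler_wpM2r ?mulr_ge0//; apply: (le_trans _ (zS N.+1)).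
rewrite [leRHS]big_ltn// mul0r add0r; apply: ler_sum => n _.
by rewrite ger0_norm// mulr_ge0// exprn_ge0.
Qed.

Lemma Lb_empirical_mean : exists2 C, 0 <= C & forall g : R -> R, measurable_fun setT g ->
  (forall x, `|g x| <= 1) -> forall N, (0 < N)%N -> Lb P r (C * (Num.sqrt N%:R)^-1)
  (fun w => N%:R^-1 * \sum_(1 <= n < N.+1) g (X n%:Z w) - \int[P]_w g (X 0 w)).
Proof.
have [C C0 H] := moment_iid_sum iidX r2.
have mX n : measurable_fun setT (X n) by case: iidX.
exists (C * 2) => [|g mg g1 N N0]; first by rewrite mulr_ge0.
set m := \int[P]_w g (X 0 w).
have mgX : measurable_fun setT (g \o X 0) by exact: measurableT_comp.
have L1 : Lb P r 1 (g \o X 0).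
  have := Lb_cst P (1 : R) r0; rewrite normr1; apply: Lb_mono => // w.
  by rewrite /= normr1.
have ig := Lb_integrable r1 L1.
have m1 : `|m| <= 1.
  apply: (le_trans (le_normr_Rintegral measurableT ig)).
  have ic := finite_measure_integrable_cst P (1 : R) measurableT.
  have : \int[P]_w `|g (X 0 w)| <= \int[P]_w (1 : R).
    by apply: le_Rintegral => //; have := integrable_norm ig; apply: eq_integrable.
  move/le_trans; apply; rewrite /Rintegral integral_cst//.
  by rewrite [X in (_ * X)%E]probability_setT mule1.
have Lg : Lb P r 2 ((fun x => g x - m) \o X 0).
  by apply: (Lb_le r0 _ (LbB r1 L1 (Lb_cst P m r0))); rewrite -[2]/(1 + 1) lerD2l.
have g0 : \int[P]_w (g (X 0 w) - m) = 0.
  have i3 := finite_measure_integrable_cst P m measurableT.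
  rewrite RintegralB// /Rintegral -/(Rintegral _ _ _) integral_cst//.
  by rewrite [X in (_ * X)%E]probability_setT mule1/= subrr.
have mgm : measurable_fun setT (fun x => g x - m) by exact: measurable_funB.
have := LbZ N%:R^-1 r0 (H 1 _ _ mgm Lg g0 N).
have Ni : 0 <= N%:R^-1 :> R by rewrite invr_ge0.
rewrite (ger0_norm Ni) mulrCA (sqrtn_inv N0); apply: Lb_eq => w.
have Nn0 : N%:R != 0 :> R by rewrite pnatr_eq0 -lt0n.
rewrite sumrB big_const_nat subn0 iter_addr_0 mulrBr -[m *+ N]mulr_natl mulKf//.
congr (_ * _ - _); rewrite -[X in _ = \sum_(X <= _ < _) _]add0n big_addn subSS subn0.
by apply: eq_bigr => i _; rewrite addn1 -addn1 PoszD addrC.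
Qed.

(** This average multiplies the parameter error and must be bounded at each outcome. Exchanging the
    sums and using [|y| <= 1 + y^2] reduces it to the empirical variance, which is itself close to
    its limit when [cov_error] is small. *)
Lemma innovation_average_le N w (A : R) : (forall j l, `|gam j l| <= A) -> (0 < N)%N ->
  N%:R^-1 * (\sum_(1 <= n < N.+1) \sum_(0 <= j < n) beta ^+ j * `|y (n%:Z - j%:Z) w|)
    <= (1 - beta)^-1 * (1 + A + cov_error N w).
Proof.
move=> gA N0; have Ni : 0 <= N%:R^-1 :> R by rewrite invr_ge0.
have S (F : nat -> R) : (forall m, 0 <= F m) ->
    \sum_(1 <= n < N.+1) \sum_(0 <= j < n) beta ^+ j * F (n - j)%N <=
    (1 - beta)^-1 * \sum_(1 <= n < N.+1) F n.
  move=> F0; apply: (@le_trans _ _ (\sum_(0 <= j < N) beta ^+ j * \sum_(1 <= n < N.+1) F n)); last first.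
    by rewrite -mulr_suml ler_wpM2r ?geo_sum_le// sumr_ge0.
  rewrite [leLHS](_ : _ = \sum_(1 <= n < N.+1) \sum_(0 <= j < N) (if (j < n)%N then beta ^+ j * F (n - j)%N else 0)).
    rewrite exchange_big /=; rewrite big_nat [leRHS]big_nat; apply: ler_sum => j /andP[_ jN].
    rewrite -big_mkcond/= -mulr_sumr ler_wpM2l ?exprn_ge0//.
    rewrite (_ : \sum_(_ <= _ < _ | _) _ = \sum_(j.+1 <= n < N.+1) F (n - j)%N); last first.
      rewrite [RHS](big_nat_widenl j.+1 1)//.
    rewrite -[X in \sum_(X <= _ < _) _]add1n big_addn subSn ?(ltnW jN)//.
    under eq_bigr do rewrite addnK.
    have le : (1 <= (N - j).+1)%N by [].
    have le' : ((N - j).+1 <= N.+1)%N by rewrite ltnS leq_subr.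
    by rewrite (big_cat_nat le le')/= lerDl sumr_ge0.
  rewrite big_nat [RHS]big_nat; apply: eq_bigr => n /andP[_ nN].
  rewrite -big_mkcond/= (big_nat_widen 0 n N)//.
have := S (fun m => `|y m%:Z w|) (fun m => normr_ge0 _) => S1.
have {S1}S1 : \sum_(1 <= n < N.+1) \sum_(0 <= j < n) beta ^+ j * `|y (n%:Z - j%:Z) w| <=
    (1 - beta)^-1 * \sum_(1 <= n < N.+1) `|y n%:Z w|.
  apply: le_trans S1; rewrite le_eqVlt; apply/orP; left; apply/eqP.
  apply: eq_bigr => n _; rewrite big_nat [RHS]big_nat; apply: eq_bigr => j /andP[_ jn].
  by rewrite subzn// ltnW.
apply: (le_trans (ler_wpM2l Ni S1)); rewrite mulrCA ler_wpM2l//.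
apply: (@le_trans _ _ (N%:R^-1 * (\sum_(1 <= n < N.+1) (1 + y n%:Z w ^+ 2)))).
  rewrite ler_wpM2l//; apply: ler_sum => n _.
  rewrite -[y _ _ ^+ 2]real_normK ?num_real//.
  by move: (`|y n%:Z w|) => z; nra.
rewrite big_split/= big_const_nat subSS subn0 iter_addr_0 mulrDr mulVf ?pnatr_eq0 -?lt0n//.
rewrite -addrA lerD2l.
have -> : N%:R^-1 * \sum_(1 <= n < N.+1) y n%:Z w ^+ 2 = sample_cov N 0 0 w.
  rewrite /sample_cov; congr (_ * _); rewrite big_nat [RHS]big_nat_cond.
  rewrite [RHS](eq_bigl (fun n => (0 < n < N.+1)%N)) => [|n]; last first.
    by rewrite andbb -andbA; case: (0 < n)%N; rewrite ?andbT ?andbF.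
  by apply: eq_bigr => n _; rewrite !subr0 expr2.
have : `|sample_cov N 0 0 w - gam 0%N 0%N| <= cov_error N w.
  have t0 j l : 0 <= (beta ^+ 2) ^+ (j + l) * `|sample_cov N j l w - gam j l|.
    by rewrite mulr_ge0// exprn_ge0// sqr_ge0.
  rewrite /cov_error big_ltn//= big_ltn//= ?addn0 expr0 mul1r -addrA lerDl addr_ge0//.
    by rewrite sumr_ge0.
  by apply: sumr_ge0 => j _; exact: sumr_ge0.
move/(le_trans (ler_norm _)) => h.
by have := le_trans (ler_norm _) (gA 0%N 0%N); move: h; lra.
Qed.
End ErrorRates.

(** * Scores *)

Section UniformLimits.
Context {R : realType} {p : nat}.
Implicit Types (f : 'rV[R]_p -> R) (x y : 'rV[R]_p) (s : seq 'I_p).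

Lemma norm_unitv_le (i : 'I_p) : `|unitv R i| <= 1 :> R.
Proof. by apply: rv_norm_le => // j; rewrite mxE eqxx /=; case: eqP; rewrite ?normr1 ?normr0. Qed.

Lemma open_segment (U : set 'rV[R]_p) x : open U -> U x ->
  exists2 e : R, 0 < e & forall y, `|y - x| <= e -> U y.
Proof.
move=> oU Ux; have : nbhs x U by exact: open_nbhs_nbhs.
rewrite -nbhs_ballE => -[e /= e0 eU]; exists (e / 2); first by rewrite divr_gt0.
move=> y ye; apply: eU; rewrite -ball_normE /ball_/= distrC.
by apply: (le_lt_trans ye); rewrite ltr_pdivrMr// mulr_natr mulr2n ltrDl.
Qed.

Variables (U : set 'rV[R]_p) (f : nat -> 'rV[R]_p -> R) (g : seq 'I_p -> 'rV[R]_p -> R) (M : R).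
Hypothesis oU : open U.
Hypothesis f_smooth : forall N, smooth U 3 (f N).
Hypothesis f_le : forall N s, (size s <= 3)%N -> forall x, U x -> `|pD s (f N) x| <= M.
Hypothesis f_cvg : forall s, (size s <= 2)%N -> forall x, U x ->
  (fun N => pD s (f N) x) @ \oo --> g s x.

(** The second-order Taylor bound has the constant [M] for every [N], hence holds in the limit,
    where it identifies the derivative. Pointwise convergence together with one further bounded
    derivative is enough. *)
Lemma is_derive_limit s i x : (size s <= 1)%N -> U x ->
  is_derive x (unitv R i) (g s) (g (i :: s) x).
Proof.
move=> s1 Ux; have [e e0 eU] := open_segment oU Ux.
have seg (t : R) : `|t| <= e -> U (x + t *: unitv R i).
  move=> te; apply: eU; rewrite addrAC subrr add0r normrZ.
  by rewrite (le_trans _ te)// ler_piMr// norm_unitv_le.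
apply: (is_derive_quadratic (C := M) e0) => t te.
have s2 : (size s <= 2)%N by exact: leq_trans s1 _.
have is2 : (size (i :: s) <= 2)%N by [].
have c : `|pD s (f N) (x + t *: unitv R i) - pD s (f N) x - t * pD (i :: s) (f N) x| @[N --> \oo]
   --> `|g s (x + t *: unitv R i) - g s x - t * g (i :: s) x|.
  apply: cvg_norm; apply: cvgB; last by apply: cvgMr; exact: f_cvg.
  by apply: cvgB; apply: f_cvg => //; exact: seg.
apply: (cvgr_to_le c); apply: nearW => N.
apply: (@pderiv_taylor2 _ _ (pD s (f N)) i x t M) => t' tt'.
have Ut' := seg t' (le_trans tt' te).
split; [exact: f_smooth|exact: (@f_smooth N (i :: s))|].
exact: (@f_le N [:: i, i & s]).
Qed.

Lemma pD_limit s x : (size s <= 2)%N -> U x -> pD s (g [::]) x = g s x.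
Proof.
elim: s x => [//|i s IH] x si Ux /=.
have s1 : (size s <= 1)%N by [].
have D := is_derive_limit i s1 Ux.
rewrite -(@derive_val _ _ _ _ _ _ _ D); apply: near_eq_derive.
have := open_nbhs_nbhs (conj oU Ux); apply: filterS => y Uy.
by apply: IH => //; exact: ltnW.
Qed.

Lemma smooth_limit : smooth U 2 (g [::]).
Proof.
move=> s s1 i x Ux; have D := is_derive_limit i (s := s) s1 Ux.
have := @ex_derive _ _ _ _ _ _ _ D; apply: near_eq_derivable.
have := open_nbhs_nbhs (conj oU Ux); apply: filterS => y Uy.
by apply/esym/pD_limit => //; exact: ltnW.
Qed.

Lemma limit_le s x : (size s <= 2)%N -> U x -> `|pD s (g [::]) x| <= M.
Proof.
move=> s2 Ux; rewrite pD_limit//.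
have c : `|pD s (f N) x| @[N --> \oo] --> `|g s x| by apply: cvg_norm; exact: f_cvg.
apply: (cvgr_to_le c); apply: nearW => N; exact: f_le (leq_trans s2 _) _ _.
Qed.

Lemma limit_lipschitz s x0 (rho : R) : (size s <= 2)%N ->
  (forall y, `|y - x0| <= rho -> U y) -> forall x y, `|x - x0| <= rho -> `|y - x0| <= rho ->
  `|pD s (g [::]) x - pD s (g [::]) y| <= p%:R * M * `|x - y|.
Proof.
move=> s2 BU x y xr yr; have [Ux Uy] := (BU x xr, BU y yr); rewrite !pD_limit//.
have c : `|pD s (f N) x - pD s (f N) y| @[N --> \oo] --> `|g s x - g s y|.
  by apply: cvg_norm; apply: cvgB; apply: f_cvg => //; exact: BU.
apply: (cvgr_to_le c); apply: nearW => N.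
apply: (@pderiv_lipschitz _ _ (pD s (f N)) x0 rho M _ x y xr yr) => z zr i; have Uz := BU z zr.
by split; [exact: f_smooth|exact: (@f_le N (i :: s))].
Qed.
End UniformLimits.

Section ScoreRoot.
Context {R : realType} {p : nat}.
Implicit Types (V W : 'rV[R]_p -> R) (x y : 'rV[R]_p) (s : seq 'I_p).

Lemma smooth_pderiv_lipschitz (U : set 'rV[R]_p) V i (c : 'rV[R]_p) (rho M : R) : smooth U 2 V ->
  (forall y, `|y - c| <= rho -> U y) ->
  (forall s, size s = 2%N -> forall x, U x -> `|pD s V x| <= M) ->
  forall x y, `|x - c| <= rho -> `|y - c| <= rho ->
  `|pderiv V i x - pderiv V i y| <= p%:R * M * `|x - y|.
Proof.
move=> sV BU VM x y xr yr.
apply: (pderiv_lipschitz (f := pderiv V i) (c := c) (rho := rho)) => // z zr j.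
by split; [exact: (sV [:: i]) (BU _ zr)|exact: (VM [:: j; i]) (BU _ zr)].
Qed.

Lemma grad_norm_le V W x (e : R) : 0 <= e ->
  (forall i, `|pderiv V i x - pderiv W i x| <= e) -> `|grad V x - grad W x| <= e.
Proof. by move=> e0 H; apply: rv_norm_le => // i; rewrite !mxE. Qed.

(** Closeness is asked of derivatives of orders one and two only, because the criteria are compared
    up to additive constants. *)
Lemma score_root (U D : set 'rV[R]_p) W x0 (rho M L : R) : open U -> compact D -> D `<=` U ->
  0 < rho -> 0 <= M -> 0 <= L -> (forall x, `|x - x0| <= rho -> D x) ->
  smooth U 2 W ->
  (forall s, size s = 2%N -> forall x, U x -> `|pD s W x| <= M) ->
  (forall s, size s = 2%N -> forall x, `|x - x0| <= rho ->
     `|pD s W x - pD s W x0| <= L * `|x - x0|) ->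
  (forall x, D x -> (grad W x = 0 <-> x = x0)) ->
  hess W x0 \in unitmx ->
  exists2 dl, 0 < dl & exists2 C, 0 <= C & forall V (eta : R), smooth U 2 V ->
    0 <= eta -> eta <= dl ->
    (forall s, (0 < size s <= 2)%N -> forall x, U x -> `|pD s V x - pD s W x| <= eta) ->
    (exists x, D x /\ grad V x = 0) /\
    forall x, D x -> grad V x = 0 -> `|x - x0| <= C * eta /\
      `|x - x0 + grad V x0 *m invmx (hess W x0)| <= C * eta ^+ 2.
Proof.
move=> oU cD DU rho0 M0 L0 BD sW WM WL Wx0 uH.
have Dx0 : D x0 by apply: BD; rewrite subrr normr0 ltW.
have [|||||dl dl0 [C C0 HC]] := @perturbed_root R p D (grad W) x0 (hess W x0) rho (p%:R * L) cD rho0 _ BD _ _ _ uH.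
- by rewrite mulr_ge0.
- move=> x Dx; have [e e0 eU] := open_segment oU (DU x Dx).
  exists e, (p%:R * M); split => //; first by rewrite mulr_ge0.
  move=> y Dy ye; apply: rv_norm_le => [|i]; first by rewrite !mulr_ge0.
  rewrite !mxE; have xe : `|x - x| <= e by rewrite subrr normr0 ltW.
  exact: (@smooth_pderiv_lipschitz U W i x e M sW eU WM y x ye xe).
- by move=> x Dx; exact: (Wx0 x Dx).1.
- exact/(Wx0 x0 Dx0).
- move=> r x y rr xr yr; have r0 : 0 <= r by exact: le_trans xr.
  have E : grad W x - grad W y = \row_j (pderiv W j x - pderiv W j y).
    by apply/rowP => i; rewrite !mxE.
  rewrite E -[p%:R * L * r]mulrA; apply: (@pderiv_first_order _ _ (fun j => pderiv W j) _ x0 r (L * r)) => //.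
    by rewrite mulr_ge0.
  move=> z zr i j; have zrho := le_trans zr rr; split; first exact: (sW [:: j]) (DU _ (BD _ zrho)).
  rewrite mxE; apply: (le_trans (WL [:: i; j] erefl z zrho)).
  by rewrite ler_wpM2l.
exists (dl / (p%:R + 1)); first by rewrite divr_gt0// ltr_wpDl.
have p1 : 0 < p%:R + 1 :> R by rewrite ltr_wpDl.
exists (C * (p%:R + 1) ^+ 2); first by rewrite mulr_ge0 ?sqr_ge0.
move=> V eta sV eta0 etadl VW.
(* A bound [eta] on second derivatives makes the difference of gradients Lipschitz with constant
   [p eta]; [p + 1] also covers the uniform bound on the gradients. *)
have [||||ex all] := HC (grad V) ((p%:R + 1) * eta).
- by rewrite mulr_ge0// ltW.
- by rewrite mulrC -ler_pdivlMr.
- move=> x Dx; apply: grad_norm_le => [|i]; first by rewrite mulr_ge0// ltW.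
  apply: (le_trans (VW [:: i] isT x (DU x Dx))); rewrite ler_peMl// lerDr//.
- move=> x y xr yr; apply: rv_norm_le => [|i].
    by rewrite !mulr_ge0// ltW.
  have sVW : smooth U 2 (fun z => 1 * V z + (-1) * W z) by exact: smooth_lin.
  have EVW s z : (size s <= 2)%N -> U z ->
      pD s (fun z => 1 * V z + (-1) * W z) z = pD s V z - pD s W z.
    by move=> s2 Uz; rewrite (pD_lin oU 1 (-1) sV sW s2 Uz) mul1r mulN1r.
  have := @smooth_pderiv_lipschitz U _ i x0 rho eta sVW (fun y yr => DU _ (BD _ yr)) _ x y xr yr.
  have e1 := EVW [:: i] x isT (DU _ (BD _ xr)).
  have e2 := EVW [:: i] y isT (DU _ (BD _ yr)).
  rewrite /= in e1 e2; rewrite e1 e2 !mxE => h; apply: (le_trans (h _)).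
    by move=> s s2 z Uz; rewrite EVW ?s2// VW// s2.
  by rewrite ler_wpM2r// ler_wpM2r// lerDl.
split; first exact: ex.
move=> x Dx Vx; have [h1 h2] := all x Dx Vx; split.
  apply: (le_trans h1); rewrite mulrA ler_wpM2r// ler_wpM2l// expr2 ler_peMr ?(ltW p1)//.
  by rewrite lerDr.
by move: h2; rewrite exprMn mulrA.
Qed.
End ScoreRoot.

Section SquareSums.
Context {R : realType}.
Variables (t : nat -> nat -> R) (B al : R).
Hypothesis al01 : 0 <= al < 1.
Hypothesis B0 : 0 <= B.
Hypothesis t_le : forall j l, `|t j l| <= B * al ^+ (j + l).
Local Notation S N := (\sum_(0 <= j < N) \sum_(0 <= l < N) t j l).

Let al0 : 0 <= al. Proof. by case/andP: al01. Qed.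
Let g0 : 0 <= (1 - al)^-1. Proof. by case/andP: al01 => _ ?; rewrite invr_ge0 subr_ge0 ltW. Qed.

Lemma geo_tail_le N n : \sum_(N <= j < n) al ^+ j <= al ^+ N * (1 - al)^-1.
Proof.
rewrite -{1}[N]add0n big_addn; under eq_bigr do rewrite exprD mulrC.
by rewrite -mulr_sumr ler_wpM2l ?exprn_ge0// geo_sum_le.
Qed.

Lemma block_sum_le a1 b1 a2 b2 :
  `|\sum_(a1 <= j < b1) \sum_(a2 <= l < b2) t j l| <=
  B * (al ^+ a1 * (1 - al)^-1) * (al ^+ a2 * (1 - al)^-1).
Proof.
apply: (@le_trans _ _ (\sum_(a1 <= j < b1) \sum_(a2 <= l < b2) B * (al ^+ j * al ^+ l))).
  apply: (le_trans (ler_norm_sum _ _ _)); apply: ler_sum => j _.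
  apply: (le_trans (ler_norm_sum _ _ _)); apply: ler_sum => l _.
  by rewrite -exprD.
rewrite (_ : \sum_(_ <= _ < _) _ = B * (\sum_(a1 <= j < b1) al ^+ j) * (\sum_(a2 <= l < b2) al ^+ l)).
  have s0 m n : 0 <= \sum_(m <= j < n) al ^+ j by apply: sumr_ge0 => j _; exact: exprn_ge0.
  by apply: ler_pM; [exact: mulr_ge0|exact: s0|rewrite ler_wpM2l// geo_tail_le|exact: geo_tail_le].
rewrite [B * _]mulr_sumr mulr_suml; apply: eq_bigr => j _.
by rewrite mulr_sumr; apply: eq_bigr => l _; rewrite mulrA.
Qed.

Definition square_sum_const := B * (1 - al)^-1 * (1 - al)^-1 *+ 2.

Lemma square_sum_const_ge0 : 0 <= square_sum_const.
Proof. by rewrite mulrn_wge0// !mulr_ge0. Qed.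

(** The part of the larger square outside the smaller one consists of two rectangles, each with one
    index at least [N]. *)
Lemma square_sum_tail N n : (N <= n)%N -> `|S n - S N| <= square_sum_const * al ^+ N.
Proof.
move=> Nn.
have -> : S n - S N = \sum_(0 <= j < N) \sum_(N <= l < n) t j l + \sum_(N <= j < n) \sum_(0 <= l < n) t j l.
  rewrite (big_cat_nat (leq0n N) Nn)/= addrAC -sumrB; congr (_ + _).
  by apply: eq_bigr => j _; rewrite (big_cat_nat (leq0n N) Nn)/= addrAC subrr add0r.
apply: (le_trans (ler_normD _ _)).
have h1 := block_sum_le 0 N N n; have h2 := block_sum_le N n 0 n.
apply: (le_trans (lerD h1 h2)); rewrite /square_sum_const expr0 mul1r.
by rewrite le_eqVlt; apply/orP; left; apply/eqP; ring.
Qed.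

Lemma square_sum_cvg : cvgn (fun N => S N).
Proof.
apply: cauchy_cvg; apply: cauchy_exP => e e0.
have z : square_sum_const * al ^+ N @[N --> \oo] --> square_sum_const * 0.
  by apply: cvgMr; apply: cvg_expr; rewrite ger0_norm//; case/andP: al01.
rewrite mulr0 in z; have := z => /cvgrPdist_lt /(_ e e0) [N _ HN].
exists (S N), N => // n /= Nn; rewrite -ball_normE /ball_/= distrC.
apply: (le_lt_trans (square_sum_tail Nn)); have := HN N (leqnn N).
by rewrite sub0r normrN; exact: le_lt_trans (ler_norm _).
Qed.

Lemma square_sum_dist l N : (fun N => S N) @ \oo --> l -> `|l - S N| <= square_sum_const * al ^+ N.
Proof.
move=> cl; have c : `|S n - S N| @[n --> \oo] --> `|l - S N|.
  by apply: cvg_norm; apply: cvgB; [exact: cl|exact: cvg_cst].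
by apply: (cvgr_to_le c); near=> n; apply: square_sum_tail; near: n; exists N.
Unshelve. all: by end_near. Qed.
End SquareSums.

Section InverseFilterSmooth.
Context {R : realType} {p : nat}.

Lemma smooth_sub (U G : set 'rV[R]_p) k f : U `<=` G -> smooth G k f -> smooth U k f.
Proof. by move=> UG sf s sk i x /UG; exact: sf. Qed.

(** Differentiability is assumed of the filter and derived for its inverse, by strong induction
    along the recursion that expresses each coefficient of the inverse through earlier ones. *)
Lemma inverse_filter_smooth (G : set 'rV[R]_p) k (a b : nat -> 'rV[R]_p -> R) : open G ->
  (forall x, G x -> a 0%N x = 1 /\ inverse_filter a b x) ->
  (forall j, smooth G k (a j)) -> forall j, smooth G k (b j).
Proof.
move=> oG ab sa j; have [n] := ubnP j; elim: n j => // n IH [|j] jn.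
  apply: (smooth_eq oG (f := fun=> 1)); last exact: smooth_cst.
  by move=> x /ab[_ []].
apply: (smooth_eq oG (f := fun x => (-1) * \sum_(i <- index_iota 0 j.+1) (a i.+1 x * b (minn j (j - i)) x))).
  move=> x /ab[a0 [_ /(_ j.+1 isT)]]; rewrite big_ord_recl/= a0 mul1r subn0 => /eqP.
  rewrite addr_eq0 => /eqP ->; rewrite mulN1r big_mkord; congr (- _).
  by apply: eq_bigr => i _; rewrite /= subSS (minn_idPr (leq_subr _ _)).
apply: (smooth_scale oG); apply: (smooth_sum oG) => i.
apply: (smooth_mul oG); first exact: sa.
apply: IH.
by rewrite (leq_ltn_trans (geq_minl _ _)).
Qed.
End InverseFilterSmooth.

(** * The prediction error stage *)

Section PredictionError.
Context d {T : measurableType d} {R : realType} (P : probability T R) {p : nat}.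
Variables (X : int -> T -> R) (beta c : R) (a : nat -> R).
Hypothesis iidX : iid P X.
Hypothesis beta01 : 0 < beta < 1.
Hypothesis sumX : forall n w, exists B, forall M,
  \sum_(0 <= j < M) beta ^+ j * `|X (n - j%:Z) w| <= B.
Hypothesis c0 : 0 <= c.
Hypothesis a_le : forall j, `|a j| <= c * (beta ^+ 2) ^+ j.
Variables (r K : R).
Hypothesis r2 : 2 <= r.
Hypothesis LX : Lb P (2 * r) K (X 0).
Local Notation y := (filtered X a).
Local Notation gam := (autocov P X a).
Local Notation al := (beta ^+ 2).
Variables (U : set 'rV[R]_p) (b : nat -> 'rV[R]_p -> R).
Hypothesis oU : open U.
Hypothesis b_smooth : forall j, smooth U 3 (b j).
Hypothesis b_le : forall s j x, (size s <= 3)%N -> U x -> `|pD s (b j) x| <= c * al ^+ j.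

Let al01 : 0 <= al < 1.
Proof. by case/andP: beta01 => b0 b1; rewrite sqr_ge0 expr_lt1// ltW. Qed.
Let al0 : 0 <= al. Proof. exact: sqr_ge0. Qed.

(** One formula for both criteria: with the sample covariances it is half the mean squared estimated
    innovation, with the autocovariances it tends to [W_P] as [N] grows. *)
Definition quad_loss (N : nat) (cc : nat -> nat -> R) (th : 'rV[R]_p) : R :=
  2^-1 * \sum_(0 <= j < N) \sum_(0 <= l < N) cc j l * (b j th * b l th).

Let smooth_bb k j l : (k <= 3)%N -> smooth U k (fun x => b j x * b l x).
Proof. by move=> k3; apply: (smooth_mul oU) => s sk; apply: b_smooth; exact: leq_trans sk k3. Qed.

Lemma smooth_quad_loss N cc : smooth U 3 (quad_loss N cc).
Proof.
apply: (smooth_scale oU); apply: (smooth_sum oU) => j; apply: (smooth_sum oU) => l.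
by apply: (smooth_scale oU); exact: smooth_bb.
Qed.

Lemma pD_quad_loss N cc s x : (size s <= 3)%N -> U x -> pD s (quad_loss N cc) x =
  2^-1 * \sum_(0 <= j < N) \sum_(0 <= l < N) cc j l * pD s (fun y => b j y * b l y) x.
Proof.
move=> s3 Ux; have sjl j l : smooth U 3 (fun x => cc j l * (b j x * b l x)).
  by apply: (smooth_scale oU); exact: smooth_bb.
have sj j : smooth U 3 (fun x => \sum_(0 <= l < N) cc j l * (b j x * b l x)).
  by apply: (smooth_sum oU) => l; exact: sjl.
rewrite (pD_scale oU _ (smooth_sum oU (r := index_iota 0 N) sj) s3 Ux); congr (_ * _).
rewrite (pD_sum oU _ sj s3 Ux); apply: eq_bigr => j _.
rewrite (pD_sum oU _ (sjl j) s3 Ux); apply: eq_bigr => l _.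
by rewrite (pD_scale oU _ (@smooth_bb 3 j l isT) s3 Ux).
Qed.

Let pD_bb_le s j l x : (size s <= 3)%N -> U x ->
  `|pD s (fun y => b j y * b l y) x| <= 8 * c ^+ 2 * al ^+ (j + l).
Proof.
move=> s3 Ux.
have := pD_mul_le oU (@b_smooth j) (@b_smooth l) Ux (fun s s3 => @b_le s j x s3 Ux)
  (fun s s3 => @b_le s l x s3 Ux) s3.
by move/le_trans; apply; rewrite exprD le_eqVlt; apply/orP; left; apply/eqP; ring.
Qed.

Let B0 A : 0 <= A -> 0 <= A * (8 * c ^+ 2).
Proof. by move=> A0; rewrite mulr_ge0// mulr_ge0// sqr_ge0. Qed.

Let term_le A (cc : nat -> nat -> R) s x : 0 <= A -> (forall j l, `|cc j l| <= A) ->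
  (size s <= 3)%N -> U x -> forall j l,
  `|cc j l * pD s (fun y => b j y * b l y) x| <= A * (8 * c ^+ 2) * al ^+ (j + l).
Proof. by move=> A0 cA s3 Ux j l; rewrite normrM -mulrA ler_pM// pD_bb_le. Qed.

Lemma pD_quad_loss_le A N cc s x : 0 <= A -> (forall j l, `|cc j l| <= A) ->
  (size s <= 3)%N -> U x -> `|pD s (quad_loss N cc) x| <= square_sum_const (A * (8 * c ^+ 2)) al.
Proof.
move=> A0 cA s3 Ux; rewrite pD_quad_loss// normrM ger0_norm ?invr_ge0//.
have := square_sum_tail al01 (B0 A0) (term_le A0 cA s3 Ux) (leq0n N).
rewrite [X in _ - X]big_geq// subr0 expr0 mulr1 => h.
have := square_sum_const_ge0 al01 (B0 A0); move: h.
by move: (square_sum_const _ _) (`|_|) => u v; lra.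
Qed.

(** The parameter occurs only in the deterministic products of coefficients, so the bound is uniform
    in [x]. The constant is half of [2^3 c^2], the Leibniz bound at order three. *)
Lemma pD_quad_lossB_le N cc cc' s x : (size s <= 3)%N -> U x ->
  `|pD s (quad_loss N cc) x - pD s (quad_loss N cc') x| <=
  4 * c ^+ 2 * \sum_(0 <= j < N) \sum_(0 <= l < N) al ^+ (j + l) * `|cc j l - cc' j l|.
Proof.
move=> s3 Ux; rewrite !pD_quad_loss// -mulrBr normrM ger0_norm ?invr_ge0//.
rewrite ler_pdivrMl// mulrA (_ : 2 * _ = 8 * c ^+ 2); last by ring.
rewrite -sumrB mulr_sumr; apply: (le_trans (ler_norm_sum _ _ _)); apply: ler_sum => j _.
rewrite -sumrB mulr_sumr; apply: (le_trans (ler_norm_sum _ _ _)); apply: ler_sum => l _.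
by rewrite -mulrBl normrM mulrC mulrA ler_wpM2r// pD_bb_le.
Qed.

Let gamB := autocov_bounded iidX beta01 sumX c0 a_le r2 LX.

Lemma quad_loss_cvg x : U x -> (fun N => quad_loss N gam x) @ \oo --> WP P b y x.
Proof.
move=> Ux; have bx j : `|b j x| <= c * al ^+ j := @b_le [::] j x isT Ux.
have [|L HL] := Lb_subpow (q := 2 * r) (ltr0Sn R 1) _ LX; first by have := r2; lra.
have LD := LbZ (c ^+ 2 / (1 - beta)) (ler0n R 2)
  (Lb_past_weight iidX beta01 sumX 0 (ler1n R 2) HL).
have my n := measurable_filtered iidX beta01 sumX c0 a_le n.
have LD' := Lb_eq (g := fun w => c ^+ 2 / (1 - beta) * past_weight X beta 0 w) (frefl _) LD.
have dom w M : \sum_(0 <= j < M) `|b j x * y (0 - j%:Z) w| <= c ^+ 2 / (1 - beta) * past_weight X beta 0 w.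
  exact: (refiltered_abs_le beta01 sumX c0 a_le bx).
have mb j : measurable_fun setT (fun w => b j x * y (0 - j%:Z) w) by exact: measurable_funM.
have cv := bilinear_limit LD mb mb dom dom.
have E : WP P b y x = 2^-1 * \int[P]_w (rseries (fun j => b j x * y (0 - j%:Z) w) *
   rseries (fun j => b j x * y (0 - j%:Z) w)).
  rewrite /WP mulrC; congr (_ * _); rewrite unlock /Rintegral; congr fine.
rewrite E /quad_loss; apply: cvgMr; apply: cvg_trans cv; apply: near_eq_cvg; apply: nearW => M.
apply: eq_bigr => j _; apply: eq_bigr => l _; rewrite /autocov.
have iyy : P.-integrable setT (EFin \o (fun w => y (- j%:Z) w * y (- l%:Z) w)).
  have Ly n := Lb_filtered iidX beta01 sumX c0 a_le n (ler1n R 2) HL.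
  have Ls n : Lb P 1 ((c * (L / (1 - beta))) ^+ 2) (fun w => y n w ^+ 2).
    by apply: Lb_sqr => //; rewrite mulr1; exact: Ly.
  have i1 := Lb_integrable (lexx 1) (LbD (lexx 1) (Ls (- j%:Z)) (Ls (- l%:Z))).
  apply: (le_integrable _ _ _ i1) => //.
    by apply/measurable_EFinP; apply: measurable_funM.
  move=> w _; rewrite /= lee_fin [leRHS]ger0_norm ?addr_ge0 ?sqr_ge0//.
  exact: normrM_le_sqrD.
rewrite [RHS]mulrC -RintegralZl//.
by apply: eq_Rintegral => w _; rewrite !sub0r mulrACA.
Qed.

(** Candidates for the derivatives of [W_P]: the entry of order zero is [W_P] itself, and [pD_limit]
    then identifies the others. *)
Definition loss_limit (s : seq 'I_p) x : R :=
  if s is [::] then WP P b y x else limn (fun N => pD s (quad_loss N gam) x).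

Lemma pD_quad_loss_cvg s x : (size s <= 2)%N -> U x ->
  (fun N => pD s (quad_loss N gam) x) @ \oo --> loss_limit s x.
Proof.
have [A A0 gA] := gamB; case: s => [_|i s] si Ux; first exact: quad_loss_cvg.
have s3 : (size (i :: s) <= 3)%N by exact: ltnW.
apply: (cvg_trans (G := (fun N => pD (i :: s) (quad_loss N gam) x) @ \oo)) => //.
rewrite /loss_limit (_ : (fun N => _) = (fun N => 2^-1 *
   \sum_(0 <= j < N) \sum_(0 <= l < N) gam j l * pD (i :: s) (fun y => b j y * b l y) x)).
  apply: is_cvgMr; exact: square_sum_cvg al01 (B0 A0) (term_le A0 gA s3 Ux).
by apply/funext => N; rewrite pD_quad_loss.
Qed.

Lemma pD_quad_loss_dist s x N A : 0 <= A -> (forall j l, `|gam j l| <= A) ->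
  (size s <= 2)%N -> U x ->
  `|pD s (quad_loss N gam) x - loss_limit s x| <= square_sum_const (A * (8 * c ^+ 2)) al * al ^+ N.
Proof.
move=> A0 gA s2 Ux; have s3 : (size s <= 3)%N by exact: leq_trans s2 _.
have cv := pD_quad_loss_cvg s2 Ux.
have cv2 : (fun N => \sum_(0 <= j < N) \sum_(0 <= l < N) gam j l * pD s (fun y => b j y * b l y) x)
   @ \oo --> 2 * loss_limit s x.
  rewrite (_ : (fun N => _) = (fun N => 2 * pD s (quad_loss N gam) x)); first exact: cvgMr.
  by apply/funext => n; rewrite pD_quad_loss// mulrA divff// mul1r.
have := square_sum_dist al01 (B0 A0) (term_le A0 gA s3 Ux) N cv2.
rewrite distrC pD_quad_loss//; move: (\sum_(0 <= j < N) _) (loss_limit s x) => u v.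
have -> : 2^-1 * u - v = 2^-1 * (u - 2 * v) by field.
rewrite normrM ger0_norm ?invr_ge0// distrC => h; have := normr_ge0 (2 * v - u); move: h.
by rewrite distrC; move: (`|_|) (_ * al ^+ N) => z1 z2; lra.
Qed.

Let smooth_eps n w : smooth U 3 (fun th => eps b y n th w).
Proof.
apply: (smooth_eq oU (f := fun th => \sum_(0 <= j < n) y (n%:Z - j%:Z) w * b j th)).
  by move=> x _; apply: eq_bigr => j _; rewrite mulrC.
by apply: (smooth_sum oU) => j; exact: (smooth_scale oU).
Qed.

Lemma quad_loss_sample_cov N w th : quad_loss N (fun j l => sample_cov X a N j l w) th =
  (2^-1 * N%:R^-1) * \sum_(1 <= n < N.+1) eps b y n th w * eps b y n th w.
Proof.
rewrite /quad_loss -mulrA; congr (_ * _); rewrite mulr_sumr.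
under [LHS]eq_bigr do under eq_bigr do rewrite /sample_cov big_mkcond/= -mulrA mulr_suml mulr_sumr.
under [LHS]eq_bigr do rewrite exchange_big/=.
rewrite exchange_big/= big_nat [RHS]big_nat; apply: eq_bigr => n /andP[_ nN].
rewrite /eps (big_nat_widen 0 n N)// mulr_suml mulr_sumr [RHS]big_mkcond.
apply: eq_bigr => j _; case jn: (j < n)%N => /=; last first.
  by rewrite big1// => l _; rewrite mul0r mulr0.
rewrite mulr_sumr mulr_sumr [RHS]big_mkcond; apply: eq_bigr => l _.
by case: ifP => ln; [ring|rewrite mul0r mulr0].
Qed.

Lemma grad_quad_loss N w th : U th ->
  grad (quad_loss N (fun j l => sample_cov X a N j l w)) th = N%:R^-1 *: pe_score b y N th w.
Proof.
move=> Uth; apply/rowP => i; rewrite !mxE.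
rewrite (_ : quad_loss _ _ = (fun th => (2^-1 * N%:R^-1) *
   \sum_(n <- index_iota 1 N.+1) eps b y n th w * eps b y n th w)); last first.
  by apply/funext => z; rewrite quad_loss_sample_cov.
have s2 n : smooth U 3 (fun th => eps b y n th w * eps b y n th w) by apply: (smooth_mul oU).
have e1 := pD_scale oU (2^-1 * N%:R^-1) (smooth_sum oU (r := index_iota 1 N.+1) s2) (s := [:: i]) isT Uth.
have e2 := pD_sum oU (index_iota 1 N.+1) s2 (s := [:: i]) isT Uth.
rewrite /= in e1 e2; rewrite e1 e2.
rewrite [2^-1 * _]mulrC -mulrA; congr (_ * _); rewrite mulrC.
rewrite /pe_score summxE mulr_suml; apply: eq_bigr => n _.
have := pD_mul oU (@smooth_eps n w) (@smooth_eps n w) (s := [:: i]) isT Uth.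
rewrite /= => ->; rewrite big_cons big_seq1 /= !mxE; move: (eps _ _ _ _ _) (pderiv _ _ _) => u v.
by field.
Qed.

Variables (D : set 'rV[R]_p) (x0 : 'rV[R]_p) (rho : R).
Hypothesis cD : compact D.
Hypothesis DU : D `<=` U.
Hypothesis rho0 : 0 < rho.
Hypothesis BD : forall x, `|x - x0| <= rho -> D x.
Hypothesis grad0 : forall x, D x -> (grad (WP P b y) x = 0 <-> x = x0).
Hypothesis hess_unit : hess (WP P b y) x0 \in unitmx.

(** The sample criterion is compared with the population loss truncated at lag [N]; the truncation
    accounts for the term [al ^+ N]. *)
Lemma pe_estimate : exists2 dl, 0 < dl & exists2 C, 0 <= C & forall N w, (0 < N)%N ->
  cov_error P X beta a N w + al ^+ N <= dl ->
  (exists x, D x /\ pe_score b y N x w = 0) /\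
  forall x, D x -> pe_score b y N x w = 0 ->
    `|x - x0| <= C * (cov_error P X beta a N w + al ^+ N).
Proof.
have [A A0 gA] := gamB.
pose M := square_sum_const (A * (8 * c ^+ 2)) al.
have M0 : 0 <= M := square_sum_const_ge0 al01 (B0 A0).
have fle N s (s3 : (size s <= 3)%N) x (Ux : U x) : `|pD s (quad_loss N gam) x| <= M :=
  pD_quad_loss_le N A0 gA s3 Ux.
have sm N : smooth U 3 (quad_loss N gam) := @smooth_quad_loss N gam.
have cvg2 s (s2 : (size s <= 2)%N) x (Ux : U x) := pD_quad_loss_cvg s2 Ux.
have sW : smooth U 2 (WP P b y) := smooth_limit oU sm fle cvg2.
have WM s : size s = 2%N -> forall x, U x -> `|pD s (WP P b y) x| <= M.
  by move=> s2 x Ux; apply: (limit_le oU sm fle cvg2) => //; rewrite s2.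
have BU z : `|z - x0| <= rho -> U z by move/BD/DU.
have WL s : size s = 2%N -> forall x, `|x - x0| <= rho ->
    `|pD s (WP P b y) x - pD s (WP P b y) x0| <= p%:R * M * `|x - x0|.
  move=> s2 x xr; have s2' : (size s <= 2)%N by rewrite s2.
  have x00 : `|x0 - x0| <= rho by rewrite subrr normr0 ltW.
  exact: (limit_lipschitz oU sm fle cvg2 s2' BU xr x00).
have pM0 : 0 <= p%:R * M by rewrite mulr_ge0.
have [dl dl0 [C C0 HC]] := score_root oU cD DU rho0 M0 pM0 BD sW WM WL grad0 hess_unit.
pose k := 4 * c ^+ 2 + M + 1.
have c20 : 0 <= 4 * c ^+ 2 by rewrite mulr_ge0// sqr_ge0.
have k0 : 0 < k by rewrite /k ltr_wpDl// addr_ge0.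
exists (dl / k); first exact: divr_gt0.
exists (C * k) => [|N w N0 small]; first by rewrite mulr_ge0// ltW.
set E := cov_error _ _ _ _ _ _ in small *.
have E0 : 0 <= E.
  by apply: sumr_ge0 => j _; apply: sumr_ge0 => l _; rewrite mulr_ge0// exprn_ge0.
have a0 : 0 <= al ^+ N by exact: exprn_ge0.
have Ni : N%:R^-1 != 0 :> R by rewrite invr_eq0 pnatr_eq0 -lt0n.
have [||||[x [Dx gx]] all] := HC (quad_loss N (fun j l => sample_cov X a N j l w)) (k * (E + al ^+ N)).
- by move=> s s2 i x Ux; apply: smooth_quad_loss => //; exact: ltnW.
- exact: mulr_ge0 (ltW k0) (addr_ge0 E0 a0).
- by rewrite mulrC -ler_pdivlMr.
- move=> s /andP[_ s2] x Ux.
  rewrite (pD_limit oU sm fle cvg2 s2 Ux).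
  have h1 := pD_quad_lossB_le N (fun j l => sample_cov X a N j l w) gam (leq_trans s2 (leqnSn 2)) Ux.
  have h2 := pD_quad_loss_dist N A0 gA s2 Ux.
  apply: (le_trans (ler_distD (pD s (quad_loss N gam) x) _ _)).
  apply: (le_trans (lerD h1 h2)); rewrite -/M mulrDr lerD ?ler_wpM2r//.
    by rewrite /k -addrA lerDl addr_ge0.
  by rewrite /k addrAC lerDr addr_ge0.
split.
  exists x; split => //; move/eqP: gx; rewrite (grad_quad_loss _ _ (DU Dx)).
  by rewrite scaler_eq0 (negbTE Ni) => /eqP.
move=> z Dz sz; have [|h _] := all z Dz; last by rewrite -mulrA.
by rewrite (grad_quad_loss _ _ (DU Dz)) sz scaler0.
Qed.
End PredictionError.

(** * The ECF stage *)

Section EcfCriterion.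
Context {R : realType} {q : nat} {I : finType}.
Variables (F : I -> 'rV[R]_q -> R) (kap : I -> I -> R) (U : set 'rV[R]_q) (M : R).
Hypothesis oU : open U.
Hypothesis F_smooth : forall m, smooth U 3 (F m).
Hypothesis F_le : forall m s, (size s <= 3)%N -> forall x, U x -> `|pD s (F m) x| <= M.
Implicit Types (tau : I -> R) (x : 'rV[R]_q) (s : seq 'I_q).

(** The data enter through the vector [tau] alone. With [tau] equal to the values of [F] at the true
    parameter this is the limiting criterion, up to a constant. *)
Definition ecf_criterion tau x : R :=
  \sum_m \sum_l kap m l * ((F m x - tau m) * (F l x - tau l)).
Local Notation Psi := ecf_criterion.

Let smooth_shift m t : smooth U 3 (fun x => F m x - t).
Proof.
apply: (smooth_eq oU (f := fun x => 1 * F m x + (- t) * 1)); first by move=> x _; rewrite mul1r mulr1.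
by apply: (smooth_lin oU) => //; exact: smooth_cst.
Qed.

Let pD_shift m t s x : (size s <= 3)%N -> U x ->
  pD s (fun x => F m x - t) x = pD s (F m) x - (if s is [::] then t else 0).
Proof.
move=> s3 Ux; rewrite (pD_eq oU (g := fun x => 1 * F m x + (- t) * 1)) => [||//]; last first.
  by move=> z _; rewrite mul1r mulr1.
rewrite (pD_lin oU _ _ (@F_smooth m) (@smooth_cst _ _ U 3 1) s3 Ux) mul1r pD_cst.
by case: (s) => [|i l]; rewrite ?mulr1 ?mulr0 ?subr0 ?addr0.
Qed.

Let smooth_term tau m l : smooth U 3 (fun x => kap m l * ((F m x - tau m) * (F l x - tau l))).
Proof. by apply: (smooth_scale oU); apply: (smooth_mul oU). Qed.

Lemma smooth_ecf tau : smooth U 3 (Psi tau).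
Proof. by apply: (smooth_sum oU) => m; apply: (smooth_sum oU) => l. Qed.

Lemma pD_ecf tau s x : (size s <= 3)%N -> U x -> pD s (Psi tau) x =
  \sum_m \sum_l kap m l * pD s (fun x => (F m x - tau m) * (F l x - tau l)) x.
Proof.
move=> s3 Ux; have sm m : smooth U 3 (fun x => \sum_l kap m l * ((F m x - tau m) * (F l x - tau l))).
  by apply: (smooth_sum oU) => l; exact: smooth_term.
rewrite (pD_sum oU _ sm s3 Ux); apply: eq_bigr => m _.
rewrite (pD_sum oU _ (@smooth_term tau m) s3 Ux); apply: eq_bigr => l _.
by rewrite (pD_scale oU _ _ s3 Ux)//; exact: (smooth_mul oU).
Qed.

Definition kap_norm := \sum_m \sum_l `|kap m l|.

Lemma kap_norm_ge0 : 0 <= kap_norm.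
Proof. by apply: sumr_ge0 => m _; exact: sumr_ge0. Qed.

Lemma pD_ecf_le tau A s x : (forall m, `|tau m| <= A) -> (size s <= 3)%N -> U x ->
  `|pD s (Psi tau) x| <= kap_norm * (8 * ((M + A) * (M + A))).
Proof.
move=> tA s3 Ux; rewrite pD_ecf// /kap_norm mulr_suml.
apply: (le_trans (ler_norm_sum _ _ _)); apply: ler_sum => m _; rewrite mulr_suml.
apply: (le_trans (ler_norm_sum _ _ _)); apply: ler_sum => l _.
rewrite normrM ler_wpM2l//.
have sh n s' : (size s' <= 3)%N -> `|pD s' (fun x => F n x - tau n) x| <= M + A.
  move=> s3'; rewrite pD_shift//; apply: (le_trans (ler_normB _ _)); rewrite lerD ?F_le//.
  by case: (s') => [//|i z]; rewrite normr0; apply: le_trans (tA n).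
apply: (le_trans (pD_mul_le oU (@smooth_shift m (tau m)) (@smooth_shift l (tau l)) Ux (sh m) (sh l) s3)).
by rewrite le_eqVlt; apply/orP; left; apply/eqP; ring.
Qed.

(** The part quadratic in [tau] is constant in [x] and disappears under differentiation; what
    remains is linear in [tau - tau'], whence a bound linear in [e]. *)
Lemma pD_ecfB_le tau tau' (e : R) s x : (forall m, `|tau m - tau' m| <= e) ->
  (0 < size s <= 3)%N -> U x ->
  `|pD s (Psi tau) x - pD s (Psi tau') x| <= kap_norm * (2 * M) * e.
Proof.
move=> te /andP[s0 s3] Ux.
pose dt m := tau m - tau' m.
pose Df m l x := dt m * F l x + dt l * F m x.
have sDf m l : smooth U 3 (Df m l) by exact: smooth_lin.
have sk m l : smooth U 3 (fun x => kap m l * Df m l x) by exact: smooth_scale.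
pose Df1 x := \sum_m \sum_l kap m l * Df m l x.
have sDf0 m : smooth U 3 (fun x => \sum_l kap m l * Df m l x) by apply: (smooth_sum oU) => l.
have sDf1 : smooth U 3 Df1 by apply: (smooth_sum oU) => m.
pose c0 := \sum_m \sum_l kap m l * (tau m * tau l - tau' m * tau' l).
have E z : Psi tau z = 1 * (1 * Psi tau' z + (-1) * Df1 z) + c0 * 1.
  rewrite /ecf_criterion /Df1 /c0 !mul1r mulN1r mulr1 -sumrN -!big_split/=.
  apply: eq_bigr => m _; rewrite -sumrN -!big_split/=; apply: eq_bigr => l _.
  by rewrite /Df /dt; ring.
rewrite (pD_eq oU (fun z _ => E z)); last exact: Ux.
have s1 := @smooth_cst _ _ U 3 1.
have sl : smooth U 3 (fun x => 1 * Psi tau' x + (-1) * Df1 x).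
  by apply: (smooth_lin oU); [exact: smooth_ecf|exact: sDf1].
rewrite (pD_lin oU 1 c0 sl s1 s3 Ux) (pD_lin oU 1 (-1) (@smooth_ecf tau') sDf1 s3 Ux) pD_cst.
have -> : (if s is [::] then 1 else 0) = 0 :> R by case: (s) s0.
rewrite mulr0 addr0 !mul1r mulN1r addrAC subrr add0r normrN.
rewrite (pD_sum oU _ sDf0 s3 Ux) /kap_norm -mulrA mulr_suml.
apply: (le_trans (ler_norm_sum _ _ _)); apply: ler_sum => m _.
rewrite (pD_sum oU _ (@sk m) s3 Ux) mulr_suml.
apply: (le_trans (ler_norm_sum _ _ _)); apply: ler_sum => l _.
rewrite (pD_scale oU _ (@sDf m l) s3 Ux) normrM ler_wpM2l//.
rewrite (pD_lin oU _ _ (@F_smooth l) (@F_smooth m) s3 Ux).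
apply: (le_trans (ler_normD _ _)).
rewrite (_ : 2 * M * e = e * M + e * M); last by ring.
by rewrite !normrM; apply: lerD; apply: ler_pM => //; first [exact: te|exact: F_le].
Qed.

(** At the point where the residuals vanish the second derivatives of [F] drop out, and the
    remaining products of first derivatives are visibly symmetric. Symmetry reconciles row vectors,
    used for gradients here, with the column form of the theorem. *)
Lemma hess_ecf_sym x : U x -> let W := Psi (fun m => F m x) in (hess W x)^T = hess W x.
Proof.
move=> Ux W; apply/matrixP => i j; rewrite !mxE.
have E i' j' : pderiv (pderiv W i') j' x =
   \sum_m \sum_l kap m l * (pderiv (F m) i' x * pderiv (F l) j' x + pderiv (F m) j' x * pderiv (F l) i' x).
  have := pD_ecf (fun m => F m x) (s := [:: j'; i']) isT Ux; rewrite /= => ->.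
  apply: eq_bigr => m _; apply: eq_bigr => l _; congr (_ * _).
  have := pD_mul oU (@smooth_shift m (F m x)) (@smooth_shift l (F l x)) (s := [:: j'; i']) isT Ux.
  rewrite /= => ->; rewrite /= !big_cons big_nil /=.
  have e0 n : (fun z => F n z - F n x) x = 0 by rewrite subrr.
  have e1 n k := pD_shift n (F n x) (s := [:: k]) isT Ux.
  rewrite /= in e1; rewrite !e1 !subrr !subr0 mul0r mulr0 add0r !addr0.
  exact: addrC.
rewrite (E i j) (E j i); apply: eq_bigr => m _; apply: eq_bigr => l _; congr (_ * _).
exact: addrC.
Qed.

Variables (D : set 'rV[R]_q) (x0 : 'rV[R]_q) (rho : R).
Hypothesis M0 : 0 <= M.
Hypothesis cD : compact D.
Hypothesis DU : D `<=` U.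
Hypothesis rho0 : 0 < rho.
Hypothesis BD : forall x, `|x - x0| <= rho -> D x.
Local Notation W := (Psi (fun m => F m x0)).
Hypothesis grad0 : forall x, D x -> (grad W x = 0 <-> x = x0).
Hypothesis hess_unit : hess W x0 \in unitmx.

Lemma ecf_estimate : exists2 C, 0 <= C & forall tau (e : R), (forall m, `|tau m| <= 1) ->
  0 <= e -> (forall m, `|tau m - F m x0| <= e) ->
  forall x, D x -> ((exists z, D z /\ grad (Psi tau) z = 0) -> grad (Psi tau) x = 0) ->
  `|x - x0 + grad (Psi tau) x0 *m invmx (hess W x0)| <= C * e ^+ 2.
Proof.
have Dx0 : D x0 by apply: BD; rewrite subrr normr0 ltW.
have Ux0 := DU Dx0.
have F0 m : `|F m x0| <= M := @F_le m [::] isT x0 Ux0.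
pose B := kap_norm * (8 * ((M + M) * (M + M))).
have B0 : 0 <= B by rewrite mulr_ge0 ?kap_norm_ge0// !mulr_ge0// addr_ge0.
have WB s (s3 : (size s <= 3)%N) x (Ux : U x) : `|pD s W x| <= B := pD_ecf_le F0 s3 Ux.
have sW := @smooth_ecf (fun m => F m x0).
have sW2 : smooth U 2 W by move=> s s2; apply: sW; exact: ltnW.
have cv s (s2 : (size s <= 2)%N) x (Ux : U x) :
    (fun N : nat => pD s W x) @ \oo --> pD s W x by exact: cvg_cst.
have BU z : `|z - x0| <= rho -> U z by move/BD/DU.
have WL s : size s = 2%N -> forall x, `|x - x0| <= rho ->
    `|pD s W x - pD s W x0| <= q%:R * B * `|x - x0|.
  move=> s2 x xr; have s2' : (size s <= 2)%N by rewrite s2.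
  have x00 : `|x0 - x0| <= rho by rewrite subrr normr0 ltW.
  exact: (limit_lipschitz (f := fun=> W) oU (fun=> sW) (fun=> WB) cv s2' BU xr x00).
have qB0 : 0 <= q%:R * B by rewrite mulr_ge0.
have WM s : size s = 2%N -> forall x, U x -> `|pD s W x| <= B.
  by move=> s2 x Ux; apply: WB => //; rewrite s2.
have [dl dl0 [C C0 HC]] := score_root oU cD DU rho0 B0 qB0 BD sW2 WM WL grad0 hess_unit.
pose k := kap_norm * (2 * M) + 1.
have k0 : 0 < k by rewrite /k ltr_wpDl// mulr_ge0 ?kap_norm_ge0// mulr_ge0.
have [A [_ HA]] := compact_bounded cD.
pose D0 := `|A| + 1.
have HD x : D x -> `|x| <= D0.
  move=> Dx; apply: (HA D0 _ x Dx).
  by rewrite /D0; apply: (le_lt_trans (ler_norm A)); rewrite ltrDl.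
pose G0 := kap_norm * (8 * ((M + 1) * (M + 1))).
have G00 : 0 <= G0 by rewrite mulr_ge0 ?kap_norm_ge0// !mulr_ge0// addr_ge0.
pose H0 := \sum_i \sum_j `|invmx (hess W x0) i j|.
have H00 : 0 <= H0 by apply: sumr_ge0 => i _; exact: sumr_ge0.
(* The bound used when [e] is large: twice the radius of the domain, plus the Newton step at [x0],
   bounded because [|tau m| <= 1]. *)
pose B1 := D0 + D0 + H0 * G0.
have B10 : 0 <= B1 by rewrite !addr_ge0// mulr_ge0.
pose dk := dl / k; have dk0 : 0 < dk by exact: divr_gt0.
exists (C * k ^+ 2 + B1 / dk ^+ 2).
  by apply: addr_ge0; [rewrite mulr_ge0// sqr_ge0|rewrite divr_ge0// sqr_ge0].
move=> tau e t1 e0 te x Dx sol.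
have e20 : 0 <= e ^+ 2 by exact: sqr_ge0.
rewrite mulrDl; have [edl|edl] := leP e dk.
  have sV : smooth U 2 (Psi tau) by move=> s s2; apply: smooth_ecf; exact: ltnW.
  have [|||ex all] := HC _ (k * e) sV.
  - by rewrite mulr_ge0// ltW.
  - by rewrite mulrC -ler_pdivlMr.
  - move=> s /andP[s0 s2] z Uz.
    have s3 : (0 < size s <= 3)%N by rewrite s0 (leq_trans s2).
    by apply: (le_trans (pD_ecfB_le te s3 Uz)); rewrite ler_wpM2r// lerDl.
  have [_] := all x Dx (sol ex); rewrite exprMn mulrA => h; apply: (le_trans h).
  by rewrite lerDl mulr_ge0// divr_ge0// sqr_ge0.
apply: (@le_trans _ _ B1).
  apply: (le_trans (ler_normD _ _)); rewrite lerD//.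
    by apply: (le_trans (ler_normB _ _)); rewrite lerD// HD.
  apply: (le_trans (mulmx_row_le _ _)); rewrite ler_wpM2l//.
  apply: rv_norm_le => // i; rewrite mxE.
  exact: (pD_ecf_le t1 (s := [:: i]) isT Ux0).
apply: (@le_trans _ _ (B1 / dk ^+ 2 * e ^+ 2)); last by rewrite lerDr mulr_ge0// mulr_ge0// sqr_ge0.
rewrite mulrAC -mulrA ler_peMr// ler_pdivlMr ?exprn_gt0// mul1r.
by rewrite lerXn2r ?nnegrE ?(ltW dk0)// ltW.
Qed.
End EcfCriterion.

Section CompactBounds.
Context {R : realType} {q : nat}.

Lemma compact_ball0 (rho : R) : compact [set v : 'rV[R]_q | `|v| <= rho].
Proof.
apply: bounded_closed_compact.
  by exists rho; split; [exact: num_real|move=> M HM x xr; apply: ltW; exact: le_lt_trans HM].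
rewrite (_ : [set v | _] = closed_ball_ Num.norm (0 : 'rV[R]_q) rho); first exact: closed_closed_ball_.
by apply/seteqP; split => x; rewrite /closed_ball_ /= sub0r normrN.
Qed.

(** Uniform bounds are available on compact sets, whereas differentiation takes place on open ones;
    the open set is therefore placed between the domain and a larger compact set. *)
Lemma compact_thicken (D G : set 'rV[R]_q) : compact D -> open G -> D `<=` G ->
  exists C U : set 'rV[R]_q, [/\ compact C, open U, C `<=` G, D `<=` U & U `<=` C].
Proof.
move=> cD oG DG.
have [rho rho0 Hrho] : exists2 rho : R, 0 < rho & forall x y, D x -> `|y - x| <= rho -> G y.
  apply: contrapT => H.
  have {}H n : exists x, D x /\ exists2 y, `|y - x| <= n.+1%:R^-1 & ~ G y.
    apply: contrapT => Hn; apply: H; exists n.+1%:R^-1; first by rewrite invr_gt0.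
    move=> x y Dx yx; apply: contrapT => Gy; apply: Hn; exists x; split => //.
    by exists y.
  have [u Hu] := choice H.
  have [x Dx clx] := compact_cluster_seq cD (fun n => (Hu n).1).
  have [e e0 eG] := open_segment oG (DG x Dx).
  have e20 : 0 < e / 2 by rewrite divr_gt0.
  have [N _ HN] : \forall n \near \oo, n.+1%:R^-1 <= e / 2 :> R.
    have := @cvg_harmonic R => /cvgrPdist_le /(_ _ e20); apply: filterS => n.
    by rewrite sub0r normrN ger0_norm ?invr_ge0.
  have [n Nn xn] := clx _ e20 N; have [_ [y yn Gy]] := Hu n; apply: Gy; apply: eG.
  apply: (le_trans (ler_distD (u n) _ _)).
  have := HN n Nn; move: xn yn; move: (n.+1%:R^-1) => z; lra.
pose C := [set xv.1 + xv.2 | xv in D `*` [set v : 'rV[R]_q | `|v| <= rho]].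
exists C, C^°; split.
- apply: continuous_compact; last by apply: compact_setX => //; exact: compact_ball0.
  by apply: continuous_subspaceT => z; exact: add_continuous.
- exact: open_interior.
- move=> _ [[x v] /= [Dx vr] <-]; apply: (Hrho x) => //.
  by rewrite addrAC subrr add0r.
- move=> x Dx; rewrite /interior -nbhs_ballE; exists rho => //= y.
  rewrite -ball_normE /ball_/= distrC => /ltW yx; exists (x, y - x) => //=.
  by rewrite addrC subrK.
- exact: interior_subset.
Qed.

Lemma compact_pD_bound (I : finType) (F : I -> 'rV[R]_q -> R) (C G : set 'rV[R]_q) k :
  compact C -> C `<=` G -> (forall m, Ck k G (F m)) ->
  exists2 M, 0 <= M & forall m s x, (size s <= k)%N -> C x -> `|pD s (F m) x| <= M.
Proof.
move=> cC CG CkF.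
have B (ms : I * seq 'I_q) : exists M, 0 <= M /\
    ((size ms.2 <= k)%N -> forall x, C x -> `|pD ms.2 (F ms.1) x| <= M).
  case: ms => m s /=; have [sk|sk] := leqP (size s) k; last by exists 0.
  have cI : compact [set pD s (F m) x | x in C].
    apply: continuous_compact => //; apply: continuous_in_subspaceT => x; rewrite inE => Cx.
    by have [c _] := CkF m; exact: c (CG x Cx).
  have [A [_ HA]] := compact_bounded cI.
  exists (`|A| + 1); split => [|_ x Cx]; first by rewrite addr_ge0.
  apply: (HA (`|A| + 1)); first by apply: (le_lt_trans (ler_norm A)); rewrite ltrDl.
  by exists x.
have [b Hb] := choice B.
have b0 ms : 0 <= b ms by have [] := Hb ms.
(* A finite sum over all lists of at most [k] indices, in place of a maximum. *)
pose M := \sum_(m : I) \sum_(n < k.+1) \sum_(t : n.-tuple 'I_q) b (m, val t).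
exists M; first by do 3!apply: sumr_ge0 => ? _.
move=> m s x sk Cx; have [_ /(_ sk x Cx)/=] := Hb (m, s).
move/le_trans; apply; rewrite /M (bigD1 m)//= ler_wpDr//.
  by do 3!apply: sumr_ge0 => ? _.
have sk' : (size s < k.+1)%N by [].
rewrite (bigD1 (Ordinal sk'))//= ler_wpDr//; first by do 2!apply: sumr_ge0 => ? _.
by rewrite (bigD1 (in_tuple s))//= lerDl sumr_ge0.
Qed.
End CompactBounds.

Section EcfModel.
Context {R : realType} {q k : nat}.
Variables (u : 'I_k -> R) (K : 'M[R]_k) (phi : R -> 'rV[R]_q -> R[i]).
Local Notation I := ('I_k * bool)%type.

Definition trig (m : I) (e : R) : R := if m.2 then cos (u m.1 * e) else sin (u m.1 * e).
Definition cf_part (m : I) (eta : 'rV[R]_q) : R :=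
  if m.2 then complex.Re (phi (u m.1) eta) else complex.Im (phi (u m.1) eta).
(** The Hermitian form of the real matrix [invmx K], in real coordinates: its real part couples real
    parts with real parts and imaginary parts with imaginary parts. *)
Definition cf_weight (m l : I) : R := if m.2 == l.2 then invmx K m.1 l.1 else 0.
Local Notation Psi := (ecf_criterion cf_part cf_weight).

Lemma trig_le1 m e : `|trig m e| <= 1.
Proof. by rewrite /trig; case: ifP => _; [exact: cos_max|exact: sin_max]. Qed.

Lemma measurable_trig m : measurable_fun setT (trig m).
Proof.
have ml : measurable_fun setT (fun x => u m.1 * x) by exact: mulrl_measurable.
rewrite /trig; case: m.2.
  apply: (@measurableT_comp _ _ _ _ _ _ (@cos R) _ _ _ ml).
  by apply: continuous_measurable_fun; exact: continuous_cos.
apply: (@measurableT_comp _ _ _ _ _ _ (@sin R) _ _ _ ml).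
by apply: continuous_measurable_fun; exact: continuous_sin.
Qed.

Let Re_sum (J : Type) (r : seq J) (f : J -> R[i]) :
  complex.Re (\sum_(j <- r) f j) = \sum_(j <- r) complex.Re (f j).
Proof. by apply: (big_morph (@complex.Re R)) => //= -[a b] [c d]. Qed.

Lemma quadK_ecf e eta : quadK K (fun j => hfun phi (u j) e eta) = Psi (trig ^~ e) eta.
Proof.
rewrite /quadK Re_sum /ecf_criterion.
rewrite -(pair_bigA _ (fun j x => \sum_l cf_weight (j, x) l *
  ((cf_part (j, x) eta - trig (j, x) e) * (cf_part l eta - trig l e))))/=.
apply: eq_bigr => j _; rewrite big_bool/= Re_sum.
rewrite -!(pair_bigA _ (fun l x => cf_weight _ (l, x) *
  ((cf_part _ eta - trig _ e) * (cf_part (l, x) eta - trig (l, x) e))))/= -big_split/=.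
apply: eq_bigr => l _; rewrite !big_bool/= /cf_weight /cf_part /trig /hfun /eit /=.
by case: (phi (u j) eta) => f g; case: (phi (u l) eta) => f' g' /=; ring.
Qed.

(** A sum of quadratics with a common leading part is [N] times the quadratic at the mean, plus an
    empirical covariance term in which [eta] does not occur. *)
Lemma ecf_average (N : nat) (t : nat -> I -> R) (tau : I -> R) : (0 < N)%N ->
  (forall m, tau m = N%:R^-1 * \sum_(1 <= n < N.+1) t n m) ->
  exists c, forall eta, \sum_(1 <= n < N.+1) Psi (t n) eta = N%:R * Psi tau eta + c.
Proof.
move=> N0 tauE; exists (\sum_m \sum_l cf_weight m l *
  (\sum_(1 <= n < N.+1) t n m * t n l - N%:R * (tau m * tau l))) => eta.
have N1 : N%:R != 0 :> R by rewrite pnatr_eq0 -lt0n.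
have S m : \sum_(1 <= n < N.+1) t n m = N%:R * tau m by rewrite tauE mulVKf.
rewrite exchange_big mulr_sumr -big_split; apply: eq_bigr => m _ /=.
rewrite exchange_big mulr_sumr -big_split; apply: eq_bigr => l _ /=.
rewrite -mulr_sumr mulrCA -mulrDr; congr (_ * _).
under [LHS]eq_bigr do rewrite mulrBl !mulrBr.
rewrite !sumrB -!mulr_suml -!mulr_sumr !S big_const_nat subSS subn0 iter_addr_0 -mulr_natl.
by ring.
Qed.

Lemma VEN_ecf d (T : measurableType d) p (b : nat -> 'rV[R]_p -> R) (dy : int -> T -> R) N th w tau :
  (0 < N)%N ->
  (forall m, tau m = N%:R^-1 * \sum_(1 <= n < N.+1) trig m (eps b dy n th w)) ->
  exists c, forall eta, VEN u K phi b dy N th eta w = N%:R * Psi tau eta + c.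
Proof.
move=> N0 tauE; have [c H] := ecf_average N0 tauE; exists c => eta; rewrite -H.
by apply: eq_bigr => n _; exact: quadK_ecf.
Qed.

(** The population counterpart: the discarded constant is the weighted covariance of the
    trigonometric variables. *)
Lemma WE_ecf d (T : measurableType d) (P : probability T R) p (b : nat -> 'rV[R]_p -> R)
    (dy : int -> T -> R) th0 eta0 (X0 : T -> R) (N0 : set T) :
  measurable_fun setT X0 -> measurable N0 -> P N0 = 0%E ->
  (forall w, ~ N0 w -> eps_star b dy 0 th0 w = X0 w) ->
  (forall m, \int[P]_w trig m (X0 w) = cf_part m eta0) ->
  exists c, forall eta, WE P u K phi b dy th0 eta = Psi (fun m => cf_part m eta0) eta + c.
Proof.
move=> mX mN PN0 epsX tX.
have mt m : measurable_fun setT (fun w => trig m (X0 w)).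
  by apply: (@measurableT_comp _ _ _ _ _ _ (trig m)) => //; exact: measurable_trig.
have bi (f : T -> R) (B : R) : measurable_fun setT f -> (forall w, `|f w| <= B) ->
    P.-integrable setT (EFin \o f).
  move=> mf fB; apply: (Lb_integrable (K := `|B|) (lexx 1)).
  apply: (Lb_mono (g := fun=> B)) => //; last exact: Lb_cst.
  by move=> w; apply: (le_trans (fB w)); exact: ler_norm.
have it m : P.-integrable setT (EFin \o (fun w => trig m (X0 w))).
  by apply: (bi _ 1) => // w; exact: trig_le1.
have itt m l : P.-integrable setT (EFin \o (fun w => trig m (X0 w) * trig l (X0 w))).
  apply: (bi _ 1); first exact: measurable_funM.
  by move=> w; rewrite normrM mulr_ile1// trig_le1.
exists (\sum_m \sum_l cf_weight m l *
  (\int[P]_w (trig m (X0 w) * trig l (X0 w)) - cf_part m eta0 * cf_part l eta0)) => eta.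
have ic (x : R) : P.-integrable setT (EFin \o (fun=> x)).
  exact: (finite_measure_integrable_cst P x measurableT).
have intc (x : R) : \int[P]_w x = x.
  by rewrite /Rintegral integral_cst// [X in (_ * X)%E]probability_setT mule1.
have iE (f g : T -> R) : P.-integrable setT (EFin \o f) -> f =1 g -> P.-integrable setT (EFin \o g).
  by move=> h fg; rewrite (_ : g = f)//; apply/funext => w; rewrite fg.
have iterm m l : P.-integrable setT (EFin \o (fun w => cf_weight m l *
    ((cf_part m eta - trig m (X0 w)) * (cf_part l eta - trig l (X0 w))))).
  apply: (bi _ (`|cf_weight m l| * ((`|cf_part m eta| + 1) * (`|cf_part l eta| + 1)))).
    by apply: measurable_funM => //; apply: measurable_funM; apply: measurable_funB.
  move=> w; rewrite !normrM ler_wpM2l// ler_pM//; apply: (le_trans (ler_normB _ _)).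
    by rewrite lerD2l trig_le1.
  by rewrite lerD2l trig_le1.
have isum m : P.-integrable setT (EFin \o (fun w => \sum_l cf_weight m l *
    ((cf_part m eta - trig m (X0 w)) * (cf_part l eta - trig l (X0 w))))).
  have := integrable_sum measurableT (index_enum I) (P := xpredT) (fun l _ => iterm m l).
  by apply: eq_integrable => // w _; rewrite /= sumEFin.
transitivity (\int[P]_w Psi (trig ^~ (X0 w)) eta).
  rewrite /WE unlock /Rintegral; congr fine; apply: (ae_eq_integral_nm mN PN0) => w Nw.
  by rewrite epsX// quadK_ecf.
rewrite [LHS](@Rintegral_sum _ _ _ P _ (index_enum I) (fun m w => \sum_l cf_weight m l *
    ((cf_part m eta - trig m (X0 w)) * (cf_part l eta - trig l (X0 w)))))//.
rewrite -big_split; apply: eq_bigr => m _ /=.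
rewrite Rintegral_sum// -big_split; apply: eq_bigr => l _ /=.
have i1 : P.-integrable setT (EFin \o (fun w => trig m (X0 w) * cf_part l eta)).
  by apply: (iE _ _ (integrableZl measurableT (cf_part l eta) (it m))) => w; rewrite mulrC.
have i2 : P.-integrable setT (EFin \o (fun w => cf_part m eta * trig l (X0 w))).
  exact: (integrableZl measurableT (cf_part m eta) (it l)).
have i3 : P.-integrable setT (EFin \o (fun w => cf_part m eta * cf_part l eta - cf_part m eta * trig l (X0 w))).
  exact: (integrableB measurableT (ic _) i2).
have i4 : P.-integrable setT (EFin \o (fun w => trig m (X0 w) * cf_part l eta - trig m (X0 w) * trig l (X0 w))).
  exact: (integrableB measurableT i1 (itt m l)).
have i5 : P.-integrable setT (EFin \o (fun w => (cf_part m eta - trig m (X0 w)) * (cf_part l eta - trig l (X0 w)))).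
  by apply: (iE _ _ (integrableB measurableT i3 i4)) => w /=; ring.
rewrite RintegralZl// -mulrDr; congr (_ * _).
transitivity (\int[P]_w ((cf_part m eta * cf_part l eta - cf_part m eta * trig l (X0 w)) -
   (trig m (X0 w) * cf_part l eta - trig m (X0 w) * trig l (X0 w)))).
  by apply: eq_Rintegral => w _; ring.
rewrite RintegralB// RintegralB// [X in _ - X]RintegralB// intc RintegralZl// tX.
rewrite (_ : \int[P]_w (trig m (X0 w) * cf_part l eta) = cf_part m eta0 * cf_part l eta).
  by ring.
by rewrite -tX mulrC -RintegralZl//; apply: eq_Rintegral => w _; rewrite mulrC.
Qed.
End EcfModel.

(** * From the prediction error estimate to the innovations *)

Section InnovationError.
Context d {T : measurableType d} {R : realType} (P : probability T R) {p : nat}.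
Variables (X : int -> T -> R) (beta c : R) (a : nat -> R).
Hypothesis iidX : iid P X.
Hypothesis beta01 : 0 < beta < 1.
Hypothesis sumX : forall n w, exists B, forall M,
  \sum_(0 <= j < M) beta ^+ j * `|X (n - j%:Z) w| <= B.
Hypothesis c0 : 0 <= c.
Hypothesis a_le : forall j, `|a j| <= c * (beta ^+ 2) ^+ j.
Variables (r K : R).
Hypothesis r2 : 2 <= r.
Hypothesis LX : Lb P (2 * r) K (X 0).
Local Notation y := (filtered X a).
Local Notation al := (beta ^+ 2).
Variables (U : set 'rV[R]_p) (b : nat -> 'rV[R]_p -> R).
Hypothesis oU : open U.
Hypothesis b_smooth : forall j, smooth U 3 (b j).
Hypothesis b_le : forall s j x, (size s <= 3)%N -> U x -> `|pD s (b j) x| <= c * al ^+ j.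
Variables (D : set 'rV[R]_p) (x0 : 'rV[R]_p) (rho : R).
Hypothesis cD : compact D.
Hypothesis DU : D `<=` U.
Hypothesis rho0 : 0 < rho.
Hypothesis BD : forall x, `|x - x0| <= rho -> D x.
Hypothesis grad0 : forall x, D x -> (grad (WP P b y) x = 0 <-> x = x0).
Hypothesis hess_unit : hess (WP P b y) x0 \in unitmx.
Hypothesis ab0 : a 0 * b 0 x0 = 1.
Hypothesis abj : forall j, (0 < j)%N -> \sum_(i < j.+1) a i * b (j - i)%N x0 = 0.

Definition pe_error N w := cov_error P X beta a N w + al ^+ N + transient X beta N w.

Let b01 : 0 <= beta < 1. Proof. by case/andP: beta01 => /ltW ->. Qed.

Let cov_error_ge0 N w : 0 <= cov_error P X beta a N w.
Proof.
by apply: sumr_ge0 => j _; apply: sumr_ge0 => l _; rewrite mulr_ge0// exprn_ge0// sqr_ge0.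
Qed.

Let transient_ge0 N w : 0 <= transient X beta N w.
Proof.
case/andP: b01 => b0 _; rewrite mulr_ge0 ?invr_ge0// sumr_ge0// => n _.
by rewrite mulr_ge0 ?(past_weight_ge0 beta01 sumX)// mulr_ge0// exprn_ge0.
Qed.

Lemma pe_error_ge0 N w : 0 <= pe_error N w.
Proof. by rewrite addr_ge0// addr_ge0// exprn_ge0// sqr_ge0. Qed.

(** The estimated innovation differs from the noise by a parameter part, Lipschitz in [th] through
    the coefficients of the inverse filter, and by the effect of the initial conditions at [x0].
    Averages of a Lipschitz function inherit both. *)
Lemma innovation_error : exists2 C, 0 <= C & forall N w th (t : R -> R) (L : R),
  (0 < N)%N -> 0 <= L -> (forall e, `|t e| <= 1) -> (forall e e', `|t e - t e'| <= L * `|e - e'|) ->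
  D th -> ((exists x, D x /\ pe_score b y N x w = 0) -> pe_score b y N th w = 0) ->
  `|N%:R^-1 * (\sum_(1 <= n < N.+1) t (eps b y n th w)) -
    N%:R^-1 * (\sum_(1 <= n < N.+1) t (X n%:Z w))| <= C * (1 + L) * pe_error N w.
Proof.
have [dl dl0 [C1 C10 HC]] := pe_estimate iidX beta01 sumX c0 a_le r2 LX oU b_smooth b_le
  cD DU rho0 BD grad0 hess_unit.
have [A A0 gA] := autocov_bounded iidX beta01 sumX c0 a_le r2 LX.
case/andP: (b01) => b0 b1.
have g0 : 0 <= (1 - beta)^-1 by rewrite invr_ge0 subr_ge0 ltW.
(* The second entry keeps [th] in the ball around [x0], where the coefficients are Lipschitz in the
   parameter. *)
pose dl' := Num.min dl (rho / (C1 + 1)).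
have C1p : 0 < C1 + 1 by rewrite ltr_wpDl.
have dl'0 : 0 < dl' by rewrite lt_min dl0 divr_gt0.
pose S := (1 - beta)^-1 * (1 + A + dl).
have S0 : 0 <= S by rewrite mulr_ge0// !addr_ge0// ltW.
pose B1 := p%:R * c * C1 * S.
have B10 : 0 <= B1 by rewrite /B1; do 3!apply: mulr_ge0 => //.
have B20 : 0 <= 2 / dl' by rewrite divr_ge0// ltW.
have c20 : 0 <= c ^+ 2 by exact: sqr_ge0.
exists (B1 + c ^+ 2 + 2 / dl'); first by rewrite !addr_ge0.
move=> N w th t L N0 L0 t1 tL Dth sol.
set E := cov_error P X beta a N w + al ^+ N; set Tr := transient X beta N w.
have E0 : 0 <= E by rewrite addr_ge0// exprn_ge0// sqr_ge0.
have Tr0 : 0 <= Tr by exact: transient_ge0.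
have Ni : 0 <= N%:R^-1 :> R by rewrite invr_ge0.
have NN : N%:R^-1 * N%:R = 1 :> R by rewrite mulVf// pnatr_eq0 -lt0n.
rewrite -mulrBr -sumrB normrM (ger0_norm Ni) /pe_error -/E -/Tr.
(* When the error exceeds [dl'], the bound [|t| <= 1] gives at most [2 <= (2 / dl') E]. *)
have [Edl|Edl] := leP E dl'; last first.
  apply: (@le_trans _ _ 2).
    apply: (@le_trans _ _ (N%:R^-1 * (\sum_(1 <= n < N.+1) 2))).
      rewrite ler_wpM2l//; apply: (le_trans (ler_norm_sum _ _ _)); apply: ler_sum => n _.
      by apply: (le_trans (ler_normB _ _)); rewrite -[2]/(1 + 1) lerD// t1.
    by rewrite big_const_nat subSS subn0 iter_addr_0 -[2 *+ N]mulr_natl mulrA NN mul1r.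
  apply: (@le_trans _ _ (2 / dl' * E)).
    by rewrite mulrAC ler_pdivlMr// ler_wpM2l// ltW.
  rewrite ler_pM//; last by rewrite lerDl.
  by rewrite -[leLHS]mulr1 ler_pM// ?lerDr ?addr_ge0// lerDl.
have dl'dl : dl' <= dl by rewrite ge_min lexx.
have [ex all] := HC N w N0 (le_trans Edl dl'dl).
have thx0 : `|th - x0| <= C1 * E := all th Dth (sol ex).
have thr : `|th - x0| <= rho.
  apply: (le_trans thx0); apply: (@le_trans _ _ ((C1 + 1) * (rho / (C1 + 1)))).
    by rewrite ler_pM ?lerDl//; apply: (le_trans Edl); rewrite ge_min lexx orbT.
  by rewrite mulrC divfK// lt0r_neq0.
have bL j : `|b j th - b j x0| <= p%:R * (c * al ^+ j) * `|th - x0|.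
  apply: (@pderiv_lipschitz _ _ (b j) x0 rho) => //; last by rewrite subrr normr0 ltW.
  move=> z zr i; have Uz := DU (BD zr); split; first exact: (@b_smooth j [::]).
  exact: (@b_le [:: i] j z isT Uz).
have al_le j : al ^+ j <= beta ^+ j.
  by rewrite exprAC expr2 ler_piMr ?exprn_ge0// exprn_ile1// ltW.
have b_le0 j : `|b j x0| <= c * al ^+ j.
  by apply: (@b_le [::]) => //; apply/DU/BD; rewrite subrr normr0 ltW.
have e1 n : `|eps b y n th w - eps b y n x0 w| <=
    p%:R * c * (C1 * E) * \sum_(0 <= j < n) beta ^+ j * `|y (n%:Z - j%:Z) w|.
  rewrite -sumrB mulr_sumr; apply: (le_trans (ler_norm_sum _ _ _)); apply: ler_sum => j _.
  rewrite -mulrBl normrM mulrA ler_wpM2r//; apply: (le_trans (bL j)).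
  rewrite (_ : p%:R * (c * al ^+ j) * `|th - x0| = p%:R * c * (`|th - x0| * al ^+ j)); last by ring.
  rewrite -[leRHS]mulrA; apply: ler_wpM2l; first by rewrite mulr_ge0.
  by apply: ler_pM => //; rewrite exprn_ge0// sqr_ge0.
have e2 n : (0 < n)%N -> `|eps b y n x0 w - X n%:Z w| <=
    c ^+ 2 * ((n%:R * beta ^+ n) * past_weight X beta n%:Z w).
  move=> n0; have := inverse_filter_le beta01 sumX c0 a_le b_le0 ab0 abj n%:Z w n0.
  by rewrite -mulrA.
have avg : N%:R^-1 * (\sum_(1 <= n < N.+1) `|eps b y n th w - X n%:Z w|) <= B1 * E + c ^+ 2 * Tr.
  apply: (@le_trans _ _ (N%:R^-1 * (\sum_(1 <= n < N.+1)
      (p%:R * c * (C1 * E) * (\sum_(0 <= j < n) beta ^+ j * `|y (n%:Z - j%:Z) w|) +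
       c ^+ 2 * ((n%:R * beta ^+ n) * past_weight X beta n%:Z w))))).
    rewrite ler_wpM2l// big_nat [leRHS]big_nat; apply: ler_sum => n /andP[n0 _].
    apply: (le_trans (ler_distD (eps b y n x0 w) _ _)); exact: lerD (e1 n) (e2 n n0).
  rewrite big_split/= -!mulr_sumr mulrDr lerD//; last first.
    by rewrite mulrCA.
  rewrite mulrCA (_ : B1 * E = p%:R * c * (C1 * E) * S); last by rewrite /B1; ring.
  rewrite ler_wpM2l ?mulr_ge0//.
  apply: (le_trans (innovation_average_le beta01 w gA N0)).
  rewrite /S ler_wpM2l// lerD2l; apply: (@le_trans _ _ E).
    by rewrite lerDl exprn_ge0// sqr_ge0.
  by apply: (le_trans Edl); rewrite ge_min lexx.
apply: (@le_trans _ _ (L * (B1 * E + c ^+ 2 * Tr))).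
  apply: (le_trans _ (ler_wpM2l L0 avg)); rewrite mulrCA ler_wpM2l// mulr_sumr.
  by apply: (le_trans (ler_norm_sum _ _ _)); apply: ler_sum => n _; exact: tL.
rewrite [leRHS](_ : _ = (1 + L) * ((B1 + c ^+ 2 + 2 / dl') * (E + Tr))); last by ring.
apply: ler_pM => //.
- by apply: addr_ge0; exact: mulr_ge0.
- by rewrite lerDr.
have -> : (B1 + c ^+ 2 + 2 / dl') * (E + Tr) =
    B1 * E + c ^+ 2 * Tr + (B1 * Tr + c ^+ 2 * E + 2 / dl' * (E + Tr)) by ring.
rewrite lerDl; apply: addr_ge0; first by apply: addr_ge0; exact: mulr_ge0.
by apply: mulr_ge0 => //; exact: addr_ge0.
Qed.

Hypothesis X_mean0 : \int[P]_w X 0 w = 0.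

Lemma Lb_pe_error : exists2 C, 0 <= C & forall N, (0 < N)%N ->
  Lb P r (C * (Num.sqrt N%:R)^-1) (pe_error N).
Proof.
have r1 : 1 <= r by apply: le_trans r2; rewrite ler1n.
have r0 : 0 <= r by exact: le_trans r1.
have [C1 C10 H1] := Lb_cov_error iidX beta01 sumX c0 a_le r2 LX X_mean0.
have [C2 C20 H2] := Lb_transient iidX beta01 sumX r2 LX.
have al01 : 0 <= al < 1 by case/andP: b01 => b0 b1; rewrite sqr_ge0 expr_lt1.
have g0 : 0 <= (1 - al)^-1 by case/andP: al01 => _ ?; rewrite invr_ge0 subr_ge0 ltW.
exists (C1 + (1 - al)^-1 + C2); first by rewrite !addr_ge0.
move=> N N0; have Np : 0 < N%:R :> R by rewrite ltr0n.
have s0 : 0 <= (Num.sqrt N%:R)^-1 :> R by rewrite invr_ge0 sqrtr_ge0.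
have Lal : Lb P r ((1 - al)^-1 * (Num.sqrt N%:R)^-1) (fun=> al ^+ N).
  apply: (Lb_le r0 _ (Lb_cst P (al ^+ N) r0)).
  rewrite ger0_norm; last by rewrite exprn_ge0// sqr_ge0.
  apply: (@le_trans _ _ ((1 - al)^-1 * N%:R^-1)).
    by rewrite ler_pdivlMr// mulrC mulrn_geo_le.
  by rewrite ler_wpM2l// invn_le_sqrt.
have := LbD r1 (LbD r1 (H1 N N0) Lal) (H2 N N0).
by rewrite -!mulrDl.
Qed.
End InnovationError.

(** * Transfer across a null set *)

Section AlmostSure.
Context d {T : measurableType d} {R : realType} (P : probability T R) (N0 : set T).
Hypothesis mN0 : measurable N0.
Hypothesis PN0 : P N0 = 0%E.

Lemma Lb_ae r K (f g : T -> R) : measurable_fun setT g -> (forall w, ~ N0 w -> g w = f w) ->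
  Lb P r K f -> Lb P r K g.
Proof.
move=> mg gf [K0 mf H]; split; [exact: K0|exact: mg|apply: le_trans H].
rewrite le_eqVlt; apply/orP; left; apply/eqP; apply: (ae_eq_integral_nm mN0 PN0) => w Nw.
by rewrite gf.
Qed.

Lemma Rintegral_ae (f g : T -> R) : (forall w, ~ N0 w -> g w = f w) ->
  \int[P]_w g w = \int[P]_w f w.
Proof.
by move=> gf; congr fine; apply: (ae_eq_integral_nm mN0 PN0) => w Nw; rewrite gf.
Qed.

(** Measurability is carried by the majorant [Y]; the function [f] is only compared with it outside
    the null set. *)
Lemma square_moment_ae (s A L : R) (f Y : T -> R) : 1 <= s -> 0 <= A -> Lb P (2 * s) L Y ->
  (forall w, 0 <= f w) -> (forall w, ~ N0 w -> f w <= A * Y w ^+ 2) ->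
  (\int[P]_w (f w `^ s)%:E <= ((A * L ^+ 2) `^ s)%:E)%E.
Proof.
move=> s1 A0 LY f0 fY; have s0 : 0 <= s by exact: le_trans s1.
have [_ _] := LbZ A s0 (Lb_sqr s0 LY); rewrite (ger0_norm A0); apply: le_trans.
apply: (ge0_ae_le_integral_nm mN0 PN0) => w.
- by rewrite lee_fin powR_ge0.
- by rewrite lee_fin powR_ge0.
move=> Nw; have AY0 : 0 <= A * Y w ^+ 2 by rewrite mulr_ge0// sqr_ge0.
rewrite lee_fin (ger0_norm AY0).
by apply: ge0_ler_powR; rewrite ?nnegrE//; exact: fY.
Qed.

Context {p : nat}.
Variables (b : nat -> 'rV[R]_p -> R) (dy dy' : int -> T -> R).
Hypothesis dyE : forall n w, ~ N0 w -> dy n w = dy' n w.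

Lemma WP_ae : WP P b dy = WP P b dy'.
Proof.
apply/funext => th; rewrite /WP unlock; congr (fine _ / 2).
apply: (ae_eq_integral_nm mN0 PN0) => w Nw; rewrite /eps_star; congr ((_ ^+ 2)%:E).
by congr rseries; apply/funext => j; rewrite dyE.
Qed.

Lemma eps_ae n th w : ~ N0 w -> eps b dy n th w = eps b dy' n th w.
Proof. by move=> Nw; apply: eq_bigr => j _; rewrite dyE. Qed.

Lemma pe_score_ae N th w : ~ N0 w -> pe_score b dy N th w = pe_score b dy' N th w.
Proof.
move=> Nw; apply: eq_bigr => n _; rewrite (eps_ae n th Nw).
by rewrite (funext (fun t => eps_ae n t Nw)).
Qed.
End AlmostSure.

Lemma ler_term_sum {R : numDomainType} {I : finType} (F : I -> R) i :
  (forall i, 0 <= F i) -> F i <= \sum_j F j.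
Proof. by move=> F0; rewrite (bigD1 i)//= lerDl sumr_ge0. Qed.

Lemma unit_derivative_lipschitz {R : realType} (f f' : R -> R) :
  (forall x, is_derive x (1 : R) f (f' x)) -> (forall x, `|f' x| <= 1) ->
  forall x y, `|f x - f y| <= `|x - y|.
Proof.
move=> df f1 x y; wlog yx : x y / y <= x.
  move=> H; have [/H//|/ltW xy] := leP y x.
  by rewrite distrC [leRHS]distrC; exact: H.
have xy0 : 0 <= x - y by rewrite subr_ge0.
have [t _] := MVT_direction (v := (1 : R)) xy0 (fun t _ => @ex_derive _ _ _ _ _ _ _ (df (y + t *: (1 : R)))).
rewrite -[(x - y) *: _]/((x - y) * 1) mulr1 [y + (x - y)]addrC subrK => ->.
rewrite (@derive_val _ _ _ _ _ _ _ (df _)) normrM ler_piMr//.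
Qed.

Lemma trig_lipschitz {R : realType} {k : nat} (u : 'I_k -> R) m e e' :
  `|trig u m e - trig u m e'| <= `|u m.1| * `|e - e'|.
Proof.
rewrite -normrM mulrBr /trig; case: m.2.
  apply: (unit_derivative_lipschitz (f' := fun x => - sin x)) => x.
  by rewrite normrN sin_max.
by apply: (unit_derivative_lipschitz (f' := cos)) => x; exact: cos_max.
Qed.

Section Affine.
Context {R : realType} {p : nat}.
Variable U : set 'rV[R]_p.
Hypothesis oU : open U.
Variables (f g : 'rV[R]_p -> R) (A c : R).
Hypothesis sf : smooth U 3 f.
Hypothesis gE : forall x, g x = A * f x + c.

Lemma pD_affine s x : (0 < size s <= 3)%N -> U x -> pD s g x = A * pD s f x.
Proof.
move=> /andP[s0 s3] Ux; rewrite (_ : g = fun x => A * f x + c * 1); last first.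
  by apply/funext => z; rewrite gE mulr1.
rewrite (pD_lin oU A c sf (@smooth_cst _ _ U 3 1) s3 Ux) pD_cst.
by case: s s0 {s3} => // i s _; rewrite mulr0 addr0.
Qed.

Lemma grad_affine x : U x -> grad g x = A *: grad f x.
Proof.
by move=> Ux; apply/rowP => i; rewrite !mxE; exact: (pD_affine (s := [:: i]) isT Ux).
Qed.

Lemma hess_affine x : U x -> hess g x = A *: hess f x.
Proof.
by move=> Ux; apply/matrixP => i j; rewrite !mxE; exact: (pD_affine (s := [:: i; j]) isT Ux).
Qed.
End Affine.

Lemma interior_prod_ball {R : realType} {p q : nat} (A : set 'rV[R]_p) (B : set 'rV[R]_q) x y :
  interior (A `*` B) (x, y) -> exists2 rho : R, 0 < rho &
    (forall z, `|z - x| <= rho -> A z) /\ (forall z, `|z - y| <= rho -> B z).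
Proof.
rewrite /interior -nbhs_ballE => -[e /= e0 eAB].
have ball_half (V : normedModType R) (v z : V) : `|z - v| <= e / 2 -> ball v e z.
  move=> ze; rewrite -ball_normE /ball_/= distrC; apply: (le_lt_trans ze).
  by rewrite ltr_pdivrMr// mulr_natr mulr2n ltrDl.
exists (e / 2); first by rewrite divr_gt0.
split=> z ze.
  have [//] : (A `*` B) (z, y) by apply: eAB; split => /=; [exact: ball_half|exact: ballxx].
have [//] : (A `*` B) (x, z) by apply: eAB; split => /=; [exact: ballxx|exact: ball_half].
Qed.

Lemma average_le1 {F : realFieldType} (f : nat -> F) N : (0 < N)%N ->
  (forall n, `|f n| <= 1) -> `|N%:R^-1 * \sum_(1 <= n < N.+1) f n| <= 1.
Proof.
move=> N0 f1; rewrite normrM ger0_norm ?invr_ge0// ler_pdivrMl ?ltr0n// mulr1.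
apply: (le_trans (ler_norm_sum _ _ _)); apply: (@le_trans _ _ (\sum_(1 <= n < N.+1) 1)).
  by apply: ler_sum => n _; exact: f1.
by rewrite big_const_nat subSS subn0 iter_addr_0.
Qed.

Lemma powR_sqrt_le {R : realType} (A B s : R) N : 0 <= A -> 0 <= s -> (0 < N)%N ->
  (A * (B * (Num.sqrt N%:R)^-1) ^+ 2) `^ s <= ((A * B ^+ 2 + 1) / N%:R) `^ s.
Proof.
move=> A0 s0 N0; have Np : 0 <= N%:R :> R by [].
have AB : 0 <= A * B ^+ 2 by rewrite mulr_ge0// sqr_ge0.
apply: ge0_ler_powR; rewrite ?nnegrE//.
- by rewrite mulr_ge0// sqr_ge0.
- by rewrite divr_ge0// addr_ge0.
by rewrite exprMn exprVn sqr_sqrtr// mulrA ler_wpM2r ?invr_ge0// lerDl.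
Qed.

(** * Assembly of the estimates *)

Theorem theorem5
  (R : realType) (d : measure_display) (T : measurableType d)
  (P : probability T R)
  (h : R) (Q p q k : nat)
  (* increments dZ_n = Z_{nh} - Z_{(n-1)h}, n in Z *)
  (dZ : int -> T -> R)
  (* Levy triplet parametrised by eta, and the characteristic function *)
  (drift s2 : 'rV[R]_q -> R) (nu : 'rV[R]_q -> {measure set R -> \bar R})
  (phi : R -> 'rV[R]_q -> R[i])
  (* impulse responses of A(theta) (a) and A^{-1}(theta) (b) *)
  (a b : nat -> 'rV[R]_p -> R)
  (Gth : set 'rV[R]_p) (Geta : set 'rV[R]_q)
  (th0 : 'rV[R]_p) (eta0 : 'rV[R]_q)
  (u : 'I_k -> R) (K : 'M[R]_k)
  (Dth : set 'rV[R]_p) (Deta : set 'rV[R]_q)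
  (Dstar : set ('rV[R]_p * 'rV[R]_q))
  (thhat : nat -> T -> 'rV[R]_p) (etahat : nat -> T -> 'rV[R]_q) :
  (* standing assumptions of the Setting *)
  0 < h -> (2 <= Q)%N -> (1 <= p)%N -> (1 <= q)%N -> (1 <= k)%N ->
  open Geta -> eta0 \in Geta ->
  (forall eta, Geta eta -> levy_measure (nu eta) /\ 0 <= s2 eta) ->
  (forall eta, Geta eta -> forall x, phi x eta = levy_increment_cf h (drift eta) (s2 eta) (nu eta) x) ->
  (forall x, Ck 3 Geta (fun eta => complex.Re (phi x eta)) /\
             Ck 3 Geta (fun eta => complex.Im (phi x eta))) ->
  iid P dZ ->
  (forall x, 'E_P[fun w => cos (x * dZ 0%:Z w)] = (complex.Re (phi x eta0))%:E /\
             'E_P[fun w => sin (x * dZ 0%:Z w)] = (complex.Im (phi x eta0))%:E)%E ->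
  P.-integrable setT (fun w => (dZ 0%:Z w)%:E) ->
  ('E_P[dZ 0%:Z] = 0)%E ->
  open Gth -> th0 \in Gth ->
  (forall th, Gth th -> a 0%N th = 1 /\ finite_dim_filter a th /\ inverse_filter a b th) ->
  (forall j, Ck 3 Gth (a j)) ->
  (* Condition 1 *)
  (forall r : R, 1 <= r -> r <= Q%:R ->
     (\int[nu eta0]_(x in [set x : R | (1 <= `|x|)%R]) ((`|x| `^ r)%R)%:E < +oo)%E) ->
  (* Condition 2 *)
  (forall C : set 'rV[R]_p, compact C -> C `<=` Gth ->
     exists c alpha : R, 0 < c /\ 0 < alpha /\ alpha < 1 /\
       forall th (j : nat) (s : seq 'I_p), C th -> (size s <= 3)%N ->
         `|pD s (a j) th| <= c * alpha ^+ j /\ `|pD s (b j) th| <= c * alpha ^+ j) ->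
  (* ECF weights *)
  K^T = K ->
  (forall v : 'rV[R]_k, v != 0 -> 0 < (v *m K *m v^T) 0 0) ->
  (* domains *)
  compact Dth -> compact Deta -> compact Dstar ->
  Dth `<=` Gth -> Deta `<=` Geta ->
  Dstar (th0, eta0) -> Dstar `<=` interior (Dth `*` Deta) ->
  (* Condition 3' *)
  (forall th, Dth th ->
     (grad (WP P b (data a th0 dZ)) th = 0 <-> th = th0)) ->
  (forall eta, Deta eta ->
     (grad (WE P u K phi b (data a th0 dZ) th0) eta = 0 <-> eta = eta0)) ->
  (* nonsingularity *)
  hess (WE P u K phi b (data a th0 dZ) th0) eta0 \in unitmx ->
  hess (WP P b (data a th0 dZ)) th0 \in unitmx ->
  (* the PE estimator: a measurably chosen solution in Dth *)
  (forall N, (forall i, measurable_fun setT (fun w => thhat N w 0 i)) /\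
     forall w, Dth (thhat N w) /\
       ((exists th, Dth th /\ pe_score b (data a th0 dZ) N th w = 0) ->
        pe_score b (data a th0 dZ) N (thhat N w) w = 0)) ->
  (* the ECF estimator: a measurably chosen solution in Deta *)
  (forall N, (forall i, measurable_fun setT (fun w => etahat N w 0 i)) /\
     forall w, Deta (etahat N w) /\
       ((exists eta, Deta eta /\
           grad (fun e => VEN u K phi b (data a th0 dZ) N (thhat N w) e w) eta = 0) ->
        grad (fun e => VEN u K phi b (data a th0 dZ) N (thhat N w) e w) (etahat N w) = 0)) ->
  (* conclusion: remainder is O_M^{Q/(2(p+q))}(N^{-1}) *)
  let RE := hess (WE P u K phi b (data a th0 dZ) th0) eta0 in
  let X := fun (N : nat) (w : T) =>
    etahat N w - eta0 +
    (invmx RE *m (N%:R^-1 *: grad (fun e => VEN u K phi b (data a th0 dZ) N (thhat N w) e w) eta0)^T)^T in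
  forall s : R, 1 <= s -> s <= Q%:R / (2 * (p + q)%:R) ->
    exists C : R, 0 < C /\
      forall N : nat, (0 < N)%N ->
        ('E_P[fun w => (`|X N w| `^ s)%R] <= ((C / N%:R) `^ s)%:E)%E.
Proof.
move=> h0 Q2 p1 q1 k1 oGe Ge0 levy phiE CkPhi iidZ cfZ intZ meanZ oGt Gt0 filt Cka cond1 cond2
  KT Kpos cDt cDe cDs DtG DeG Ds0 Dsub gradP gradE uE uP thH etH RE X s s1 sQ.
move: Ge0; rewrite inE => Ge0.
(* From [p + q >= 2], since [s * (2 * (p + q)) <= Q]. *)
have s4 : 2 * (2 * s) <= Q%:R.
  have pq2 : 2 <= (p + q)%:R :> R by rewrite ler_nat (leq_add p1 q1).
  move: sQ; rewrite ler_pdivlMr; last by rewrite mulr_gt0// (lt_le_trans _ pq2).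
  apply: le_trans; rewrite (_ : 2 * (2 * s) = s * (2 * 2)); last by ring.
  by rewrite ler_wpM2l ?(le_trans _ s1)// ler_wpM2l.
have ss2 : 2 <= 2 * s by rewrite ler_peMr.
have s0 : 0 <= s by exact: le_trans s1.
have cfX v : \int[P]_w cos (v * dZ 0 w) =
      complex.Re (levy_increment_cf h (drift eta0) (s2 eta0) (nu eta0) v) /\
    \int[P]_w sin (v * dZ 0 w) =
      complex.Im (levy_increment_cf h (drift eta0) (s2 eta0) (nu eta0) v).
  have [] := cfZ v; rewrite unlock /Rintegral => -> ->.
  by rewrite -phiE.
have [lev s20] := levy eta0 Ge0.
have Q1 : 1 <= Q%:R :> R by rewrite ler1n ltnW.
have [KQ LQ] := increment_moment iidZ lev s20 h0 cfX intZ (lt_le_trans ltr01 Q1) (cond1 _ Q1 (lexx _)).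
have [K1 L1] := Lb_subpow ltr01 Q1 LQ.
have s40 : 0 < 2 * (2 * s) by rewrite !mulr_gt0// (lt_le_trans ltr01).
have [K4 L4] := Lb_subpow s40 s4 LQ.
have [C1 [U1 [cC1 oU1 C1G DU1 UC1]]] := compact_thicken cDt oGt DtG.
have [c [al [c0 [al0 [al1 Hcab]]]]] := cond2 C1 cC1 C1G.
(* The decay rate of Condition 2 is written as a square, so that it can be spent in two halves. *)
have [beta beta01 alE] : exists2 beta : R, 0 < beta < 1 & al = beta ^+ 2.
  exists (Num.sqrt al); last by rewrite sqr_sqrtr// ltW.
  by rewrite sqrtr_gt0 al0 -[ltRHS]sqrtr1 ltr_sqrt.
rewrite {}alE in Hcab.
have [X' [N0 [iidX mN0 PN0 XX' sumX]]] := summable_version iidZ beta01 L1.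
have [rho rho0 [BDt BDe]] := interior_prod_ball (Dsub _ Ds0).
have Dt0 : Dth th0 by apply: BDt; rewrite subrr normr0 ltW.
have De0 : Deta eta0 by apply: BDe; rewrite subrr normr0 ltW.
have dyE n w : ~ N0 w -> data a th0 dZ n w = filtered X' (a ^~ th0) n w.
  by move=> Nw; congr rseries; apply/funext => j; rewrite XX'.
have mX n : measurable_fun setT (X' n) by case: iidX.
have LX : Lb P (2 * (2 * s)) K4 (X' 0) := Lb_ae mN0 PN0 (mX 0) (XX' 0) L4.
have mean0 : \int[P]_w X' 0 w = 0.
  by rewrite (Rintegral_ae mN0 PN0 (XX' 0)) /Rintegral -[RHS]/(fine 0%E) -meanZ unlock.
rewrite (WP_ae mN0 PN0 b dyE) in gradP uP.
have sb j : smooth Gth 3 (b j).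
  apply: (inverse_filter_smooth oGt (a := a)) => [x /filt[? []]//|i].
  by have [] := Cka i.
have U1G : U1 `<=` Gth by exact: subset_trans UC1 C1G.
have sbU j : smooth U1 3 (b j) := smooth_sub U1G (@sb j).
have b_le t j x : (size t <= 3)%N -> U1 x -> `|pD t (b j) x| <= c * (beta ^+ 2) ^+ j.
  by move=> t3 Ux; have [] := Hcab x j t (UC1 x Ux) t3.
have a_le j : `|a j th0| <= c * (beta ^+ 2) ^+ j.
  by have [] := Hcab th0 j [::] (UC1 _ (DU1 _ Dt0)) isT.
have [a0 [_ [bth0 abj]]] := filt th0 (DtG _ Dt0).
have ab0 : a 0%N th0 * b 0%N th0 = 1 by rewrite a0 bth0 mulr1.
have b_le0 j : `|b j th0| <= c * (beta ^+ 2) ^+ j := @b_le [::] j th0 isT (DU1 _ Dt0).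
have c0' : 0 <= c by exact: ltW.
have [Ci Ci0 Hinn] := innovation_error iidX beta01 sumX c0' a_le ss2 LX oU1 sbU b_le cDt DU1 rho0 BDt
  gradP uP ab0 abj.
have [Cp Cp0 Hpe] := Lb_pe_error iidX beta01 sumX c0' a_le ss2 LX mean0.
have [Ce Ce0 Hem] := Lb_empirical_mean iidX ss2.
have [C2 [U2 [cC2 oU2 C2G DU2 UC2]]] := compact_thicken cDe oGe DeG.
have CkF m : Ck 3 Geta (cf_part u phi m).
  by case: m => j []; have [] := CkPhi (u j).
have [M M0 HM] := compact_pD_bound cC2 C2G CkF.
have U2G : U2 `<=` Geta by exact: subset_trans UC2 C2G.
have sF m : smooth U2 3 (cf_part u phi m) := smooth_sub U2G (CkF m).2.
have FM m t (t3 : (size t <= 3)%N) x (Ux : U2 x) : `|pD t (cf_part u phi m) x| <= M :=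
  HM m t x t3 (UC2 x Ux).
have Ue0 : U2 eta0 by exact: DU2.
have tX m : \int[P]_w trig u m (X' 0 w) = cf_part u phi m eta0.
  rewrite (Rintegral_ae mN0 PN0 (f := fun w => trig u m (dZ 0 w))); last first.
    by move=> w Nw; rewrite XX'.
  have [] := cfZ (u m.1); rewrite unlock /Rintegral /trig /cf_part.
  by case: m.2 => [-> _|_ ->].
have epsX w : ~ N0 w -> eps_star b (data a th0 dZ) 0 th0 w = X' 0 w.
  move=> Nw; rewrite -[RHS](inverse_filterK beta01 sumX c0' a_le b_le0 ab0 abj 0 w).
  by congr rseries; apply/funext => j; rewrite dyE.
have [cW HW] := WE_ecf K (mX 0) mN0 PN0 epsX tX.
pose W := ecf_criterion (cf_part u phi) (cf_weight K) (fun m => cf_part u phi m eta0).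
have sPsi tau : smooth U2 3 (ecf_criterion (cf_part u phi) (cf_weight K) tau).
  exact: (smooth_ecf oU2 sF).
have HW1 eta : WE P u K phi b (data a th0 dZ) th0 eta = 1 * W eta + cW by rewrite HW mul1r.
have gW x : U2 x -> grad (WE P u K phi b (data a th0 dZ) th0) x = grad W x.
  by move=> Ux; rewrite (grad_affine oU2 (sPsi _) HW1 Ux) scale1r.
have hW : RE = hess W eta0 by rewrite /RE (hess_affine oU2 (sPsi _) HW1 Ue0) scale1r.
have gradW x : Deta x -> (grad W x = 0 <-> x = eta0).
  by move=> Dx; rewrite -gW; [exact: gradE|exact: DU2].
have uW : hess W eta0 \in unitmx by rewrite -hW.
have [Cf Cf0 Hecf] := ecf_estimate oU2 sF FM M0 cDe DU2 rho0 BDe gradW uW.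
have symW : (hess W eta0)^T = hess W eta0 := hess_ecf_sym _ oU2 sF Ue0.
pose L := \sum_j `|u j|.
have L0 : 0 <= L := sumr_ge0 _ (fun j _ => normr_ge0 (u j)).
have uL j : `|u j| <= L := ler_term_sum j (fun j => normr_ge0 (u j)).
pose y := filtered X' (a ^~ th0).
pose S (m : 'I_k * bool) N w := N%:R^-1 * (\sum_(1 <= n < N.+1) trig u m (X' n%:Z w)) -
  \int[P]_w trig u m (X' 0 w).
pose CL := Ci * (1 + L).
have uCL j : Ci * (1 + `|u j|) <= CL by apply: (ler_wpM2l Ci0); rewrite lerD2l; exact: uL.
have CL0 : 0 <= CL := mulr_ge0 Ci0 (addr_ge0 ler01 L0).
pose E N w := pe_error P X' beta (a ^~ th0) N w.
(* Bounds the error of all trigonometric averages at once: estimated innovations against noise, then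
   averages of the noise against their means. *)
pose Y N w := CL * E N w + \sum_m `|S m N w|.
pose CY := CL * Cp + \sum_(m : 'I_k * bool) Ce.
have r1 : 1 <= 2 * s by apply: le_trans ss2; rewrite ler1n.
have r0 : 0 <= 2 * s by exact: le_trans r1.
have LY N : (0 < N)%N -> Lb P (2 * s) (CY * (Num.sqrt N%:R)^-1) (Y N).
  move=> Np; have -> : CY * (Num.sqrt N%:R)^-1 = CL * (Cp * (Num.sqrt N%:R)^-1) +
      \sum_(m : 'I_k * bool) Ce * (Num.sqrt N%:R)^-1.
    by rewrite /CY [LHS]mulrDl mulr_suml mulrA.
  apply: (LbD r1).
    by have := LbZ CL r0 (Hpe N Np); rewrite (ger0_norm CL0).
  apply: (@Lb_sum _ _ _ P _ (index_enum ('I_k * bool)%type) (2 * s)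
    (fun=> Ce * (Num.sqrt N%:R)^-1) (fun m w => `|S m N w|) r1) => m.
  by apply: Lb_norm; exact: (Hem _ (measurable_trig u m) (trig_le1 u m) N Np).
have Xle N w : (0 < N)%N -> ~ N0 w -> `|X N w| <= Cf * Y N w ^+ 2.
  move=> Np Nw; have Nn0 : N%:R != 0 :> R by rewrite pnatr_eq0 -lt0n.
  have [_ /(_ w)[Dth_ thsol]] := thH N; have [_ /(_ w)[Deta_ etasol]] := etH N.
  pose tau m := N%:R^-1 * \sum_(1 <= n < N.+1) trig u m (eps b y n (thhat N w) w).
  have tauE m : tau m = N%:R^-1 * \sum_(1 <= n < N.+1) trig u m (eps b (data a th0 dZ) n (thhat N w) w).
    by congr (_ * _); apply: eq_bigr => n _; rewrite (eps_ae b dyE n _ Nw).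
  have [cV HV] := VEN_ecf K phi Np tauE.
  have gV x : U2 x -> grad (fun e => VEN u K phi b (data a th0 dZ) N (thhat N w) e w) x =
      N%:R *: grad (ecf_criterion (cf_part u phi) (cf_weight K) tau) x.
    exact: (grad_affine oU2 (sPsi tau) HV).
  have XE : X N w = etahat N w - eta0 +
      grad (ecf_criterion (cf_part u phi) (cf_weight K) tau) eta0 *m invmx (hess W eta0).
    (* The factor [N] of the gradient cancels the normalisation; the transposes turn the column form
       into a row times the inverse of the transposed Hessian. *)
    rewrite /X (gV _ Ue0) scalerA (mulVf Nn0) scale1r trmx_mul trmxK trmx_inv.
    by rewrite hW symW.
  have E0 : 0 <= E N w := pe_error_ge0 P (a ^~ th0) beta01 sumX N w.
  have Y0 : 0 <= Y N w.
    exact: (addr_ge0 (mulr_ge0 CL0 E0) (sumr_ge0 _ (fun m _ => normr_ge0 (S m N w)))).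
  rewrite XE; apply: (Hecf tau (Y N w) _ Y0 _ _ Deta_).
  - by move=> m; apply: (average_le1 Np) => n; exact: trig_le1.
  - move=> m; rewrite -tX.
    apply: (le_trans (ler_distD (N%:R^-1 * \sum_(1 <= n < N.+1) trig u m (X' n%:Z w)) _ _)).
    rewrite /Y; apply: lerD; last exact: (ler_term_sum m (fun m => normr_ge0 (S m N w))).
    have sol : (exists x, Dth x /\ pe_score b y N x w = 0) -> pe_score b y N (thhat N w) w = 0.
      move=> [x [Dx sx]]; rewrite -(pe_score_ae b dyE N _ Nw); apply: thsol.
      by exists x; split; [exact: Dx|rewrite (pe_score_ae b dyE N _ Nw); exact: sx].
    apply: (le_trans (Hinn N w (thhat N w) (trig u m) `|u m.1| Np (normr_ge0 _) (trig_le1 u m)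
      (trig_lipschitz u m) Dth_ sol)).
    exact: (ler_wpM2r E0 (uCL m.1)).
  (* The two gradients differ by the nonzero factor [N], so the root property of the estimator
     carries over. *)
  - move=> [z [Dz gz]].
    have := etasol; rewrite (gV _ (DU2 _ Deta_)) => gsol.
    have : N%:R *: grad (ecf_criterion (cf_part u phi) (cf_weight K) tau) (etahat N w) = 0.
      by apply: gsol; exists z; split; [exact: Dz|rewrite (gV _ (DU2 _ Dz)) gz; exact: scaler0].
    by move/eqP; rewrite scaler_eq0 (negbTE Nn0) => /eqP.
have A0 : 0 <= Cf * CY ^+ 2 := mulr_ge0 Cf0 (sqr_ge0 CY).
(* The added 1 keeps the constant positive even if [Cf] or [CY] vanishes. *)
exists (Cf * CY ^+ 2 + 1); split; first exact: (ltr_wpDl A0 ltr01).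
move=> N Np; rewrite unlock.
apply: (le_trans (square_moment_ae mN0 PN0 s1 Cf0 (LY N Np) (fun w => normr_ge0 (X N w))
  (fun w Nw => Xle N w Np Nw))).
rewrite lee_fin; exact: (powR_sqrt_le CY Cf0 s0 Np).
Qed.
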